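(* Let $M\subset\mathbb R^n$ be a complete Riemannian submanifold of $\mathbb R^n$ (of class at least $C^2$) with the induced metric, and let $S\subset M$ be a nonempty closed prox-regular subset of $M$. If $\gamma:I\to M$ is a weak geodesic on $S$ as a subset of $M$, then $\gamma$ is a weak geodesic on $S$ as a subset of $\mathbb R^n$.
   Context: $I=[0,1]$. $S$ is a nonempty closed subset of $M$, also regarded as a closed subset of $\mathbb R^n$. Let $N$ be a Riemannian manifold (here $N=M$ with the induced metric, or $N=\mathbb R^n$ with the Euclidean metric, in which case $\exp_x^{-1}y=y-x$ and $D_t\dot\gamma=\ddot\gamma$), with Riemannian distance $d$ and covariant derivative $D_t$ along curves. A convex set is a set in which any two points are joined by a unique minimizing geodesic of $N$, which lies in the set; then $\exp_x^{-1}y$ denotes the initial velocity at $x$ of the minimizing geodesic $[0,1]\to N$ from $x$ to $y$. Proximal normal cone: for $S\subseteq N$ closed and $x\in S$, $\xi\in T_xN$ belongs to the proximal normal cone $N^P_S(x)$ of $S$ in $N$ iff there exist $\sigma>0$ and a convex neighborhood $U$ of $x$ in $N$ with $\langle\xi,\exp_x^{-1}y\rangle\le\sigma d^2(x,y)$ for all $y\in U\cap S$. Prox-regularity: a closed set $S\subseteq N$ is prox-regular at $\bar x\in S$ if there exist $\varepsilon>0,\sigma>0$ such that $B(\bar x,\varepsilon)$ is convex and $\langle v,\exp_x^{-1}y\rangle\le\sigma d^2(x,y)$ for all $x,y\in S\cap B(\bar x,\varepsilon)$ and all $v\in N^P_S(x)$ with $\|v\|<\varepsilon$. $S$ is prox-regular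 if it is so at each of its points. Sobolev curves: $W^{2,2}(I,N)$ is the set of continuous curves $\gamma:I\to N$ with $\Phi\circ\gamma\in W^{2,2}(I,\mathbb R^{2\dim N+1})$, where $\Phi:N\to\mathbb R^{2\dim N+1}$ is a fixed embedding. Weak geodesic: a continuous curve $\gamma:I\to N$ is a weak geodesic on $S$ as a subset of $N$ (joining $\gamma(0)$ and $\gamma(1)$) if $\gamma(t)\in S$ for all $t\in I$, $\gamma\in W^{2,2}(I,N)$, and $D_t\dot\gamma(t)\in N^P_S(\gamma(t))$ for a.e. $t\in I$, where $D_t$ and $N^P_S$ are taken in $N$. *)

(* Defs.v *)
From HB Require Import structures.
From mathcomp Require Import all_boot all_order all_algebra.
From mathcomp Require Import all_classical all_reals all_analysis.

Set Implicit Arguments.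
Unset Strict Implicit.
Unset Printing Implicit Defensive.

Import Order.TTheory GRing.Theory Num.Theory.
Import numFieldNormedType.Exports.

Local Open Scope classical_set_scope.
Local Open Scope ring_scope.

(* In [ring_scope] these otherwise denote the formal derivative of polynomials. *)
Local Notation "f ^` ()" := (derive1 f) : ring_scope.
Local Notation "f ^` ( k )" := (derive1n k f) : ring_scope.

Section Calculus.
Context {R : realType}.

(* The library norm on ['rV[R]_n] is the sup norm, hence these. *)
Definition inner n (u v : 'rV[R]_n) : R := \sum_i u 0 i * v 0 i.
Definition enorm n (u : 'rV[R]_n) : R := Num.sqrt (inner u u).

(* Functions of class C^k on an open set [U]. *)
Fixpoint Ck (k : nat) (V W : normedModType R) (U : set V) (f : V -> W) : Prop :=
  match k with
  | 0 => forall u, U u -> {for u, continuous f}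
  | k'.+1 => (forall u, U u -> differentiable f u) /\
             forall v, Ck k' U ('D_v f)
  end.

Definition immersive m n (U : set 'rV[R]_m) (f : 'rV[R]_m -> 'rV[R]_n) : Prop :=
  forall u, U u -> injective ('d f u : 'rV[R]_m -> 'rV[R]_n).

Definition homeo_onto_image m n (A : set 'rV[R]_m) (f : 'rV[R]_m -> 'rV[R]_n)
    : Prop :=
  {within A, continuous f} /\
  exists2 g : 'rV[R]_n -> 'rV[R]_m,
    (forall x, A x -> g (f x) = x) & {within f @` A, continuous g}.

End Calculus.

(* Curves [I -> N] are represented by functions on all of [R]; unless stated
   otherwise only their values on [I] matter. *)
Notation II := (`[0%R, 1%R]%classic).

Section Submanifolds.
Context {R : realType} {n : nat}.
Implicit Types (N S : set 'rV[R]_n) (x y v w xi : 'rV[R]_n) (c : R -> 'rV[R]_n).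

(* [phi : U -> N] is a C^2 local parametrization of [N] by an open subset of
   R^m: it is a C^2 immersion and a homeomorphism onto an open subset of [N]. *)
Definition chart m N (U : set 'rV[R]_m) (phi : 'rV[R]_m -> 'rV[R]_n) : Prop :=
  [/\ open U, Ck 2 U phi, immersive U phi, homeo_onto_image U phi &
      exists2 V, open V & phi @` U = N `&` V].

(* [N] is an embedded [m]-dimensional C^2 submanifold of R^n. *)
Definition submanifold m N : Prop :=
  forall x, N x -> exists U (phi : 'rV[R]_m -> 'rV[R]_n),
    chart N U phi /\ (phi @` U) x.

Definition tangent m N x xi : Prop :=
  exists U (phi : 'rV[R]_m -> 'rV[R]_n) u h,
    [/\ chart N U phi, U u, phi u = x & xi = 'D_h phi u].

(* The induced metric g_ij = <d_i phi, d_j phi> in a chart, and the Christoffel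
   symbols Gamma^k_ij of its Levi-Civita connection. *)
Definition metric m (phi : 'rV[R]_m -> 'rV[R]_n) (u : 'rV[R]_m) : 'M[R]_m :=
  \matrix_(i, j) inner ('D_(delta_mx 0 i) phi u) ('D_(delta_mx 0 j) phi u).

Definition dmetric m (phi : 'rV[R]_m -> 'rV[R]_n) (l i j : 'I_m)
    (u : 'rV[R]_m) : R :=
  'D_(delta_mx 0 l) (fun h => metric phi h i j : R) u.

Definition christoffel m (phi : 'rV[R]_m -> 'rV[R]_n) (k i j : 'I_m)
    (u : 'rV[R]_m) : R :=
  2^-1 * \sum_l invmx (metric phi u) k l *
    (dmetric phi i j l u + dmetric phi j i l u - dmetric phi l i j u).

(* [D_t c'(t)] exists and equals [w]: writing [c = phi \o z] near [t] with
   [z] twice differentiable at [t],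
   w = \sum_k (z_k'' + \sum_ij Gamma^k_ij z_i' z_j') d_k phi. *)
Definition covariant_acceleration m N c (t : R) w : Prop :=
  exists U (phi : 'rV[R]_m -> 'rV[R]_n) (z : R -> 'rV[R]_m),
    [/\ chart N U phi,
        \forall s \near t, [/\ U (z s), c s = phi (z s) & derivable z s 1],
        derivable (z^`()) t 1 &
        w = \sum_k (z^`(2) t 0 k +
                    \sum_i \sum_j christoffel phi k i j (z t) *
                                  z^`() t 0 i * z^`() t 0 j)
                   *: 'D_(delta_mx 0 k) phi (z t)].

(* Geodesics [I -> N]: as usual for smoothness on a closed interval, the
   equation is required on an open interval containing [I]. *)
Definition geodesic m N c : Prop :=
  exists2 e : R, 0 < e &
    forall t, - e < t < 1 + e -> covariant_acceleration m N c t 0.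

(* [s] is the increasing list of break points, the last of which is 1. *)
Definition piecewise_C1 c : Prop :=
  exists s : seq R, [/\ path <%R 0 s, last 0 s = 1 &
    forall i, (i < size s)%N -> exists g : R -> 'rV[R]_n,
      Ck 1 setT g /\
      forall t, nth 0 (0 :: s) i <= t <= nth 0 s i -> c t = g t].

Definition curve_length c : \bar R :=
  (\int[lebesgue_measure]_(t in II) (enorm (c^`() t))%:E)%E.

(* Riemannian distance ([+oo] between distinct connected components). *)
Definition rdist N x y : \bar R :=
  ereal_inf [set curve_length c | c in
    [set c | [/\ piecewise_C1 c, forall t, II t -> N (c t), c 0 = x & c 1 = y]]].

Definition complete_metric N : Prop :=
  forall u : nat -> 'rV[R]_n, (forall k, N (u k)) ->
    (forall e : R, 0 < e -> exists K, forall i j, (K <= i)%N -> (K <= j)%N ->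
       (rdist N (u i) (u j) < e%:E)%E) ->
    exists2 x, N x & rdist N (u k) x @[k --> \oo] --> 0%E.

Definition minimizing_geodesic m N x y c : Prop :=
  [/\ geodesic m N c, c 0 = x, c 1 = y & curve_length c = rdist N x y].

Definition convex_in m N (U : set 'rV[R]_n) : Prop :=
  U `<=` N /\
  forall x y, U x -> U y -> exists c,
    [/\ minimizing_geodesic m N x y c,
        forall t, II t -> U (c t) &
        forall c', minimizing_geodesic m N x y c' -> {in II, c' =1 c}].

(* exp_x^{-1} y; meaningful only when [x] and [y] lie in a common convex set. *)
Definition exp_inv m N x y : 'rV[R]_n :=
  get [set w | exists2 c, minimizing_geodesic m N x y c & w = c^`() 0].

Definition proximal_normal m N S x xi : Prop :=
  tangent m N x xi /\
  exists sigma : R, exists U : set 'rV[R]_n,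
    [/\ 0 < sigma, convex_in m N U, within N (nbhs x) U &
        forall y, U y -> S y ->
          ((inner xi (exp_inv m N x y))%:E <= sigma%:E * rdist N x y ^+ 2)%E].

Definition rball N x (e : R) : set 'rV[R]_n :=
  [set y | N y /\ (rdist N x y < e%:E)%E].

Definition prox_regular_at m N S (xb : 'rV[R]_n) : Prop :=
  exists e sigma : R,
    [/\ 0 < e, 0 < sigma, convex_in m N (rball N xb e) &
        forall x y, S x -> S y -> rball N xb e x -> rball N xb e y ->
        forall v, proximal_normal m N S x v -> enorm v < e ->
          ((inner v (exp_inv m N x y))%:E <= sigma%:E * rdist N x y ^+ 2)%E].

Definition prox_regular m N S : Prop :=
  forall x, S x -> prox_regular_at m N S x.

Definition closed_in N S : Prop := exists2 F, closed F & S = N `&` F.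

(* C^2 embeddings of the [m]-dimensional submanifold [N] in R^p. *)
Definition embedding m N p (Phi : 'rV[R]_n -> 'rV[R]_p) : Prop :=
  (forall U (phi : 'rV[R]_m -> 'rV[R]_n), chart N U phi ->
     Ck 2 U (Phi \o phi) /\ immersive U (Phi \o phi)) /\
  homeo_onto_image N Phi.

End Submanifolds.

Section Sobolev.
Context {R : realType}.
Implicit Types u g phi : R -> R.

Definition L2 u : Prop :=
  measurable_fun (II : set R) u /\
  lebesgue_measure.-integrable II (fun t => (u t ^+ 2)%:E).

(* C^1 functions with compact support in the interior of [I] *)
Definition test_function phi : Prop :=
  Ck 1 setT phi /\
  exists a b : R, [/\ 0 < a, b < 1 & forall t, ~~ (a <= t <= b) -> phi t = 0].

Definition weak_derivative u g : Prop :=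
  forall phi, test_function phi ->
    \int[lebesgue_measure]_(t in II) (u t * phi^`() t) =
    - \int[lebesgue_measure]_(t in II) (g t * phi t).

Fixpoint W2 (k : nat) u : Prop :=
  match k with
  | 0 => L2 u
  | k'.+1 => L2 u /\ exists g, weak_derivative u g /\ W2 k' g
  end.

Definition W22 p (c : R -> 'rV[R]_p) : Prop :=
  forall i : 'I_p, W2 2 (fun t => c t 0 i).

End Sobolev.

Section WeakGeodesics.
Context {R : realType} {n : nat}.

(* [Phi] is the fixed embedding of [N] with respect to which W^{2,2}(I, N)
   is defined. *)
Definition weak_geodesic m (N : set 'rV[R]_n) p (Phi : 'rV[R]_n -> 'rV[R]_p)
    (S : set 'rV[R]_n) (gamma : R -> 'rV[R]_n) : Prop :=
  [/\ {within II, continuous gamma},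
      forall t, II t -> S (gamma t),
      W22 (Phi \o gamma) &
      {ae lebesgue_measure, forall t, II t ->
         exists2 w, covariant_acceleration m N gamma t w &
                    proximal_normal m N S (gamma t) w}].

End WeakGeodesics.

(* Main.v *)
Require Import Defs.
From HB Require Import structures.
From mathcomp Require Import all_boot all_order all_algebra.
From mathcomp Require Import all_classical all_reals all_analysis.
From mathcomp Require Import measurable_realfun.
From mathcomp Require Import ring lra.
Import Order.TTheory GRing.Theory Num.Theory.
Import numFieldNormedType.Exports.
Set Implicit Arguments.
Unset Strict Implicit.
Unset Printing Implicit Defensive.
Local Open Scope classical_set_scope.
Local Open Scope ring_scope.

(** Two things are transported from [M] to R^n: the differential inclusion,
which is a pointwise statement, and the Sobolev regularity of the curve.

The inclusion. Let [t] be a time at which the covariant acceleration [w] of the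
curve [c] in [M] exists and is a proximal normal to [S] at [x = c t]. In a chart
the curve is twice differentiable at [t], so its acceleration [a] in R^n exists,
and [a - w] is orthogonal to the tangent space of [M] at [x] ([gauss_formula]).
For [y] in [S] close to [x], let [v] be the initial velocity of the minimizing
geodesic of [M] from [x] to [y]; then
  <a, y - x> = <a - w, y - x> + <w, v> + <w, y - x - v>,
and each term is at most a constant times |y - x|^2. The first one, because [M]
leaves its tangent space only to second order. The second one, because [w] is
proximal and the Riemannian distance is at most a constant times the Euclidean
one ([rdist_chart_le]). The third one, because the acceleration of a geodesic
is normal to [M] and quadratic in its speed |v|, the Riemannian distance
([geodesic_taylor]). So [a] is a proximal normal to [S] in R^n, where geodesics
are segments, the distance is |y - x| and the inverse of the exponential map at
[x] is [y - x] ([proximal_acceleration]).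

The regularity. Membership of a continuous curve in W^{2,2} does not depend on
the embedding that is used to define it ([W22_embedding_change]). In one
variable, a continuous function in W^{2,2} is C^1 on the open interval and its
derivative extends continuously to the closed one, with a weak derivative in L^2
([W22_regular], from the lemma [du_bois_reymond]). Let [G] be the derivative
of [Phi \o c]. Then the velocity of [c] is [G *m Q], where
Q = A^T (A A^T)^{-1} B for the Jacobian matrices [A] of [Phi \o phi] and [B] of
[phi] at the coordinates of the curve in a chart [phi]. The matrix [Q] is the
same in all charts, and it is a C^1 function of time, for the coordinates of the
curve are. Hence the velocity of [Psi \o c], for another C^2 map [Psi], has
components of the form \sum_i G_i q_i with C^1 functions [q_i], and the product
rule for weak derivatives concludes ([W22_of_product]). *)

(** * Norms, inner products and Gram matrices *)

Section Linear.
Context {R : realType}.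

Lemma normv_coord m n (A : 'M[R]_(m, n)) i j : `|A i j| <= `|A|.
Proof. by rewrite [leRHS]/Num.norm/= mx_normrE; exact: (le_bigmax _ _ (i, j)). Qed.

Lemma normv_le m n (A : 'M[R]_(m, n)) c :
  0 <= c -> (forall i j, `|A i j| <= c) -> `|A| <= c.
Proof.
by move=> c0 h; rewrite [leLHS]/Num.norm/= mx_normrE bigmax_le// => -[i j] _; exact: h.
Qed.

Lemma norm_mulmx_le m n p (A : 'M[R]_(p, m)) (P : 'M[R]_(m, n)) :
  `|A *m P| <= m%:R * `|P| * `|A|.
Proof.
apply: normv_le => [|i j]; first by rewrite !mulr_ge0.
rewrite mxE (le_trans (ler_norm_sum _ _ _))//.
have -> : m%:R * `|P| * `|A| = \sum_(k < m) (`|A| * `|P|).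
  by rewrite sumr_const card_ord -mulr_natl; ring.
by apply: ler_sum => k _; rewrite normrM ler_pM// normv_coord.
Qed.

Lemma innerC n (u v : 'rV[R]_n) : inner u v = inner v u.
Proof. by apply: eq_bigr => i _; rewrite mulrC. Qed.

Lemma innerE n (u v : 'rV[R]_n) : inner u v = (u *m v^T) 0 0.
Proof. by rewrite mxE; apply: eq_bigr => i _; rewrite mxE. Qed.

Lemma innerDl n (u v w : 'rV[R]_n) : inner (u + v) w = inner u w + inner v w.
Proof. by rewrite !innerE mulmxDl mxE. Qed.
Lemma innerDr n (u v w : 'rV[R]_n) : inner w (u + v) = inner w u + inner w v.
Proof. by rewrite ![inner w _]innerC innerDl. Qed.
Lemma innerZl n c (u w : 'rV[R]_n) : inner (c *: u) w = c * inner u w.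
Proof. by rewrite !innerE -scalemxAl mxE. Qed.
Lemma innerZr n c (u w : 'rV[R]_n) : inner w (c *: u) = c * inner w u.
Proof. by rewrite ![inner w _]innerC innerZl. Qed.
Lemma innerNl n (u w : 'rV[R]_n) : inner (- u) w = - inner u w.
Proof. by rewrite -scaleN1r innerZl mulN1r. Qed.
Lemma innerNr n (u w : 'rV[R]_n) : inner w (- u) = - inner w u.
Proof. by rewrite ![inner w _]innerC innerNl. Qed.
Lemma innerBl n (u v w : 'rV[R]_n) : inner (u - v) w = inner u w - inner v w.
Proof. by rewrite innerDl innerNl. Qed.
Lemma innerBr n (u v w : 'rV[R]_n) : inner w (u - v) = inner w u - inner w v.
Proof. by rewrite innerDr innerNr. Qed.
Lemma inner0l n (w : 'rV[R]_n) : inner 0 w = 0.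
Proof. by rewrite innerE mul0mx mxE. Qed.
Lemma inner0r n (w : 'rV[R]_n) : inner w 0 = 0.
Proof. by rewrite innerC inner0l. Qed.
Lemma inner_suml n m (u : 'I_m -> 'rV[R]_n) w :
  inner (\sum_i u i) w = \sum_i inner (u i) w.
Proof.
by elim/big_rec2: _ => [|i a b _ <-]; rewrite ?inner0l// innerDl.
Qed.

Lemma inner_ge0 n (u : 'rV[R]_n) : 0 <= inner u u.
Proof. by apply: sumr_ge0 => i _; rewrite -expr2 sqr_ge0. Qed.

Lemma norm2_le_inner n (u : 'rV[R]_n) : `|u| ^+ 2 <= inner u u.
Proof.
rewrite -ler_sqrt ?inner_ge0// sqrtr_sqr normr_id.
apply: normv_le; first exact: sqrtr_ge0.
move=> i j; rewrite -sqrtr_sqr ler_sqrt ?inner_ge0//.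
rewrite /inner (bigD1 j)//= ord1 expr2 lerDl sumr_ge0// => k _.
by rewrite -expr2 sqr_ge0.
Qed.

Lemma norm_inner_le n (u v : 'rV[R]_n) : `|inner u v| <= n%:R * `|u| * `|v|.
Proof.
rewrite (le_trans (ler_norm_sum _ _ _))//.
have -> : n%:R * `|u| * `|v| = \sum_(k < n) (`|u| * `|v|).
  by rewrite sumr_const card_ord -mulr_natl; ring.
by apply: ler_sum => k _; rewrite normrM ler_pM// normv_coord.
Qed.

Lemma inner_le n (u v : 'rV[R]_n) : inner u v <= n%:R * `|u| * `|v|.
Proof. exact: le_trans (ler_norm _) (norm_inner_le _ _). Qed.

Lemma inner_eq0 n (u : 'rV[R]_n) : inner u u = 0 -> u = 0.
Proof.
move=> h; apply/eqP; rewrite -normr_eq0 -sqrf_eq0 eq_le sqr_ge0 andbT.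
by rewrite -h norm2_le_inner.
Qed.

Lemma cauchy_schwarz n (u v : 'rV[R]_n) : inner u v <= enorm u * enorm v.
Proof.
have [->|v0] := eqVneq v 0; first by rewrite inner0r mulr_ge0 ?sqrtr_ge0.
have vv : 0 < inner v v.
  by rewrite lt_neqAle inner_ge0 andbT eq_sym; apply/negP => /eqP /inner_eq0 /eqP; exact/negP.
rewrite /enorm -sqrtrM ?inner_ge0//.
have [h|/ltW h] := leP (inner u v) 0; first by rewrite (le_trans h)// sqrtr_ge0.
rewrite -(ger0_norm h) -sqrtr_sqr ler_sqrt ?mulr_ge0 ?inner_ge0//.
have := inner_ge0 (inner v v *: u - inner u v *: v).
rewrite innerBl !innerBr !innerZl !innerZr (innerC v u).
set a := inner u u; set b := inner u v; set c := inner v v.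
have -> : c * (c * a) - c * (b * b) - (b * (c * b) - b * (b * c)) = c * (a * c - b ^+ 2) by ring.
by rewrite pmulr_rge0// subr_ge0.
Qed.

Lemma enorm_sqr n (u : 'rV[R]_n) : enorm u ^+ 2 = inner u u.
Proof. by rewrite sqr_sqrtr// inner_ge0. Qed.

Lemma enorm_ge0 n (u : 'rV[R]_n) : 0 <= enorm u.
Proof. exact: sqrtr_ge0. Qed.

Lemma enormZ n c (u : 'rV[R]_n) : enorm (c *: u) = `|c| * enorm u.
Proof.
by rewrite /enorm innerZl innerZr mulrA -expr2 sqrtrM ?sqr_ge0// sqrtr_sqr.
Qed.

Lemma enorm_triangle n (u v : 'rV[R]_n) : enorm (u + v) <= enorm u + enorm v.
Proof.
rewrite -(ler_pXn2r (n := 2)) ?nnegrE ?addr_ge0 ?enorm_ge0//.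
rewrite enorm_sqr innerDl !innerDr (innerC v u) sqrrD !enorm_sqr.
have := cauchy_schwarz u v; lra.
Qed.

Lemma norm_le_enorm n (u : 'rV[R]_n) : `|u| <= enorm u.
Proof. by rewrite -(ler_pXn2r (n := 2)) ?nnegrE ?enorm_ge0// enorm_sqr norm2_le_inner. Qed.

Lemma enorm_le_norm n (u : 'rV[R]_n) : enorm u <= n%:R * `|u|.
Proof.
rewrite -(ler_pXn2r (n := 2)) ?nnegrE ?enorm_ge0 ?mulr_ge0// enorm_sqr.
apply: le_trans (inner_le _ _) _; rewrite -mulrA -expr2 exprMn ler_wpM2r ?sqr_ge0//.
by rewrite -natrX ler_nat; case: n {u} => // k; rewrite leq_pmulr.
Qed.

(** The Moore-Penrose inverse of a matrix of full row rank. The adjugate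
makes its entries visibly rational functions of those of [A]. *)
Definition right_inverse_mx m n (A : 'M[R]_(m, n)) : 'M[R]_(n, m) :=
  A^T *m ((\det (A *m A^T))^-1 *: \adj (A *m A^T)).

(** A row vector [v] with [v *m (A *m A^T) = 0] satisfies |v A|^2 = 0, and
[A] has a right inverse. *)
Lemma gram_unit m n (A : 'M[R]_(m, n)) P : A *m P = 1%:M -> A *m A^T \in unitmx.
Proof.
move=> AP; rewrite -row_free_unit; apply/inj_row_free => v vG.
have v0 : v *m A = 0.
  by apply: inner_eq0; rewrite innerE trmx_mul mulmxA -[v *m _ *m _]mulmxA vG mul0mx mxE.
by rewrite -[v]mulmx1 -AP mulmxA v0 mul0mx.
Qed.

Lemma right_inverse_mxE m n (A : 'M[R]_(m, n)) P :
  A *m P = 1%:M -> A *m right_inverse_mx A = 1%:M.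
Proof.
move=> AP; have G := gram_unit AP.
by have := mulmxV G; rewrite /invmx G mulmxA.
Qed.

End Linear.

(** * Differential calculus *)

Section DiffCalc.
Context {R : realType}.

(** The estimates below compare increments along curves that are not known
in advance to be differentiable; this quantified form of the derivative is the
one that they establish. *)
Lemma is_derive_littleo (V : normedModType R) (c : R -> V) (t : R) (w : V) :
  is_derive t 1 c w <->
  forall e : R, 0 < e -> \forall s \near t, `|c s - c t - (s - t) *: w| <= e * `|s - t|.
Proof.
split=> [[dc <-] e e0|h].
  move: dc => /cvg_ex[l lc].
  have lE : 'D_1 c t = l by apply: cvg_lim.
  rewrite lE; move/cvgrPdist_le: lc => /(_ e e0) [d /= d0 H].
  exists d => // s /=; rewrite distrC => st.
  have [->|nst] := eqVneq s t; first by rewrite !subrr scale0r subrr !normr0 mulr0.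
  have nst0 : s - t != 0 by rewrite subr_eq0.
  have := H (s - t); rewrite /= sub0r normrN => /(_ st nst0).
  rewrite /= [_%:A]mulr1 subrK => H1.
  rewrite -ler_pdivrMr ?normr_gt0// mulrC -normfV -normrZ.
  by rewrite scalerBr scalerA mulVf// scale1r -normrN opprB.
have hl : (fun h => h^-1 *: (c (h *: 1 + t) - c t)) @ 0^' --> w.
  apply/cvgrPdist_le => e e0; have [d /= d0 H] := h e e0.
  exists d => // x /=; rewrite /ball_ sub0r normrN => xd x0.
  have := H (x + t); rewrite /= opprD addrCA subrr addr0 normrN => /(_ xd).
  rewrite addrK [_%:A]mulr1 => H1.
  rewrite -[w](scalerK x0) -scalerBr normrZ normfV ler_pdivrMl ?normr_gt0//.
  by rewrite -normrN opprB mulrC.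
split; first by apply/cvg_ex; exists w.
exact: cvg_lim.
Qed.

Lemma differentiable_littleo m n (f : 'rV[R]_m -> 'rV[R]_n) u :
  differentiable f u ->
  forall e : R, 0 < e -> \forall v \near u, `|f v - f u - (v - u) *m 'J f u| <= e * `|v - u|.
Proof.
move=> df e e0.
have := diff_locally df => /eqaddoP /(_ e e0) /nbhs_ballP[d /= d0].
rewrite -ball_normE => H; apply/nbhs_ballP; exists d => // v; rewrite -ball_normE /= distrC => vd.
have := H (v - u); rewrite /= sub0r normrN => /(_ vd).
rewrite !fctE /= subrK => h; apply: le_trans h.
by rewrite -deriveEjacobian// deriveE// opprD addrA.
Qed.

Lemma derivable_diff (V : normedModType R) (c : R -> V) (t : R) (w : V) :
  is_derive t 1 c w -> is_diff t c (fun h => h *: w).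
Proof.
move=> cw; have dc : derivable c t 1 by [].
apply: DiffDef; first exact/derivable1_diffP.
by rewrite deriv1E// derive1E derive_val.
Qed.

Lemma is_derive_compv m n (f : 'rV[R]_m -> 'rV[R]_n) (c : R -> 'rV[R]_m) (t : R) (w : 'rV[R]_m) :
  differentiable f (c t) -> is_derive t 1 c w ->
  is_derive t 1 (f \o c) (w *m 'J f (c t)).
Proof.
move=> df cw; have cd := derivable_diff cw.
have dfc : differentiable (f \o c) t by apply: differentiable_comp.
apply: DeriveDef; first exact/derivable1_diffP.
rewrite -derive1E derive1E'// diff_comp//= diff_val scale1r.
by rewrite -deriveE// deriveEjacobian.
Qed.

Lemma is_derive_line (V W : normedModType R) (f : V -> W) (u h : V) (t : R) :
  derivable f (t *: h + u) h ->
  is_derive t 1 (fun s : R => f (s *: h + u)) ('D_h f (t *: h + u)).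
Proof.
move=> df.
have E : (fun k : R => k^-1 *: (((fun s : R => f (s *: h + u)) \o shift t) (k *: 1) - f (t *: h + u)))
  = (fun k : R => k^-1 *: ((f \o shift (t *: h + u)) (k *: h) - f (t *: h + u))).
  by apply/funext => k /=; rewrite [_%:A]mulr1 scalerDl addrA.
split; first by rewrite /derivable E.
by rewrite /derive E.
Qed.

Lemma is_deriveE (V W : normedModType R) (f : V -> W) t v w :
  is_derive t v f w -> 'D_v f t = w.
Proof. by case. Qed.

Lemma is_derive1E (W : normedModType R) (f : R -> W) (t : R) w :
  is_derive t 1 f w -> derive1 f t = w.
Proof. by rewrite derive1E => /is_deriveE. Qed.

Lemma is_derive1P (W : normedModType R) (f : R -> W) (t : R) :
  derivable f t 1 -> is_derive t 1 f (derive1 f t).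
Proof. by rewrite derive1E; exact: derivableP. Qed.

Lemma is_derive_uniq (V W : normedModType R) (f : V -> W) t v w w' :
  is_derive t v f w -> is_derive t v f w' -> w = w'.
Proof. by move=> /is_deriveE <- /is_deriveE <-. Qed.

Lemma is_derive_affine (V : normedModType R) (h u : V) (t : R) :
  is_derive t 1 (fun s : R => s *: h + u) h.
Proof.
have d : derivable id (t *: h + u) h by exact: derivable_id.
by have := is_derive_line d; rewrite derive_id.
Qed.

Lemma is_derive_continuous (V : normedModType R) (f : R -> V) (t : R) w :
  is_derive t 1 f w -> {for t, continuous f}.
Proof. by case=> d _; apply: differentiable_continuous; apply/derivable1_diffP. Qed.

Lemma MVT_closed (f df : R -> R) (a b : R) : a <= b ->
  (forall x, a <= x <= b -> is_derive x 1 f (df x)) ->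
  exists2 c, a <= c <= b & f b - f a = df c * (b - a).
Proof.
move=> ab h; have [||c cI E] := @MVT_segment R f df a b ab.
- by move=> x; rewrite in_itv/= => /andP[? ?]; apply: h; rewrite !ltW.
- by apply: derivable_within_continuous => x; rewrite in_itv/= => /h[].
by exists c.
Qed.

Lemma inner_row m n (A : 'M[R]_(m, n)) i j : inner (row i A) (row j A) = (A *m A^T) i j.
Proof. by rewrite mxE; apply: eq_bigr => k _; rewrite !mxE. Qed.

Lemma is_derive_mxP (V : normedModType R) m n (c : V -> 'M[R]_(m, n)) t v w :
  is_derive t v c w <-> forall i j, is_derive t v (fun s => c s i j) (w i j).
Proof.
split=> [[dc <-] i j|h].
  by split; [exact: (derivable_mxP _ _ _).1|rewrite derive_mx// mxE].
have dc : derivable c t v by apply/derivable_mxP => i j; case: (h i j).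
split=> //; rewrite derive_mx//; apply/matrixP => i j.
by rewrite mxE; case: (h i j).
Qed.

Lemma is_derive_bigsum (V : normedModType R) n (c : 'I_n -> V -> R) t v w :
  (forall i, is_derive t v (c i) (w i)) ->
  is_derive t v (fun s => \sum_i c i s) (\sum_i w i).
Proof.
move=> h; have -> : (fun s => \sum_i c i s) = \sum_i c i.
  by apply/funext => s; rewrite fct_sumE.
exact: is_derive_sum.
Qed.

Lemma is_derive_mulr (V : normedModType R) (f g : V -> R) t v df dg :
  is_derive t v f df -> is_derive t v g dg ->
  is_derive t v (fun s => f s * g s) (df * g t + f t * dg).
Proof.
move=> hf hg; apply: (@is_derive_eq _ _ _ (f * g)); rewrite addrC [df * _]mulrC.
by [].
Qed.

Lemma is_derive_mulmx (V : normedModType R) m n p (A : V -> 'M[R]_(m, n))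
    (B : V -> 'M[R]_(n, p)) t v dA dB :
  is_derive t v A dA -> is_derive t v B dB ->
  is_derive t v (fun s => A s *m B s) (dA *m B t + A t *m dB).
Proof.
move=> /is_derive_mxP hA /is_derive_mxP hB; apply/is_derive_mxP => i j.
have -> : (fun s => (A s *m B s) i j) = (fun s => \sum_k A s i k * B s k j).
  by apply/funext => s; rewrite mxE.
rewrite !mxE -big_split/=; apply: is_derive_bigsum => k.
exact: is_derive_mulr.
Qed.

Lemma is_derive_inner (V : normedModType R) n (c d : V -> 'rV[R]_n) t v w z :
  is_derive t v c w -> is_derive t v d z ->
  is_derive t v (fun s => inner (c s) (d s)) (inner w (d t) + inner (c t) z).
Proof.
move=> /is_derive_mxP hA /is_derive_mxP hB; rewrite /inner -big_split/=.
by apply: is_derive_bigsum => k; apply: is_derive_mulr.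
Qed.

Lemma is_derive_innerl (V : normedModType R) n (c : V -> 'rV[R]_n) a t v w :
  is_derive t v c w -> is_derive t v (fun s => inner a (c s)) (inner a w).
Proof.
move=> h; apply: is_derive_eq; first exact: (is_derive_inner (is_derive_cst a t v) h).
by rewrite inner0l add0r.
Qed.

Lemma cvg_mxP (T : Type) (F : set_system T) {FF : Filter F} m n
    (M : T -> 'M[R]_(m, n)) (A : 'M[R]_(m, n)) :
  M x @[x --> F] --> A <-> forall i j, (M x i j) @[x --> F] --> A i j.
Proof.
split=> [h i j|h].
  by apply: (cvg_comp M (fun N : 'M[R]_(m, n) => N i j) h); exact: coord_continuous.
apply/cvgrPdist_le => e e0; near=> x; apply: normv_le; first exact: ltW.
have H : forall ij : 'I_m * 'I_n, `|A ij.1 ij.2 - M x ij.1 ij.2| <= e.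
  near: x; apply: filter_forall => -[i j] /=.
  by move: (h i j) => /cvgrPdist_le; exact.
by move=> i j; rewrite !mxE; exact: (H (i, j)).
Unshelve. all: by end_near. Qed.

Lemma continuous_mxP (T : topologicalType) m n (M : T -> 'M[R]_(m, n)) x :
  {for x, continuous M} <-> forall i j, {for x, continuous (fun y => M y i j)}.
Proof. exact: cvg_mxP. Qed.

Lemma cvg_bigsum (T : Type) (F : set_system T) {FF : Filter F} n (f : 'I_n -> T -> R) l :
  (forall i, f i x @[x --> F] --> l i) ->
  (\sum_i f i x) @[x --> F] --> \sum_i l i.
Proof. by move=> h; apply: cvg_big => // ; exact: add_continuous. Qed.

Lemma cvg_mulmx (T : Type) (F : set_system T) {FF : Filter F} m n p
    (M : T -> 'M[R]_(m, n)) (N : T -> 'M[R]_(n, p)) (A : 'M[R]_(m, n)) (B : 'M[R]_(n, p)) :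
  M x @[x --> F] --> A -> N x @[x --> F] --> B ->
  (M x *m N x) @[x --> F] --> A *m B.
Proof.
move=> /cvg_mxP hM /cvg_mxP hN; apply/cvg_mxP => i j; rewrite mxE.
have -> : (fun x => (M x *m N x) i j) = (fun x => \sum_k M x i k * N x k j).
  by apply/funext => x; rewrite mxE.
by apply: cvg_bigsum => k; apply: cvgM.
Qed.

Lemma cvg_inner (T : Type) (F : set_system T) {FF : Filter F} n
    (c d : T -> 'rV[R]_n) (a b : 'rV[R]_n) :
  c x @[x --> F] --> a -> d x @[x --> F] --> b ->
  inner (c x) (d x) @[x --> F] --> inner a b.
Proof.
move=> /cvg_mxP hM /cvg_mxP hN.
by apply: cvg_bigsum => k; apply: cvgM.
Qed.

Lemma near_eq_continuous (T S : topologicalType) (f g : T -> S) x :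
  (\forall y \near x, f y = g y) -> {for x, continuous f} -> {for x, continuous g}.
Proof.
move=> fg; rewrite /prop_for /continuous_at -(nbhs_singleton fg) => h.
by apply: cvg_trans h; apply: near_eq_cvg; apply: filterS fg => y ->.
Qed.

Lemma is_derive_scalel (s c : R) : is_derive s 1 (fun x : R => x * c) c.
Proof.
apply: (is_derive_eq (is_derive_mulr (f := id) (g := cst c)
  (is_derive_id s 1) (is_derive_cst _ s 1))).
by rewrite mul1r mulr0 addr0.
Qed.

Lemma jacobianE m n (f : 'rV[R]_m -> 'rV[R]_n) u i j : differentiable f u ->
  'J f u i j = 'D_(delta_mx 0 i) f u 0 j.
Proof. by move=> df; rewrite deriveEjacobian// -rowE [RHS]mxE. Qed.

Lemma row_jacobian m n (f : 'rV[R]_m -> 'rV[R]_n) u i : differentiable f u ->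
  row i ('J f u) = 'D_(delta_mx 0 i) f u.
Proof. by move=> df; rewrite deriveEjacobian// -rowE. Qed.

Lemma continuous_jacobian m n (U : set 'rV[R]_m) (f : 'rV[R]_m -> 'rV[R]_n) u :
  open U -> Ck 1 U f -> U u -> {for u, continuous (jacobian f)}.
Proof.
move=> oU [df cf] Uu; apply/continuous_mxP => i j.
apply: (@near_eq_continuous _ _ (fun x => 'D_(delta_mx 0 i) f x 0 j)).
  have := open_nbhs_nbhs (conj oU Uu); apply: filterS => x Ux.
  by rewrite jacobianE//; exact: df.
by have /continuous_mxP := cf (delta_mx 0 i) u Uu; exact.
Qed.

(** The scalar mean value theorem for f(u + s (v - u)) - s (v - u) A, one
entry at a time. *)
Lemma mean_value_ineq m n (f : 'rV[R]_m -> 'rV[R]_n) (A : 'M[R]_(m, n)) u v (e : R) :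
  0 <= e ->
  (forall s : R, 0 <= s <= 1 -> differentiable f (s *: (v - u) + u) /\
     `|'J f (s *: (v - u) + u) - A| <= e) ->
  `|f v - f u - (v - u) *m A| <= m%:R * e * `|v - u|.
Proof.
move=> e0 h; apply: normv_le => [|i j]; first by rewrite !mulr_ge0.
pose p := fun s : R => s *: (v - u) + u.
pose g := fun s : R => f (p s) 0 j - s * ((v - u) *m A) 0 j.
have dg (s : R) : 0 <= s <= 1 ->
    is_derive s 1 g (((v - u) *m ('J f (p s) - A)) 0 j).
  move=> /h[df _]; rewrite mulmxBr [X in is_derive _ _ _ X]mxE [X in _ + X]mxE.
  have H1 : is_derive s 1 (fun s : R => f (p s) 0 j) (((v - u) *m 'J f (p s)) 0 j).
    rewrite -deriveEjacobian//.
    by have := is_derive_line (diff_derivable df : derivable f _ (v - u)) => /is_derive_mxP.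
  exact: (is_deriveB H1 (is_derive_scalel _ _)).
have [||c cI] := @MVT_segment _ g (fun s => ((v - u) *m ('J f (p s) - A)) 0 j) 0 1 ler01.
- move=> x; rewrite in_itv/= => /andP[x0 x1]; apply: dg; by rewrite !ltW.
- apply: derivable_within_continuous => x; rewrite in_itv/= => xI.
  by case: (dg x xI).
rewrite subr0 mulr1 /g /p scale1r scale0r add0r subrK mul1r mul0r subr0 => E.
have -> : (f v - f u - (v - u) *m A) i j = f v 0 j - ((v - u) *m A) 0 j - f u 0 j.
  by rewrite ord1 mxE [X in X + _]mxE [X in _ + X]mxE [X in _ + X + _]mxE addrAC.
rewrite E.
have := h c; rewrite in_itv/= in cI => /(_ cI) [_ Jc].
apply: le_trans (normv_coord _ _ _) _.
apply: le_trans (norm_mulmx_le _ _) _.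
by rewrite ler_wpM2r// ler_wpM2l.
Qed.

(** Jacobian matrices act on row vectors, so that injectivity is the
existence of a right inverse. *)
Lemma injective_right_inverse m n (f : 'rV[R]_m -> 'rV[R]_n) u :
  injective ('d f u : 'rV[R]_m -> 'rV[R]_n) -> exists P, 'J f u *m P = 1%:M.
Proof.
move=> inj; exists (pinvmx ('J f u)); apply: mulmxVp.
apply/inj_row_free => x; rewrite /jacobian mul_rV_lin1 => h; apply: inj.
by rewrite h linear0.
Qed.

(** The differentiability of the lift [v] is a conclusion: applied to the
first order expansion of [F], the matrix [P] first gives v s - v t = O(s - t),
and then the derivative. This replaces the inverse function theorem. *)
Lemma is_derive_lift m n (F : 'rV[R]_m -> 'rV[R]_n) (P : 'M[R]_(n, m))
    (v : R -> 'rV[R]_m) (t : R) (w : 'rV[R]_n) :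
  differentiable F (v t) -> 'J F (v t) *m P = 1%:M -> {for t, continuous v} ->
  is_derive t 1 (F \o v) w -> is_derive t 1 v (w *m P).
Proof.
move=> dF JP cv /is_derive_littleo hw; apply/is_derive_littleo => e e0.
(* [K] bounds the multiplication by [P], and [C] is the Lipschitz constant of
   [v] at [t]; [e1] is the accuracy required of the two expansions. *)
pose K := n%:R * `|P| + 1; have K0 : 0 < K by rewrite ltr_wpDl// mulr_ge0.
have KP k (x : 'M[R]_(k, n)) : `|x *m P| <= K * `|x|.
  by apply: le_trans (norm_mulmx_le _ _) _; rewrite ler_wpM2r// lerDl.
pose C := 2 * K * (`|w| + 1) + 1; have C0 : 0 < C.
  by rewrite ltr_wpDl// !mulr_ge0// ?(ltW K0)// addr_ge0.
pose e1 := Num.min (Num.min (2 * K)^-1 (e / (K * C))) 1.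
have e10 : 0 < e1 by rewrite !lt_min invr_gt0 divr_gt0 ?mulr_gt0 /=.
have e1K : e1 * K <= 2^-1.
  have : e1 <= (2 * K)^-1 by rewrite !ge_min lexx.
  by rewrite invfM -ler_pdivlMr.
have e1C : e1 * (K * C) <= e.
  by rewrite -ler_pdivlMr ?mulr_gt0// !ge_min lexx orbT.
have e11 : e1 <= 1 by rewrite !ge_min lexx !orbT.
have H1 := hw _ e10.
have H2 := cv _ (differentiable_littleo dF e10).
near=> s.
have h1 : `|F (v s) - F (v t) - (s - t) *: w| <= e1 * `|s - t| by near: s.
have h2 : `|F (v s) - F (v t) - (v s - v t) *m 'J F (v t)| <= e1 * `|v s - v t|.
  by near: s.
move: h1 h2; set d := v s - v t; set D := F (v s) - F (v t).
move: d D => d D h1 h2.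
have h3 : `|D *m P - d| <= e1 * K * `|d|.
  have -> : D *m P - d = (D - d *m 'J F (v t)) *m P.
    by rewrite mulmxBl -mulmxA JP mulmx1.
  by apply: le_trans (KP _ _) _; rewrite [e1 * K]mulrC -mulrA ler_wpM2l// ltW.
have hD : `|D| <= (`|w| + 1) * `|s - t|.
  have -> : D = (D - (s - t) *: w) + (s - t) *: w by rewrite subrK.
  apply: le_trans (ler_normD _ _) _.
  rewrite normrZ mulrDl mul1r addrC mulrC lerD2l.
  by apply: le_trans h1 _; rewrite ler_piMl.
have hd : `|d| <= 2 * K * (`|w| + 1) * `|s - t|.
  have a1 : `|d| <= `|D *m P| + `|D *m P - d|.
    by rewrite -{1}(subKr (D *m P) d) (le_trans (ler_normB _ _)).
  have a2 : `|D *m P| <= K * ((`|w| + 1) * `|s - t|).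
    by apply: le_trans (KP _ _) _; rewrite ler_wpM2l// ltW.
  have a3 : `|D *m P - d| <= 2^-1 * `|d|.
    by apply: le_trans h3 _; rewrite ler_wpM2r.
  lra.
have -> : d - (s - t) *: (w *m P) = (D - (s - t) *: w) *m P - (D *m P - d).
  by rewrite mulmxBl -scalemxAl opprB [RHS]addrC addrA subrK.
apply: le_trans (ler_normB _ _) _.
apply: (@le_trans _ _ (K * (e1 * `|s - t|) + e1 * K * (2 * K * (`|w| + 1) * `|s - t|))).
  apply: lerD; first by apply: le_trans (KP _ _) _; rewrite ler_wpM2l// ltW.
  by apply: le_trans h3 _; rewrite ler_wpM2l// mulr_ge0// ltW.
apply: (@le_trans _ _ (e1 * (K * C) * `|s - t|)); last by rewrite ler_wpM2r.
by rewrite /C le_eqVlt; apply/orP; left; apply/eqP; ring.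
Unshelve. all: by end_near. Qed.
(** * Symmetry of second derivatives *)

(** The mean value theorem twice, in the direction [a] and then in the
direction [b]. *)
Lemma second_difference (V : normedModType R) (h : V -> R) (u a b : V) (L e : R) :
  (\forall x \near u, [/\ derivable h x a, derivable ('D_a h) x b &
     `|'D_b ('D_a h) x - L| <= e]) ->
  \forall s \near (0 : R)^'+,
   `|h (s *: a + (s *: b + u)) - h (s *: a + u) - (h (s *: b + u) - h u)
      - s ^+ 2 * L| <= e * s ^+ 2.
Proof.
move=> /nbhs_ballP[r /= r0 H].
pose K := `|a| + `|b| + 1; have K0 : 0 < K by rewrite ltr_wpDl// addr_ge0.
near=> s.
have s0 : 0 < s by near: s; exact: nbhs_right_gt.
have sr : s * (`|a| + `|b|) < r.
  have : s < r / K by near: s; apply: nbhs_right_lt; rewrite divr_gt0.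
  rewrite ltr_pdivlMr// => /(le_lt_trans _); apply.
  by rewrite ler_wpM2l ?(ltW s0)// /K lerDl.
have inball (x y : R) : 0 <= x <= s -> 0 <= y <= s -> ball u r (x *: a + (y *: b + u)).
  move=> /andP[x0 xs] /andP[y0 ys]; rewrite -ball_normE /= distrC addrA addrK.
  apply: le_lt_trans sr; rewrite mulrDr; apply: le_trans (ler_normD _ _) _.
  by rewrite !normrZ !ger0_norm// lerD// ler_wpM2r.
have s00 : 0 <= s <= s by rewrite ltW/=.
have h00 : (0:R) <= 0 <= s by rewrite lexx ltW.
pose phi (x : R) := h (x *: a + (s *: b + u)) - h (x *: a + u).
have dphi (x : R) : 0 <= x <= s ->
  is_derive x 1 phi ('D_a h (x *: a + (s *: b + u)) - 'D_a h (x *: a + u)).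
  move=> xs; apply: is_deriveB; apply: is_derive_line.
    by case: (H _ (inball _ _ xs s00)).
  by have := inball _ _ xs h00; rewrite scale0r add0r => /H[].
have [||x xI] := @MVT_segment _ phi
   (fun x => 'D_a h (x *: a + (s *: b + u)) - 'D_a h (x *: a + u)) 0 s (ltW s0).
- by move=> x; rewrite in_itv/= => /andP[? ?]; apply: dphi; rewrite !ltW.
- apply: derivable_within_continuous => x; rewrite in_itv/= => xI.
  by case: (dphi x xI).
rewrite in_itv/= in xI; rewrite /phi scale0r !add0r subr0 => ->.
pose psi (y : R) := 'D_a h (y *: b + (x *: a + u)).
have dpsi (y : R) : 0 <= y <= s -> is_derive y 1 psi ('D_b ('D_a h) (y *: b + (x *: a + u))).
  move=> ys; apply: is_derive_line.
  by rewrite addrCA; case: (H _ (inball _ _ xI ys)).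
have [||y yI] := @MVT_segment _ psi
   (fun y => 'D_b ('D_a h) (y *: b + (x *: a + u))) 0 s (ltW s0).
- by move=> y; rewrite in_itv/= => /andP[? ?]; apply: dpsi; rewrite !ltW.
- apply: derivable_within_continuous => y; rewrite in_itv/= => yI.
  by case: (dpsi y yI).
rewrite in_itv/= in yI; rewrite /psi scale0r !add0r subr0 (addrCA (s *: b)) => ->.
rewrite -mulrA -expr2 (mulrC _ (s ^+ 2)) -mulrBr normrM ger0_norm ?sqr_ge0//.
rewrite mulrC ler_wpM2r ?sqr_ge0// addrCA.
by case: (H _ (inball _ _ xI yI)).
Unshelve. all: by end_near. Qed.

Lemma second_difference_gap (A B C D x y q c : R) :
  `|A - B - (C - D) - q * x| <= c / 2 * q ->
  `|A - C - (B - D) - q * y| <= c / 2 * q -> `|q * (x - y)| <= q * c.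
Proof. by rewrite !ler_norml => /andP[? ?] /andP[? ?]; apply/andP; split; lra. Qed.

(** Schwarz: the second difference of [h] is symmetric in [a] and [b], and
divided by s^2 it tends to either mixed derivative. *)
Lemma derive_comm_scalar (V : normedModType R) (h : V -> R) (u a b : V) :
  (\forall x \near u, [/\ derivable h x a, derivable ('D_a h) x b,
      derivable h x b & derivable ('D_b h) x a]) ->
  {for u, continuous ('D_b ('D_a h))} -> {for u, continuous ('D_a ('D_b h))} ->
  'D_b ('D_a h) u = 'D_a ('D_b h) u.
Proof.
move=> H c1 c2; apply/eqP; rewrite -subr_eq0 -normr_le0; apply/ler_addgt0Pr => e e0.
rewrite add0r; have e2 : 0 < e / 2 by rewrite divr_gt0.
have /(second_difference (L := 'D_b ('D_a h) u) (e := e / 2)) h1 :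
    \forall x \near u, [/\ derivable h x a, derivable ('D_a h) x b &
     `|'D_b ('D_a h) x - 'D_b ('D_a h) u| <= e / 2].
  near=> x; have [? ? _ _] : [/\ derivable h x a, derivable ('D_a h) x b,
      derivable h x b & derivable ('D_b h) x a] by near: x.
  split=> //; rewrite distrC; near: x; move/cvgrPdist_le: c1; exact.
have /(second_difference (L := 'D_a ('D_b h) u) (e := e / 2)) h2 :
    \forall x \near u, [/\ derivable h x b, derivable ('D_b h) x a &
     `|'D_a ('D_b h) x - 'D_a ('D_b h) u| <= e / 2].
  near=> x; have [_ _ ? ?] : [/\ derivable h x a, derivable ('D_a h) x b,
      derivable h x b & derivable ('D_b h) x a] by near: x.
  split=> //; rewrite distrC; near: x; move/cvgrPdist_le: c2; exact.
set X := 'D_b ('D_a h) u in h1 *; set Y := 'D_a ('D_b h) u in h2 *.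
have [s [[H1 H2] s0]] := filter_ex (filterI (filterI h1 h2) (nbhs_right_gt 0)).
rewrite (addrCA (s *: b)) in H2.
have s2 : 0 < s ^+ 2 by rewrite exprn_gt0.
rewrite -(ler_pM2l s2) -[X in X * `|_|]ger0_norm ?(ltW s2)// -normrM.
exact: second_difference_gap H1 H2.
Unshelve. all: by end_near. Qed.

Lemma derive_comm m n (U : set 'rV[R]_m) (f : 'rV[R]_m -> 'rV[R]_n) u a b :
  open U -> Ck 2 U f -> U u -> 'D_b ('D_a f) u = 'D_a ('D_b f) u.
Proof.
move=> oU [df C1f] Uu.
have nU : \near u, U u := open_nbhs_nbhs (conj oU Uu).
have co a' x j : U x -> ('D_a' f x) 0 j = 'D_a' (fun y => f y 0 j) x.
  by move=> /df/diff_derivable dfx; rewrite derive_mx// mxE.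
have dco a' x j : U x -> derivable (fun y => f y 0 j) x a'.
  by move=> /df/diff_derivable dfx; apply: ((derivable_mxP _ _ _).1 (dfx a')).
have co2 a' b' x j : U x -> ('D_b' ('D_a' f) x) 0 j = 'D_b' ('D_a' (fun y => f y 0 j)) x.
  move=> Ux; have [d1 _] := C1f a'.
  rewrite derive_mx; last exact/diff_derivable/d1.
  rewrite mxE; apply: near_eq_derive.
  by apply: filterS (open_nbhs_nbhs (conj oU Ux)) => y Uy; rewrite co.
have dco2 a' b' x j : U x -> derivable ('D_a' (fun y => f y 0 j)) x b'.
  move=> Ux; have [d1 _] := C1f a'.
  have /derivable_mxP/(_ 0 j) := diff_derivable (d1 x Ux) : derivable ('D_a' f) x b'.
  apply: near_eq_derivable.
  by apply: filterS (open_nbhs_nbhs (conj oU Ux)) => y Uy; rewrite co.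
have cco a' b' j : {for u, continuous ('D_b' ('D_a' (fun y => f y 0 j)))}.
  have [_ /(_ b' u Uu)/continuous_mxP/(_ 0 j)] := C1f a'.
  by apply: near_eq_continuous; apply: filterS nU => y Uy; rewrite co2.
apply/rowP => j.
apply: etrans (co2 a b u j Uu) _; apply: etrans _ (esym (co2 b a u j Uu)).
apply: derive_comm_scalar => //.
by apply: filterS nU => x Ux; split; [exact: dco|exact: dco2|exact: dco|exact: dco2].
Qed.

End DiffCalc.

(** * Charts of a submanifold *)

Section Charts.
Context {R : realType}.

Lemma mxB_entry m n (A B : 'M[R]_(m, n)) i j : (A - B) i j = A i j - B i j.
Proof. by rewrite !mxE. Qed.

Lemma jacobianB_entry m n (f : 'rV[R]_m -> 'rV[R]_n) u w i j :
  differentiable f u -> differentiable f w ->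
  ('J f w - 'J f u) i j = ('D_(delta_mx 0 i) f w - 'D_(delta_mx 0 i) f u) 0 j.
Proof.
by move=> du dw; rewrite mxB_entry [RHS]mxB_entry; congr (_ - _); exact: jacobianE.
Qed.

Lemma norm_le_of_dist (V : normedModType R) (a b : V) (e : R) :
  `|a - b| <= e -> `|a| <= `|b| + e.
Proof.
by move=> h; rewrite -{1}(subrK b a) addrC (le_trans (ler_normD _ _))// lerD2l.
Qed.

Lemma continuous_near_dist (T : topologicalType) (V : normedModType R) (f : T -> V) x (e : R) :
  {for x, continuous f} -> 0 < e -> \forall y \near x, `|f y - f x| <= e.
Proof.
by move=> /cvgrPdist_le cf e0; apply: filterS (cf _ e0) => y; rewrite distrC.
Qed.

Lemma Ck2_Ck1 m n (U : set 'rV[R]_m) (f : 'rV[R]_m -> 'rV[R]_n) :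
  Ck 2 U f -> Ck 1 U f.
Proof.
move=> [df cf]; split=> // v u Uu.
by have [d _] := cf v; apply: differentiable_continuous; exact: d.
Qed.

Lemma ball_segment (V : normedModType R) (x u v : V) (r s : R) :
  0 <= s <= 1 -> ball x r u -> ball x r v -> ball x r (s *: (v - u) + u).
Proof.
move=> /andP[s0 s1]; rewrite -!ball_normE /= => xu xv.
have -> : x - (s *: (v - u) + u) = s *: (x - v) + (1 - s) *: (x - u).
  have e : (x - v) - (x - u) = u - v by rewrite opprB addrC addrA subrK.
  rewrite scalerBl scale1r addrCA -scalerBr e opprD -scalerN opprB.
  by rewrite addrA addrAC.
have [s00|sn0] := eqVneq s 0.
  by rewrite s00 scale0r add0r subr0 scale1r.
have sp : 0 < s by rewrite lt_neqAle eq_sym sn0.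
apply: le_lt_trans (ler_normD _ _) _.
have s1' : 0 <= 1 - s by rewrite subr_ge0.
rewrite !normrZ (ger0_norm s0) (ger0_norm s1').
have -> : r = s * r + (1 - s) * r by ring.
by rewrite ltr_leD ?ltr_pM2l// ler_wpM2l// ltW.
Qed.

Lemma mulmx_right_inverse_err m n (h : 'rV[R]_m) (A B : 'M[R]_(m, n)) P :
  B *m P = 1%:M -> h *m A *m P - h = h *m (A - B) *m P.
Proof. by move=> BP; rewrite mulmxBr [in RHS]mulmxBl -[h *m B *m P]mulmxA BP mulmx1. Qed.

(** The constants of all local estimates come from here. Where the Jacobian
matrix stays close to its value at [u0], a right inverse of that value inverts
[f] and its linearizations up to half of the increment, hence the first two
bounds; the others come from the bounds on the second derivatives. *)
Lemma immersion_local m n (U : set 'rV[R]_m) (f : 'rV[R]_m -> 'rV[R]_n) u0 :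
  open U -> Ck 2 U f -> U u0 -> injective ('d f u0 : 'rV[R]_m -> 'rV[R]_n) ->
  exists r K : R, [/\ 0 < r, 0 < K, ball u0 r `<=` U &
    forall u v : 'rV[R]_m, ball u0 r u -> ball u0 r v ->
    [/\ `|v - u| <= K * `|f v - f u|,
        forall h : 'rV[R]_m, `|h| <= K * `|h *m 'J f u|,
        `|'J f v - 'J f u| <= K * `|v - u|,
        `|'J f u| <= K &
        `|f v - f u - (v - u) *m 'J f u| <= K * `|v - u| ^+ 2]].
Proof.
move=> oU C2 Uu0 inj; have [df C1f] := C2.
have [P JP] := injective_right_inverse inj.
pose K0 := n%:R * `|P| + 1; have K00 : 0 < K0 by rewrite ltr_wpDl// mulr_ge0.
have KP k (x : 'M[R]_(k, n)) : `|x *m P| <= K0 * `|x|.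
  by apply: le_trans (norm_mulmx_le _ _) _; rewrite ler_wpM2r// lerDl.
(* With this accuracy the linear error, multiplied by [P], is at most half of
   the increment of the coordinates. *)
pose e := (2 * K0 * (m%:R + 1))^-1.
have m10 : 0 < m%:R + 1 :> R by rewrite ltr_wpDl.
have e0 : 0 < e by rewrite invr_gt0 !mulr_gt0.
have eK : K0 * (m%:R * e) <= 2^-1.
  have -> : 2^-1 = K0 * ((m%:R + 1) * e).
    by rewrite /e; field; rewrite !gt_eqF.
  by rewrite ler_wpM2l ?(ltW K00)// ler_wpM2r ?(ltW e0)// lerDl.
pose B := \sum_(i < m) `|'J ('D_(delta_mx 0 i) f) u0| + 1.
have nU : \near u0, U u0 := open_nbhs_nbhs (conj oU Uu0).
have nJ : \forall u \near u0, `|'J f u - 'J f u0| <= e.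
  exact: (continuous_near_dist (continuous_jacobian oU (Ck2_Ck1 C2) Uu0) e0).
have nB : \forall u \near u0, forall i : 'I_m, `|'J ('D_(delta_mx 0 i) f) u| <= B.
  suff H (i : 'I_m) : \forall u \near u0, `|'J ('D_(delta_mx 0 i) f) u| <= B.
    exact: (@filter_forall _ 'I_m (fun i u => `|'J ('D_(delta_mx 0 i) f) u| <= B) _ _ H).
  have := continuous_near_dist (continuous_jacobian oU (C1f (delta_mx 0 i)) Uu0) ltr01.
  apply: filterS => u h.
  apply: le_trans (norm_le_of_dist h) _; rewrite /B lerD2r.
  by rewrite (bigD1 i)//= lerDl sumr_ge0.
have B0 : 0 <= B by rewrite addr_ge0// sumr_ge0.
have /nbhs_ballP[r /= r0 rH] : nbhs u0 (U `&` ([set u | `|'J f u - 'J f u0| <= e] `&`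
    [set u | forall i : 'I_m, `|'J ('D_(delta_mx 0 i) f) u| <= B])).
  exact: filterI nU (filterI nJ nB).
have Jb0 : 0 <= `|'J f u0| + e by rewrite addr_ge0// ltW.
have mB : 0 <= m%:R * B by rewrite mulr_ge0.
have mmB : 0 <= m%:R * (m%:R * B) by rewrite mulr_ge0.
have K20 : 0 < 2 * K0 by rewrite mulr_gt0.
have [K [K0' KK KB KJ KmB]] : exists K : R, [/\ 0 < K, 2 * K0 <= K, m%:R * B <= K,
    `|'J f u0| + e <= K & m%:R * (m%:R * B) <= K].
  exists (2 * K0 + m%:R * B + (`|'J f u0| + e) + m%:R * (m%:R * B)).
  move: mB Jb0 mmB K20; move: (m%:R * B) (`|_| + e) (m%:R * _) (2 * K0); clear.
  by move=> a b c d a0 b0 c0 d0; split; lra.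
exists r, K; split=> //.
  by move=> u /rH[].
move=> u v ru rv.
have [Uu [Ju Bu]] := rH _ ru; have [Uv [Jv Bv]] := rH _ rv.
have seg (s : R) : 0 <= s <= 1 -> ball u0 r (s *: (v - u) + u) by move=> ?; exact: ball_segment.
have MV : `|f v - f u - (v - u) *m 'J f u0| <= m%:R * e * `|v - u|.
  apply: mean_value_ineq (ltW e0) _ => s /seg/rH[Us [Js _]].
  by split=> //; exact: df.
have LJ (w : 'rV[R]_m) : ball u0 r w -> `|'J f w - 'J f u| <= m%:R * B * `|w - u|.
  move=> rw; have [Uw _] := rH _ rw.
  have segw (s : R) : 0 <= s <= 1 -> ball u0 r (s *: (w - u) + u) by move=> ?; exact: ball_segment.
  apply: normv_le => [|i j]; first by rewrite mulr_ge0.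
  rewrite (jacobianB_entry i j (df u Uu) (df w Uw)).
  apply: le_trans (normv_coord _ _ _) _.
  have := @mean_value_ineq _ m n ('D_(delta_mx 0 i) f) 0 u w B B0.
  rewrite mulmx0 subr0; apply=> s /segw/rH[Us [_ Bs]].
  split; last by rewrite subr0; exact: Bs.
  by have [d _] := C1f (delta_mx 0 i); exact: d.
split.
- have h : `|(f v - f u) *m P - (v - u)| <= 2^-1 * `|v - u|.
    have -> : (f v - f u) *m P - (v - u) = (f v - f u - (v - u) *m 'J f u0) *m P.
      by rewrite [in RHS]mulmxBl -mulmxA JP mulmx1.
    apply: le_trans (KP _ _) _; apply: le_trans (ler_wpM2l (ltW K00) MV) _.
    by rewrite mulrA ler_wpM2r.
  have h2 := KP _ (f v - f u).
  have h3 : `|v - u| <= `|(f v - f u) *m P| + `|(f v - f u) *m P - (v - u)|.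
    by rewrite -{1}(subKr ((f v - f u) *m P) (v - u)) (le_trans (ler_normB _ _)).
  apply: le_trans (ler_wpM2r (normr_ge0 _) KK).
  move: h h2 h3; move: `|v - u| `|(f v - f u) *m P - (v - u)| `|(f v - f u) *m P| `|f v - f u|.
  clear; move=> a b c d; lra.
- move=> h; have h1 : `|h *m 'J f u *m P - h| <= 2^-1 * `|h|.
    rewrite (mulmx_right_inverse_err h ('J f u) JP).
    apply: le_trans (KP _ _) _; apply: le_trans (ler_wpM2l (ltW K00) (norm_mulmx_le _ _)) _.
    rewrite mulrA; apply: ler_wpM2r; first exact: normr_ge0.
    apply: le_trans _ eK; apply: ler_wpM2l; first exact: ltW.
    by apply: ler_wpM2l; [exact: ler0n|exact: Ju].
  have h2 := KP _ (h *m 'J f u).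
  have h3 : `|h| <= `|h *m 'J f u *m P| + `|h *m 'J f u *m P - h|.
    by rewrite -{1}(subKr (h *m 'J f u *m P) h) (le_trans (ler_normB _ _)).
  apply: le_trans (ler_wpM2r (normr_ge0 _) KK).
  move: h1 h2 h3; move: `|h| `|h *m 'J f u *m P - h| `|h *m 'J f u *m P| `|h *m 'J f u|.
  clear; move=> a b c d; lra.
- by apply: le_trans (LJ _ rv) _; rewrite ler_wpM2r.
- exact: le_trans (norm_le_of_dist Ju) KJ.
- apply: (@le_trans _ _ (m%:R * (m%:R * B * `|v - u|) * `|v - u|)).
    apply: mean_value_ineq => [|s s01]; first by rewrite mulr_ge0.
    have rs := seg _ s01; split; first by apply: df; case: (rH _ rs).
    apply: le_trans (LJ _ rs) _; rewrite addrK normrZ ler_wpM2l//.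
    by move: s01 => /andP[s0 s1]; rewrite ger0_norm// ler_piMl.
  rewrite [m%:R * (_ * `|_|)]mulrA -mulrA -expr2 ler_wpM2r// sqr_ge0//.
Qed.

(** The image of a chart is open in [N], so the inverse of the chart is
continuous on a relatively open part of [N]. *)
Lemma chart_inverse m n N (U : set 'rV[R]_m) (phi : 'rV[R]_m -> 'rV[R]_n) :
  chart N U phi -> exists (g : 'rV[R]_n -> 'rV[R]_m) (V : set 'rV[R]_n),
  [/\ open V, forall u, U u -> [/\ g (phi u) = u, N (phi u) & V (phi u)],
      forall y, N y -> V y -> U (g y) /\ phi (g y) = y &
      {within N `&` V, continuous g}].
Proof.
move=> [oU _ _ [_ [g gK cg]] [V oV UV]]; exists g, V; split=> //.
- move=> u Uu; have : (phi @` U) (phi u) by exists u.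
  by rewrite UV => -[? ?]; rewrite gK.
- move=> y Ny Vy; have : (N `&` V) y by [].
  by rewrite -UV => -[u Uu <-]; rewrite gK.
- by rewrite -UV.
Qed.

Lemma within_cvg (T S X : topologicalType) (A : set S) (F : set_system T) {FF : Filter F}
    (c : T -> S) (g : S -> X) y :
  {within A, continuous g} -> A y -> c s @[s --> F] --> y ->
  (\forall s \near F, A (c s)) -> g (c s) @[s --> F] --> g y.
Proof.
move=> /subspace_continuousP cg Ay cF Ac; apply: (@cvg_comp _ _ _ c g F (within A (nbhs y))).
  by move=> Q /= /cF /= h; apply: filterS2 Ac h => s As; apply.
exact: cg.
Qed.

(** The segment [t *: h + u] is mapped by [phi] to a curve in [N], which is
read in the chart [psi] through its continuous inverse; [is_derive_lift] gives
this reading a velocity [k]. The same [k] serves for [id] and for [Phi], since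
both are evaluated on the same curve. *)
Lemma tangent_transition m n p N (U W : set 'rV[R]_m) (phi psi : 'rV[R]_m -> 'rV[R]_n)
    (Phi : 'rV[R]_n -> 'rV[R]_p) u w :
  chart N U phi -> chart N W psi -> U u -> W w -> phi u = psi w ->
  differentiable (Phi \o phi) u -> differentiable (Phi \o psi) w ->
  forall h : 'rV[R]_m, exists k : 'rV[R]_m, h *m 'J phi u = k *m 'J psi w /\
    h *m 'J (Phi \o phi) u = k *m 'J (Phi \o psi) w.
Proof.
move=> cphi cpsi Uu Ww E dPphi dPpsi h.
have [oU [dphi _] _ _ _] := cphi; have [oW [dpsi _] impsi _ _] := cpsi.
have [gphi [Vphi [_ phiNV _ _]]] := chart_inverse cphi.
have [g [V [oV psiNV gN cg]]] := chart_inverse cpsi.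
(* [l] and [v] are the coordinates of the same curve in the two charts. *)
pose l (t : R) : 'rV[R]_m := t *: h + u.
have l0 : l 0 = u by rewrite /l scale0r add0r.
have dl : is_derive (0 : R) 1 l h.
  exact: is_derive_affine.
have cl : l t @[t --> (0 : R)] --> u.
  rewrite -l0; exact: is_derive_continuous dl.
have nU : \forall t \near (0 : R), U (l t).
  by apply: cl; exact: open_nbhs_nbhs.
have cphil : phi (l t) @[t --> (0 : R)] --> phi u.
  by apply: (cvg_comp l phi cl); exact: differentiable_continuous (dphi _ Uu).
have nV : \forall t \near (0 : R), V (phi (l t)).
  by apply: cphil; apply: open_nbhs_nbhs; split=> //; rewrite E; have [] := psiNV _ Ww.
pose v (t : R) := g (phi (l t)).
have v0 : v 0 = w by rewrite /v l0 E; have [] := psiNV _ Ww.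
have vl : \forall t \near (0 : R), W (v t) /\ psi (v t) = phi (l t).
  by apply: filterS2 nU nV => t Ut Vt; apply: gN => //; have [] := phiNV _ Ut.
have cv : {for (0 : R), continuous v}.
  rewrite /prop_for /continuous_at /v l0.
  apply: (within_cvg (A := N `&` V)) => //.
    by have [? ? ?] := phiNV _ Uu; split=> //; rewrite E; have [] := psiNV _ Ww.
  by apply: filterS2 nU nV => t Ut Vt; split=> //; have [] := phiNV _ Ut.
have [P JP] := injective_right_inverse (impsi _ Ww).
have dpl : is_derive (0 : R) 1 (phi \o l) (h *m 'J phi u).
  by have := is_derive_compv (f := phi) _ dl; rewrite l0; apply; exact: dphi.
have dpv : is_derive (0 : R) 1 (psi \o v) (h *m 'J phi u).
  by apply: near_eq_is_derive dpl; apply: filterS vl => t [_ /= ->].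
have dv : is_derive (0 : R) 1 v (h *m 'J phi u *m P).
  by apply: (@is_derive_lift _ _ _ psi) dpv; rewrite ?v0//; exact: dpsi.
exists (h *m 'J phi u *m P); split.
  have H := is_derive_compv (f := psi) (c := v) (t := 0) _ dv.
  rewrite v0 in H; have {}H := H (dpsi _ Ww).
  exact: is_derive_uniq dpv H.
have H1 : is_derive (0 : R) 1 (Phi \o phi \o l) (h *m 'J (Phi \o phi) u).
  by have := is_derive_compv (f := Phi \o phi) _ dl; rewrite l0; apply.
have H2 : is_derive (0 : R) 1 (Phi \o psi \o v) (h *m 'J phi u *m P *m 'J (Phi \o psi) w).
  by have := is_derive_compv (f := Phi \o psi) _ dv; rewrite v0; apply.
have H3 : is_derive (0 : R) 1 (Phi \o psi \o v) (h *m 'J (Phi \o phi) u).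
  by apply: near_eq_is_derive H1; apply: filterS vl => t [_ /= ->].
exact: is_derive_uniq H3 H2.
Qed.

Lemma is_derive_jacobian m n (U : set 'rV[R]_m) (f : 'rV[R]_m -> 'rV[R]_n)
    (z : R -> 'rV[R]_m) (t : R) (w : 'rV[R]_m) :
  open U -> Ck 2 U f -> U (z t) -> is_derive t 1 z w ->
  is_derive t 1 (fun s => 'J f (z s))
    (\matrix_(i, j) (w *m 'J ('D_(delta_mx 0 i) f) (z t)) 0 j).
Proof.
move=> oU [df C1f] Uz dz; apply/is_derive_mxP => i j; rewrite mxE.
have [d1 _] := C1f (delta_mx 0 i).
have H := is_derive_compv (d1 _ Uz) dz.
have /is_derive_mxP /(_ 0 j) := H.
apply: near_eq_is_derive.
have cz : {for t, continuous z}.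
  exact: is_derive_continuous dz.
have nU : \forall s \near t, U (z s) by apply: cz; exact: open_nbhs_nbhs.
by apply: filterS nU => s Us; apply/esym/jacobianE; exact: df.
Qed.

Lemma metricE m n (phi : 'rV[R]_m -> 'rV[R]_n) u i j :
  metric phi u i j = inner ('D_(delta_mx 0 i) phi u) ('D_(delta_mx 0 j) phi u).
Proof. by rewrite mxE. Qed.

Lemma metric_sym m n (phi : 'rV[R]_m -> 'rV[R]_n) u i j :
  metric phi u i j = metric phi u j i.
Proof. by rewrite !metricE innerC. Qed.

Lemma metric_unit m n (phi : 'rV[R]_m -> 'rV[R]_n) u :
  differentiable phi u -> injective ('d phi u : 'rV[R]_m -> 'rV[R]_n) ->
  metric phi u \in unitmx.
Proof.
move=> df inj; have [P JP] := injective_right_inverse inj.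
have -> : metric phi u = 'J phi u *m ('J phi u)^T; last exact: gram_unit JP.
by apply/matrixP => i j; rewrite metricE -inner_row !row_jacobian.
Qed.

Lemma koszul_sum n (Dij Dip Djp Ei Ej Ep : 'rV[R]_n) :
  inner Dij Ep + inner Ej Dip + (inner Dij Ep + inner Ei Djp)
  - (inner Dip Ej + inner Ei Djp) = 2 * inner Dij Ep.
Proof. by rewrite (innerC Ej); ring. Qed.

(** Koszul's formula for an induced metric: differentiating
g_ij = <d_i phi, d_j phi> by the product rule, the first kind Christoffel symbols
collapse to <d_ij phi, d_l phi>. *)
Lemma christoffelP m n (U : set 'rV[R]_m) (phi : 'rV[R]_m -> 'rV[R]_n) u i j l :
  open U -> Ck 2 U phi -> U u -> injective ('d phi u : 'rV[R]_m -> 'rV[R]_n) ->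
  \sum_k christoffel phi k i j u * metric phi u k l =
  inner ('D_(delta_mx 0 j) ('D_(delta_mx 0 i) phi) u) ('D_(delta_mx 0 l) phi u).
Proof.
move=> oU C2 Uu inj; have [df C1f] := C2.
pose D a b := 'D_(delta_mx 0 b) ('D_(delta_mx 0 a) phi) u.
pose E a := 'D_(delta_mx 0 a) phi u.
have DC a b : D a b = D b a by exact: (derive_comm _ _ oU C2 Uu).
have dm a b c : dmetric phi a b c u = inner (D b a) (E c) + inner (E b) (D c a).
  rewrite /dmetric.
  have -> : (fun h => metric phi h b c : R) =
     (fun h => inner ('D_(delta_mx 0 b) phi h) ('D_(delta_mx 0 c) phi h)).
    by apply/funext => h; rewrite metricE.
  have dd e : is_derive u (delta_mx 0 a) ('D_(delta_mx 0 e) phi) (D e a).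
    by apply/derivableP/diff_derivable; have [d1 _] := C1f (delta_mx 0 e); exact: d1.
  exact: is_deriveE (is_derive_inner (dd b) (dd c)).
have T p : dmetric phi i j p u + dmetric phi j i p u - dmetric phi p i j u = 2 * inner (D i j) (E p).
  rewrite !dm (DC j i) (DC p i) (DC p j).
  exact: koszul_sum.
have -> : inner ('D_(delta_mx 0 j) ('D_(delta_mx 0 i) phi) u) ('D_(delta_mx 0 l) phi u)
   = \sum_p (inner (D i j) (E p)) * (metric phi u *m invmx (metric phi u)) l p.
  rewrite mulmxV ?metric_unit//; last exact: df.
  rewrite (bigD1 l)//= big1 ?addr0 ?mxE ?eqxx ?mulr1// => p pl.
  by rewrite mxE eq_sym (negbTE pl) mulr0.
have -> : \sum_k christoffel phi k i j u * metric phi u k l =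
   \sum_k \sum_p inner (D i j) (E p) * (metric phi u l k * invmx (metric phi u) k p).
  apply: eq_bigr => k _; rewrite /christoffel -mulrA mulr_suml mulr_sumr.
  apply: eq_bigr => p _; rewrite T (metric_sym phi u k l).
  move: (inner _ _) (invmx _ _ _) (metric _ _ _ _); clear => a b c.
  by field.
rewrite exchange_big/=; apply: eq_bigr => p _; rewrite -mulr_sumr; congr (_ * _).
by rewrite mxE.
Qed.

End Charts.

(** * The Gauss formula *)

Section Gauss.
Context {R : realType}.

Lemma sum_scale_rows m n (f : 'rV[R]_m -> 'rV[R]_n) u (a : 'I_m -> R) :
  differentiable f u ->
  \sum_k a k *: 'D_(delta_mx 0 k) f u = (\row_k a k) *m 'J f u.
Proof.
move=> df; rewrite mulmx_sum_row; apply: eq_bigr => k _.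
by rewrite mxE row_jacobian.
Qed.

(** In a chart, c'' is (z_k'') d_k phi plus z_i' z_j' d_ij phi, and the
Christoffel symbols are the tangential coordinates of d_ij phi. So the covariant
acceleration is the tangential part of c''. *)
Lemma gauss_formula m n N (c : R -> 'rV[R]_n) (t : R) (w : 'rV[R]_n) :
  covariant_acceleration m N c t w ->
  exists (U : set 'rV[R]_m) (phi : 'rV[R]_m -> 'rV[R]_n) (z : R -> 'rV[R]_m),
  [/\ chart N U phi,
      \forall s \near t, [/\ U (z s), c s = phi (z s) &
        is_derive s 1 c (derive1 z s *m 'J phi (z s))],
      derivable (derive1 c) t 1,
      exists k : 'rV[R]_m, w = k *m 'J phi (z t) &
      forall h : 'rV[R]_m, inner (derive1 (derive1 c) t - w) (h *m 'J phi (z t)) = 0].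
Proof.
move=> [U [phi [z [chrt nz dz' wE]]]]; exists U, phi, z.
have [oU C2 imm _ _] := chrt; have [dphi C1phi] := C2.
have ncz : \forall s \near t, [/\ U (z s), c s = phi (z s) &
    is_derive s 1 c (derive1 z s *m 'J phi (z s))].
  have := near_join nz; apply: filterS => s ns.
  have [Us csE dzs] := nbhs_singleton ns; split=> //.
  have dzs' : is_derive s 1 z (derive1 z s) by rewrite derive1E; exact: derivableP.
  have := is_derive_compv (dphi _ Us) dzs'.
  by apply: near_eq_is_derive; apply: filterS ns => x [_ -> _].
have [Ut ctE dct] := nbhs_singleton ncz.
have c'E : \forall s \near t, derive1 z s *m 'J phi (z s) = derive1 c s.
  by apply: filterS ncz => s [_ _ d]; rewrite [derive1 c s]derive1E (is_deriveE d).
have dzt : is_derive t 1 z (derive1 z t).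
  by have [_ _ d] := nbhs_singleton nz; rewrite derive1E; exact: derivableP.
have dz't : is_derive t 1 (derive1 z) (derive1 (derive1 z) t).
  by rewrite [derive1 (derive1 z) t]derive1E; exact: derivableP.
have dc' := is_derive_mulmx dz't (is_derive_jacobian oU C2 Ut dzt).
have {}dc' := near_eq_is_derive c'E dc'.
split=> //.
  eexists; rewrite {1}wE; apply: sum_scale_rows; exact: dphi.
move=> h; rewrite [derive1 (derive1 c) t]derive1E (is_deriveE dc').
pose z1 := derive1 z t; pose z2 := derive1 (derive1 z) t.
pose E k := 'D_(delta_mx 0 k) phi (z t).
pose D i j := 'D_(delta_mx 0 j) ('D_(delta_mx 0 i) phi) (z t).
have -> : h *m 'J phi (z t) = \sum_l h 0 l *: E l.
  by rewrite mulmx_sum_row; apply: eq_bigr => l _; rewrite row_jacobian//; exact: dphi.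
rewrite innerC inner_suml big1// => l _; rewrite innerZl innerC.
apply/eqP; rewrite mulf_eq0; apply/orP; right; rewrite innerBl subr_eq0; apply/eqP.
rewrite innerDl.
have -> : inner (z2 *m 'J phi (z t)) (E l) = \sum_k z2 0 k * metric phi (z t) k l.
  rewrite mulmx_sum_row inner_suml; apply: eq_bigr => k _.
  by rewrite innerZl metricE row_jacobian//; exact: dphi.
set G := (X in inner (z1 *m X)).
have -> : inner (z1 *m G) (E l) = \sum_i \sum_j z1 0 i * z1 0 j * inner (D i j) (E l).
  rewrite mulmx_sum_row inner_suml; apply: eq_bigr => i _.
  have -> : row i G = z1 *m 'J ('D_(delta_mx 0 i) phi) (z t).
    by apply/rowP => j; rewrite 2!mxE.
  have [d1 _] := C1phi (delta_mx 0 i).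
  rewrite innerZl mulmx_sum_row inner_suml mulr_sumr; apply: eq_bigr => j _.
  by rewrite innerZl -mulrA row_jacobian//; exact: d1.
rewrite wE inner_suml.
have -> : \sum_k inner ((z2 0 k + \sum_i \sum_j christoffel phi k i j (z t) * z1 0 i * z1 0 j)
     *: 'D_(delta_mx 0 k) phi (z t)) (E l) =
   \sum_k (z2 0 k * metric phi (z t) k l + \sum_i \sum_j
     z1 0 i * z1 0 j * (christoffel phi k i j (z t) * metric phi (z t) k l)).
  apply: eq_bigr => k _; rewrite innerZl -metricE mulrDl mulr_suml; congr (_ + _).
  apply: eq_bigr => i _; rewrite mulr_suml; apply: eq_bigr => j _.
  by move: (christoffel _ _ _ _ _) (metric _ _ _ _) (z1 0 i) (z1 0 j); clear => a b x y; ring.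
rewrite big_split/=; congr (_ + _).
rewrite [RHS]exchange_big/=; apply: eq_bigr => i _.
rewrite [RHS]exchange_big/=; apply: eq_bigr => j _.
rewrite -mulr_sumr; congr (_ * _); apply/esym.
exact: (christoffelP i j l oU C2 Ut (imm _ Ut)).
Qed.

End Gauss.

(** * The Riemannian geometry of R^n *)

Section Euclid.
Context {R : realType}.

Lemma continuous_enorm n (d : R -> 'rV[R]_n) (t : R) :
  {for t, continuous d} -> {for t, continuous (fun s => enorm (d s))}.
Proof.
move=> cd; rewrite /prop_for /continuous_at; apply/cvgrPdist_le => e e0.
have n0 : 0 < n%:R + 1 :> R by rewrite ltr_wpDl.
have := continuous_near_dist cd (divr_gt0 e0 n0); apply: filterS => s h.
have K : n%:R * `|d s - d t| <= e.
  apply: le_trans (_ : (n%:R + 1) * `|d s - d t| <= _).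
    by rewrite ler_wpM2r// lerDl.
  by rewrite mulrC -ler_pdivlMr.
have h1 := enorm_triangle (d s) (d t - d s).
have h2 := enorm_triangle (d t) (d s - d t).
rewrite addrC subrK in h1; rewrite addrC subrK in h2.
have k1 := enorm_le_norm (d s - d t).
have k2 := enorm_le_norm (d t - d s); rewrite distrC in k2.
have q1 := le_trans h1 (lerD (lexx _) (le_trans k2 K)).
have q2 := le_trans h2 (lerD (lexx _) (le_trans k1 K)).
by rewrite ler_distl q1 andbT lerBlDr.
Qed.

(** Pairing with the chord v = g b - g a turns the length of a vector into
the integral of the scalar function <v, g'>, which is at most |v| |g'|. *)
Lemma chord_le_length n (g : R -> 'rV[R]_n) (a b : R) : a < b ->
  (forall t : R, derivable g t 1) -> continuous (derive1 g) ->
  ((enorm (g b - g a))%:E <=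
   \int[lebesgue_measure]_(t in `[a, b]) (enorm (derive1 g t))%:E)%E.
Proof.
move=> ab dg cg; set v := g b - g a.
have [v0|v0] := eqVneq (enorm v) 0.
  by rewrite v0; apply: integral_ge0 => t _; rewrite lee_fin enorm_ge0.
have vp : 0 < enorm v by rewrite lt_neqAle eq_sym v0 enorm_ge0.
have cg' : continuous (fun t => enorm (derive1 g t)).
  by move=> t; apply: continuous_enorm; exact: cg.
have dF (t : R) : is_derive t 1 (fun s => inner v (g s)) (inner v (derive1 g t)).
  by apply: is_derive_innerl; rewrite derive1E; exact: derivableP.
have cF : continuous (fun t => inner v (g t)).
  by move=> t; exact: is_derive_continuous (dF t).
have cF' : continuous (fun t => inner v (derive1 g t)).
  by move=> t; apply: cvg_inner; [exact: cvg_cst|exact: cg].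
have ftc := @continuous_FTC2 R (fun t => inner v (derive1 g t)) (fun t => inner v (g t)) a b ab.
rewrite -(@lee_pmul2l _ (enorm v)%:E)//.
have -> : ((enorm v)%:E * (enorm v)%:E =
    \int[lebesgue_measure]_(t in `[a, b]) (inner v (derive1 g t))%:E)%E.
  rewrite ftc.
  - by rewrite -EFinM -expr2 enorm_sqr -EFinB -innerBr.
  - exact: continuous_subspaceT.
  - split; first by move=> t _; case: (dF t).
      by apply: cvg_at_right_filter; exact: cF.
    by apply: cvg_at_left_filter; exact: cF.
  - by move=> t _; rewrite derive1E; exact: is_deriveE (dF t).
have icpt (f : R -> R) : continuous f ->
    lebesgue_measure.-integrable `[a, b] (EFin \o f).
  move=> cf; apply: continuous_compact_integrable; first exact: segment_compact.
  exact: continuous_subspaceT.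
rewrite -integralZl//; last exact: icpt.
apply: le_integral => //; first exact: icpt.
  apply: (icpt (fun t => enorm v * enorm (derive1 g t))) => t.
  by apply: cvgMl_tmp; exact: cg'.
by move=> t _; rewrite -EFinM lee_fin cauchy_schwarz.
Qed.

(** The measurability of the speed is part of the induction because it is
what the additivity of the integral over adjacent intervals requires. *)
Lemma piecewise_length n (c : R -> 'rV[R]_n) (s : seq R) (a : R) :
  path <%R a s ->
  (forall i, (i < size s)%N -> exists g : R -> 'rV[R]_n,
      Ck 1 setT g /\
      forall t, nth 0 (a :: s) i <= t <= nth 0 s i -> c t = g t) ->
  [/\ a <= last a s, measurable_fun `[a, last a s] (fun t => enorm (derive1 c t)) &
  ((enorm (c (last a s) - c a))%:E <=
   \int[lebesgue_measure]_(t in `[a, last a s]) (enorm (derive1 c t))%:E)%E].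
Proof.
elim: s a => [|b s IH] a /=.
  move=> _ _; split=> //.
    by rewrite set_itv1; exact: measurable_fun_set1.
  rewrite subrr /enorm inner0l sqrtr0; apply: integral_ge0 => t _.
  by rewrite lee_fin sqrtr_ge0.
move=> /andP[ab ps] h.
have [|bl ms IHl] := IH b ps; first by move=> i si; exact: (h i.+1).
have [g [[dg cg] cE]] := h 0%N (ltn0Sn _).
rewrite /= in cE.
have dg' (t : R) : derivable g t 1 by exact/diff_derivable/dg.
have cg' : continuous (derive1 g).
  have -> : derive1 g = 'D_1 g by apply/funext => t; rewrite derive1E.
  by move=> t; exact: cg.
have E (t : R) : t \in `]a, b[ -> derive1 c t = derive1 g t.
  rewrite in_itv/= => /andP[at_ tb]; rewrite !derive1E; apply: near_eq_derive.
  have := @near_in_itvoo _ a b t; rewrite in_itv/= at_ tb => /(_ isT).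
  by apply: filterS => x; rewrite in_itv/= => /andP[? ?]; apply: cE; rewrite !ltW.
have mg : measurable_fun `]a, b[ (fun t => enorm (derive1 g t)).
  apply: open_continuous_measurable_fun => // t _.
  by apply: continuous_enorm; exact: cg'.
have mc : measurable_fun `]a, b[ (fun t => enorm (derive1 c t)).
  by apply: eq_measurable_fun mg => t; rewrite inE/= => /E ->.
have mcc := measurable_fun_itv_cc mc.
have U : `[a, last b s]%classic = (`[a, b]%classic `|` `]b, last b s]%classic) :> set R.
  rewrite predeqE => t /=; rewrite !in_itv/=; split=> [/andP[h1 h2]|].
    by case: (leP t b) => tb; [left|right]; apply/andP.
  move=> [/andP[h1 h2]|/andP[h1 h2]]; first by rewrite h1 (le_trans h2).
  by rewrite h2 andbT ltW// (lt_trans ab).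
have mbl := measurable_fun_itv_oc ms.
have mU : measurable_fun (`[a, b] `|` `]b, last b s]) (fun t => enorm (derive1 c t)).
  by apply/measurable_funU => //; split.
split; first by rewrite ltW// (lt_le_trans ab).
  by rewrite U.
rewrite U ge0_integral_setU//; first last.
- apply/disj_setPRL => t /=; rewrite !in_itv/= => /andP[bt _] /andP[_ tb].
  by move: (lt_le_trans bt tb); rewrite ltxx.
- by move=> t _; rewrite lee_fin enorm_ge0.
- exact/measurable_EFinP.
have -> : c (last b s) - c a = (c (last b s) - c b) + (c b - c a).
  by rewrite addrA subrK.
apply: (@le_trans _ _ ((enorm (c (last b s) - c b))%:E + (enorm (c b - c a))%:E)%E).
  by rewrite -EFinD lee_fin enorm_triangle.
rewrite addeC; apply: leeD; last first.
  have [ca cb] : c a = g a /\ c b = g b by split; apply: cE; rewrite lexx ltW.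
  rewrite ca cb; apply: le_trans (chord_le_length ab dg' cg') _.
  have EI := @eq_integral_itv_bounded R a b (fun t => enorm (derive1 g t))
    (fun t => enorm (derive1 c t)) true false mc mg
    (fun t tI => congr1 (@enorm R n) (E t tI)).
  exact: eq_ind (fun x => (_ <= x)%E) (lexx _) _ (esym EI).
by rewrite integral_itv_obnd_cbnd//; exact/measurable_EFinP.
Qed.

Lemma chord_le_curve_length n (c : R -> 'rV[R]_n) :
  piecewise_C1 c -> ((enorm (c 1 - c 0))%:E <= curve_length c)%E.
Proof.
by move=> [s [ps ls h]]; have [_ _] := piecewise_length ps h; rewrite ls.
Qed.

Lemma constant_of_derive0 n (f : R -> 'rV[R]_n) (a b : R) :
  (forall t, a < t < b -> is_derive t 1 f 0) ->
  forall s t, a < s < b -> a < t < b -> f s = f t.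
Proof.
move=> h; suff H s t : a < s < b -> a < t < b -> s <= t -> f s = f t.
  move=> s t sI tI; case: (leP s t) => st; first exact: H.
  by apply/esym/H => //; exact: ltW.
move=> /andP[as_ sb] /andP[at_ tb] st; apply/rowP => j.
have d x : s <= x <= t -> is_derive x 1 (fun y => f y 0 j) 0.
  move=> /andP[sx xt]; have /h/is_derive_mxP/(_ 0 j) : a < x < b.
    by rewrite (lt_le_trans as_ sx) (le_lt_trans xt tb).
  by rewrite mxE.
have [x _] := @MVT_closed R (fun y => f y 0 j) (fun _ : R => 0 : R) s t st d.
by rewrite mul0r => /eqP; rewrite subr_eq0 => /eqP ->.
Qed.

Lemma Ck_id n k : Ck k (setT : set 'rV[R]_n) (id : 'rV[R]_n -> 'rV[R]_n).
Proof.
have E (v : 'rV[R]_n) : 'D_v (id : 'rV[R]_n -> 'rV[R]_n) = cst v.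
  by apply/funext => x; rewrite derive_id.
case: k => [u _|k]; first exact: cvg_id.
split=> [u _|v]; first exact: ex_diff.
rewrite E; elim: k v => [v u _|k IH v]; first exact: cst_continuous.
split=> [u _|w]; first exact: differentiable_cst.
have -> : 'D_w (cst v) = cst 0 by apply/funext => x; rewrite derive_cst.
exact: IH.
Qed.

Lemma chart_id n : chart (setT : set 'rV[R]_n) setT (id : 'rV[R]_n -> 'rV[R]_n).
Proof.
split.
- exact: openT.
- exact: Ck_id.
- move=> u _ x y.
  have d : differentiable (id : 'rV[R]_n -> 'rV[R]_n) u by exact: ex_diff.
  by rewrite -!deriveE// !derive_id.
- split; first by apply: continuous_subspaceT => ?; exact: cvg_id.
  by exists id => //; apply: continuous_subspaceT => ?; exact: cvg_id.
- by exists setT; [exact: openT|rewrite image_id setTI].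
Qed.

Lemma tangent_euclid n (x w : 'rV[R]_n) : tangent n setT x w.
Proof.
exists setT, id, x, w; split=> //; first exact: chart_id.
by rewrite derive_id.
Qed.

(** In the identity chart the metric is constant, so the Christoffel
symbols vanish. *)
Lemma euclid_covariant_acceleration n (c : R -> 'rV[R]_n) (t : R) :
  (\forall s \near t, derivable c s 1) -> derivable (derive1 c) t 1 ->
  covariant_acceleration n setT c t (derive1 (derive1 c) t).
Proof.
move=> dc dc'; exists setT, id, c; split.
- exact: chart_id.
- by apply: filterS dc => s ds; split.
- exact: dc'.
have G0 k i j : christoffel (id : 'rV[R]_n -> 'rV[R]_n) k i j (c t) = 0.
  have D0 a b d : dmetric (id : 'rV[R]_n -> 'rV[R]_n) a b d (c t) = 0.
    rewrite /dmetric.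
    have -> : (fun h => metric (id : 'rV[R]_n -> 'rV[R]_n) h b d : R) =
       cst (inner (delta_mx 0 b : 'rV[R]_n) (delta_mx 0 d : 'rV[R]_n)).
      by apply/funext => h; rewrite metricE !derive_id.
    by rewrite derive_cst.
  by rewrite /christoffel big1 ?mulr0// => l _; rewrite !D0 addr0 subr0 mulr0.
rewrite [LHS]row_sum_delta; apply: eq_bigr => k _; rewrite derive_id; congr (_ *: _).
rewrite big1 ?addr0// => i _; rewrite big1// => j _.
by rewrite G0 !mul0r.
Qed.

(** The chart in the definition is arbitrary, but every vector of R^n is
tangent, so the difference of the two accelerations is orthogonal to itself. *)
Lemma covariant_acceleration_euclid n (c : R -> 'rV[R]_n) (t : R) (w : 'rV[R]_n) :
  covariant_acceleration n setT c t w ->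
  [/\ \forall s \near t, derivable c s 1, derivable (derive1 c) t 1 &
      w = derive1 (derive1 c) t].
Proof.
move=> /gauss_formula [U [phi [z [chrt nz dc' _ orth]]]]; split=> //.
  by apply: filterS nz => s [_ _ []].
have [oU [dphi _] imm _ _] := chrt.
have [Ut _ _] := nbhs_singleton nz.
have [P JP] := injective_right_inverse (imm _ Ut).
apply/esym/eqP; rewrite -subr_eq0; apply/eqP/inner_eq0.
set v := _ - w; have := orth (v *m P).
by rewrite -mulmxA (mulmx1C JP) mulmx1.
Qed.

Lemma geodesic_euclid n (c : R -> 'rV[R]_n) : geodesic n setT c ->
  exists2 e, 0 < e & forall t, - e < t < 1 + e -> c t = t *: derive1 c 0 + c 0 /\
    is_derive t 1 c (derive1 c 0).
Proof.
move=> [e e0 h]; exists e => //.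
have h' (t : R) : - e < t < 1 + e -> derivable c t 1 /\ is_derive t 1 (derive1 c) 0.
  move=> tI; have [n1 d E] := covariant_acceleration_euclid (h t tI).
  split; first exact: nbhs_singleton n1.
  by rewrite E derive1E; exact: derivableP.
have I0 : - e < 0 < 1 + e by rewrite oppr_lt0 e0 ltr_wpDl.
have E1 (t : R) : - e < t < 1 + e -> derive1 c t = derive1 c 0.
  move=> tI; apply: (constant_of_derive0 (a := - e) (b := 1 + e)) => // s /h'[]//.
have d (t : R) : - e < t < 1 + e -> is_derive t 1 c (derive1 c 0).
  by move=> tI; rewrite -(E1 t tI) derive1E; apply: derivableP; case: (h' t tI).
move=> t tI; split; last exact: d.
have d2 (s : R) : - e < s < 1 + e -> is_derive s 1 (fun x => c x - (x *: derive1 c 0 + c 0)) 0.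
  move=> sI; rewrite -(subrr (derive1 c 0)); apply: is_deriveB; first exact: d.
  exact: is_derive_affine.
have := constant_of_derive0 d2 tI I0.
by rewrite scale0r add0r subrr => /eqP; rewrite subr_eq0 => /eqP.
Qed.

Lemma geodesic_affine n (x y : 'rV[R]_n) :
  geodesic n setT (fun t : R => t *: (y - x) + x).
Proof.
exists 1 => // t _; set c := fun t : R => _.
have dc (s : R) : is_derive s 1 c (y - x) by exact: is_derive_affine.
have E : derive1 c = cst (y - x).
  by apply/funext => s; rewrite derive1E; exact: is_deriveE (dc s).
have -> : 0 = derive1 (derive1 c) t by rewrite E derive1_cst.
apply: euclid_covariant_acceleration; first exact: (@filterE _ (nbhs (t : R)) _ _ (fun s => let: DeriveDef d _ := dc s in d)).
by rewrite E; exact: derivable_cst.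
Qed.

Lemma integral_II_cst (k : R) :
  (\int[lebesgue_measure]_(t in (II : set R)) k%:E)%E = k%:E.
Proof.
have E : lebesgue_measure (II : set R) = 1%E.
  by rewrite lebesgue_measure_itv/= lte01 oppr0 adde0.
apply: etrans (integral_cst _ _ _) _ => //.
by apply: etrans (congr1 (fun x => k%:E * x)%E E) _; exact: mule1.
Qed.

Lemma curve_length_cst n (c : R -> 'rV[R]_n) (k : R) :
  (forall t, II t -> enorm (derive1 c t) = k) -> curve_length c = k%:E.
Proof.
move=> h; rewrite /curve_length -(integral_II_cst k).
by apply: eq_integral => t; rewrite inE => /h ->.
Qed.

Lemma piecewise_C1_smooth n (c : R -> 'rV[R]_n) : Ck 1 setT c -> piecewise_C1 c.
Proof.
move=> h; exists [:: 1]; split=> //=; first by rewrite ltr01.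
by move=> [|//] _; exists c.
Qed.

Lemma rdist_euclid n (x y : 'rV[R]_n) : rdist setT x y = (enorm (y - x))%:E.
Proof.
apply/eqP; rewrite eq_le; apply/andP; split; last first.
  apply: le_ereal_inf_tmp => _ [c [pc _ c0 c1] <-].
  by rewrite -c0 -c1; exact: chord_le_curve_length.
apply: ereal_inf_lbound => /=; exists (fun t : R => t *: (y - x) + x).
  have dc (s : R) : is_derive s 1 (fun t : R => t *: (y - x) + x) (y - x).
    exact: is_derive_affine.
  split=> //; [|by rewrite scale0r add0r|by rewrite scale1r subrK].
  apply: piecewise_C1_smooth; split=> [u _|v u _].
    by apply/derivable1_diffP; case: (dc u).
  have -> : 'D_v (fun t : R => t *: (y - x) + x) = cst (v *: (y - x)).
    apply/funext => s; have ds := derivable_diff (dc s).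
    by rewrite deriveE// diff_val.
  exact: cst_continuous.
apply: curve_length_cst => t _; congr enorm; rewrite derive1E.
exact: is_deriveE (is_derive_affine _ _ _).
Qed.

Lemma minimizing_affine n (x y : 'rV[R]_n) :
  minimizing_geodesic n setT x y (fun t : R => t *: (y - x) + x).
Proof.
split; [exact: geodesic_affine|by rewrite scale0r add0r|by rewrite scale1r subrK|].
rewrite rdist_euclid; apply: curve_length_cst => t _; congr enorm.
by rewrite derive1E; exact: is_deriveE (is_derive_affine _ _ _).
Qed.

Lemma minimizing_euclid n (x y : 'rV[R]_n) c : minimizing_geodesic n setT x y c ->
  derive1 c 0 = y - x /\ forall t, II t -> c t = t *: (y - x) + x.
Proof.
move=> [/geodesic_euclid[e e0 h] c0 c1 _].
have I t : 0 <= t <= 1 -> - e < t < 1 + e.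
  by move=> /andP[t0 t1]; rewrite (lt_le_trans _ t0) ?oppr_lt0// (le_lt_trans t1)// ltrDl.
have I1 : 0 <= (1 : R) <= 1 by rewrite ler01 lexx.
have [E _] := h 1 (I 1 I1).
have v : derive1 c 0 = y - x.
  by rewrite -c1 -c0 E scale1r addrK.
split=> // t; rewrite /= in_itv/= => /I/h[-> _].
by rewrite v c0.
Qed.

Lemma exp_inv_euclid n (x y : 'rV[R]_n) : exp_inv n setT x y = y - x.
Proof.
rewrite /exp_inv; set P := [set w | _].
have : P (get P).
  by apply: (getPex (P := P)); exists (y - x); exists (fun t : R => t *: (y - x) + x);
    [exact: minimizing_affine|rewrite derive1E; apply/esym/is_deriveE/is_derive_affine].
by move=> [c /minimizing_euclid[-> _] ->].
Qed.

Lemma convex_euclid_ball n (x : 'rV[R]_n) (r : R) :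
  convex_in n setT [set y | enorm (y - x) < r].
Proof.
split=> // y z /= yr zr; exists (fun t : R => t *: (z - y) + y); split.
- exact: minimizing_affine.
- move=> t /=; rewrite in_itv/= => /andP[t0 t1].
  have -> : t *: (z - y) + y - x = t *: (z - x) + (1 - t) *: (y - x).
    by rewrite scalerBl scale1r addrCA -scalerBr opprB addrA subrK -addrA addrC.
  apply: le_lt_trans (enorm_triangle _ _) _; rewrite !enormZ.
  have t1' : 0 <= 1 - t by rewrite subr_ge0.
  rewrite (ger0_norm t0) (ger0_norm t1').
  have [->|tn0] := eqVneq t 0; first by rewrite mul0r add0r subr0 mul1r.
  have tp : 0 < t by rewrite lt_neqAle eq_sym tn0.
  have -> : r = t * r + (1 - t) * r by ring.
  by rewrite ltr_leD ?ltr_pM2l// ler_wpM2l// ltW.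
move=> c /minimizing_euclid[_ h] t; rewrite inE => /h ->//.
Qed.

Lemma nbhs_enorm_ball n (x : 'rV[R]_n) (r : R) : 0 < r ->
  within setT (nbhs x) [set y | enorm (y - x) < r].
Proof.
move=> r0; rewrite /within/=.
have n0 : 0 < n%:R + 1 :> R by rewrite ltr_wpDl.
apply/nbhs_ballP; exists (r / (n%:R + 1)); first by rewrite /= divr_gt0.
move=> y; rewrite -ball_normE /= distrC => yr _.
apply: le_lt_trans (enorm_le_norm _) _.
apply: (@le_lt_trans _ _ ((n%:R + 1) * `|y - x|)).
  by rewrite ler_wpM2r// lerDl.
by rewrite mulrC -ltr_pdivlMr.
Qed.

Lemma proximal_normal_euclid n (S : set 'rV[R]_n) (x w : 'rV[R]_n) (r s : R) :
  0 < r -> 0 < s ->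
  (forall y, S y -> enorm (y - x) < r -> inner w (y - x) <= s * enorm (y - x) ^+ 2) ->
  proximal_normal n setT S x w.
Proof.
move=> r0 s0 h; split; first exact: tangent_euclid.
exists s, [set y | enorm (y - x) < r]; split=> //.
- exact: convex_euclid_ball.
- exact: nbhs_enorm_ball.
move=> y yr Sy; rewrite exp_inv_euclid rdist_euclid -EFin_expe -EFinM lee_fin.
exact: h.
Qed.

End Euclid.

(** * Proximal normals in [M] and in R^n *)

Section Prox.
Context {R : realType}.

(** A Lipschitz bound between two curves passes to their velocities. Here
[g] will be a geodesic, and [f] a component of its velocity. *)
Lemma derive_le_of_near_le (V W : normedModType R) (f : R -> V) (g : R -> W)
    (t C : R) (a : V) (b : W) : 0 <= C ->
  is_derive t 1 f a -> is_derive t 1 g b ->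
  (\forall s \near t, `|f s - f t| <= C * `|g s - g t|) -> `|a| <= C * `|b|.
Proof.
move=> C0 /is_derive_littleo df /is_derive_littleo dg h.
have C1 : 0 < C + 1 by rewrite ltr_wpDl.
apply/ler_addgt0Pr => e e0; have e1 : 0 < e / (C + 1) by rewrite divr_gt0.
set d := e / (C + 1) in e1.
have H : \forall s \near t^', [/\ `|f s - f t - (s - t) *: a| <= d * `|s - t|,
   `|g s - g t - (s - t) *: b| <= d * `|s - t|,
   `|f s - f t| <= C * `|g s - g t| & s != t].
  near=> s; split.
  - by near: s; apply: cvg_within; exact: df.
  - by near: s; apply: cvg_within; exact: dg.
  - by near: s; apply: cvg_within; exact: h.
  - by near: s; exact: nbhs_dnbhs_neq.
have [s [h1 h2 h3 st]] := @filter_ex _ _ (Proper_dnbhs_numFieldType (t : R)) _ H.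
have q0 : 0 < `|s - t| by rewrite normr_gt0 subr_eq0.
have k1 : `|s - t| * `|a| <= `|f s - f t| + d * `|s - t|.
  rewrite -normrZ -[X in `|X|](subKr (f s - f t)).
  by apply: le_trans (ler_normB _ _) _; rewrite lerD2l.
have k2 : `|g s - g t| <= `|s - t| * `|b| + d * `|s - t|.
  by rewrite -normrZ; exact: norm_le_of_dist.
have k3 : `|s - t| * `|a| <= C * (`|s - t| * `|b| + d * `|s - t|) + d * `|s - t|.
  apply: le_trans k1 _; rewrite lerD2r; apply: le_trans h3 _.
  by rewrite ler_wpM2l.
rewrite -(ler_pM2l q0); apply: le_trans k3 _.
have -> : e = d * (C + 1) by rewrite /d divfK// gt_eqF.
by rewrite le_eqVlt; apply/orP; left; apply/eqP; ring.
Unshelve. all: by end_near. Qed.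

(** Points of [N] that are close in the ambient space have close
coordinates, as the inverse of a chart is continuous. *)
Lemma chart_near m n N (U : set 'rV[R]_m) (phi : 'rV[R]_m -> 'rV[R]_n) u0 (r : R) :
  chart N U phi -> U u0 -> 0 < r ->
  exists2 d : R, 0 < d & forall y, N y -> `|y - phi u0| < d ->
    exists u, [/\ U u, ball u0 r u & phi u = y].
Proof.
move=> chrt Uu0 r0; have [g [V [oV phiNV gN cg]]] := chart_inverse chrt.
have [gphi Nx Vx] := phiNV _ Uu0.
have /subspace_continuousP cg' := cg.
have nb : \forall y \near phi u0, (N `&` V) y -> ball u0 r (g y).
  have H0 : g y @[y --> within (N `&` V) (nbhs (phi u0))] --> g (phi u0).
    exact: cg' (phi u0) (conj Nx Vx).
  rewrite gphi in H0; have /cvgrPdist_lt/(_ r r0) H1 := H0.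
  apply: (@filterS _ (nbhs (phi u0)) _ _ _ _ H1) => y h NVy.
  by rewrite -ball_normE /=; exact: h.
have nV : \forall y \near phi u0, V y by exact: open_nbhs_nbhs.
have /nbhs_ballP[d /= d0 H] :
    nbhs (phi u0) ([set y | (N `&` V) y -> ball u0 r (g y)] `&` [set y | V y]).
  exact: filterI nb nV.
exists d => // y Ny yd.
have [h1 h2] : ((N `&` V) y -> ball u0 r (g y)) /\ V y.
  by apply: H; rewrite -ball_normE /= distrC.
by exists (g y); have [? ?] := gN _ Ny h2; split=> //; exact: h1.
Qed.

(** The chart in the definition of the covariant acceleration may change
with time; the tangent space does not depend on it, so that tangency of the
velocity and normality of the acceleration can be read in a fixed chart. *)
Lemma geodesic_in_chart m n N (U : set 'rV[R]_m) (phi : 'rV[R]_m -> 'rV[R]_n)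
    (c : R -> 'rV[R]_n) (s : R) v :
  chart N U phi -> U v -> covariant_acceleration m N c s 0 -> c s = phi v ->
  (exists k : 'rV[R]_m, derive1 c s = k *m 'J phi v) /\
  forall h : 'rV[R]_m, inner (derive1 (derive1 c) s) (h *m 'J phi v) = 0.
Proof.
move=> chrt Uv /gauss_formula[W [psi [z [chrt' nz dc' _ orth]]]] cE.
have [Wz czE dcz] := nbhs_singleton nz.
have dd n' (U' : set 'rV[R]_n') (psi' : 'rV[R]_n' -> 'rV[R]_n) x :
    chart N U' psi' -> U' x -> differentiable psi' x.
  by move=> [_ [d _] _ _ _] U'x; exact: d.
split.
  have := tangent_transition (Phi := id) chrt' chrt Wz Uv _ (dd _ _ _ _ chrt' Wz) (dd _ _ _ _ chrt Uv).
  rewrite -czE -cE => /(_ erefl (derive1 z s))[k [kE _]]; exists k.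
  rewrite (is_derive1E dcz); exact: kE.
move=> h.
have := tangent_transition (Phi := id) chrt chrt' Uv Wz _ (dd _ _ _ _ chrt Uv) (dd _ _ _ _ chrt' Wz).
rewrite -czE -cE => /(_ erefl h)[k [-> _]].
by have := orth k; rewrite subr0.
Qed.

(** The acceleration is normal and the velocity tangent, so the derivative
of the squared speed vanishes. *)
Lemma geodesic_regular m n N (c : R -> 'rV[R]_n) : geodesic m N c ->
  exists2 e : R, 0 < e & forall t, - e < t < 1 + e ->
  [/\ covariant_acceleration m N c t 0, N (c t), is_derive t 1 c (derive1 c t),
      is_derive t 1 (derive1 c) (derive1 (derive1 c) t) &
      enorm (derive1 c t) = enorm (derive1 c 0)].
Proof.
move=> [e e0 h]; exists e; first exact: e0.
have H (t : R) : - e < t < 1 + e -> [/\ N (c t), is_derive t 1 c (derive1 c t),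
      is_derive t 1 (derive1 c) (derive1 (derive1 c) t) &
      inner (derive1 (derive1 c) t) (derive1 c t) = 0].
  move=> /h; move=> ca; have [W [psi [z [chrt nz dc' _ orth]]]] := gauss_formula ca.
  have [Wz czE dcz] := nbhs_singleton nz; split.
  - by have [g [V [_ phiNV _ _]]] := chart_inverse chrt; rewrite czE; have [] := phiNV _ Wz.
  - by rewrite (is_derive1E dcz).
  - exact: is_derive1P.
  - have := orth (derive1 z t); rewrite subr0.
    by rewrite (is_derive1E dcz).
have K (t : R) : - e < t < 1 + e ->
   is_derive t 1 (fun s => inner (derive1 c s) (derive1 c s)) 0.
  move=> /H[_ _ d o]; apply: (is_derive_eq (is_derive_inner d d)).
  by rewrite (innerC (derive1 c t)) o addr0.
have I0 : - e < 0 < 1 + e by rewrite oppr_lt0 e0 ltr_wpDl.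
have E (s t : R) : - e < s < 1 + e -> - e < t < 1 + e -> s <= t ->
    inner (derive1 c s) (derive1 c s) = inner (derive1 c t) (derive1 c t).
  move=> /andP[s1 s2] /andP[t1 t2] st.
  have [x xI|x _] := @MVT_closed R (fun s => inner (derive1 c s) (derive1 c s)) (fun _ : R => 0 : R) s t st.
    apply: K; move: xI => /andP[sx xt].
    by rewrite (lt_le_trans s1 sx) (le_lt_trans xt t2).
  by rewrite mul0r => /eqP; rewrite subr_eq0 => /eqP ->.
move=> t tI; have [Nt dct dc't _] := H t tI.
split; [exact: h|exact: Nt|exact: dct|exact: dc't|].
congr Num.sqrt; case: (leP t 0) => t0; first exact: E.
by apply/esym/E => //; exact: ltW.
Qed.

(** The remainder is a double integral of c'', so the matter is to bound
c'' by the squared speed. Let nu = c''(s), a normal vector at c(s). Then <nu, c'>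
vanishes at [s]; at a nearby time it is the pairing of [nu] with a tangent vector
at another point, and as the tangent space varies in a Lipschitz way, it is at
most a constant times |nu| |c'| |c(x) - c(s)|. Differentiating at [s] gives
|nu|^2 <= C |nu| |c'|^2. *)
Lemma geodesic_taylor m n N (U : set 'rV[R]_m) (phi : 'rV[R]_m -> 'rV[R]_n) u0 (r K d : R)
    (c : R -> 'rV[R]_n) (w : 'rV[R]_n) :
  chart N U phi -> 0 < K -> ball u0 r `<=` U ->
  (forall u v : 'rV[R]_m, ball u0 r u -> ball u0 r v ->
    [/\ `|v - u| <= K * `|phi v - phi u|,
        forall h : 'rV[R]_m, `|h| <= K * `|h *m 'J phi u| &
        `|'J phi v - 'J phi u| <= K * `|v - u|]) ->
  (forall y, N y -> `|y - phi u0| < d -> exists u, [/\ U u, ball u0 r u & phi u = y]) ->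
  geodesic m N c -> c 0 = phi u0 -> enorm (derive1 c 0) < d ->
  `|inner w (c 1 - c 0 - derive1 c 0)| <=
    n%:R * `|w| * (n%:R * m%:R * K ^+ 3) * enorm (derive1 c 0) ^+ 2.
Proof.
move=> chrt K0 rU hK hd /geodesic_regular[e e0 h] c0 ld.
have l0 := enorm_ge0 (derive1 c 0).
move lE : (enorm (derive1 c 0)) => l in ld l0 h *.
have I01 (s : R) : 0 <= s <= 1 -> - e < s < 1 + e.
  by move=> /andP[s0 s1]; rewrite (lt_le_trans _ s0) ?oppr_lt0// (le_lt_trans s1)// ltrDl.
have I00 : 0 <= (0 : R) <= 1 by rewrite lexx ler01.
have c'l (s : R) : - e < s < 1 + e -> `|derive1 c s| <= l.
  by move=> /h[_ _ _ _ <-]; exact: norm_le_enorm.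
(* The geodesic is shorter than [d], so it stays in the image of the chart. *)
have near_x (s : R) : 0 <= s <= 1 -> `|c s - phi u0| < d.
  move=> sI; apply: le_lt_trans ld; rewrite -c0.
  apply: normv_le => // i j; rewrite ord1 mxB_entry.
  have [s0 s1] := andP sI.
  have dc (x : R) : 0 <= x <= s -> is_derive x 1 (fun y => c y 0 j) (derive1 c x 0 j).
    move=> /andP[x0 xs]; have /I01/h[_ _ d1 _ _] : 0 <= x <= 1 by rewrite x0 (le_trans xs).
    by move: d1 => /is_derive_mxP.
  have [x /andP[x0 xs] ->] := MVT_closed s0 dc.
  rewrite subr0 normrM (ger0_norm s0).
  have xI : 0 <= x <= 1 by rewrite x0 (le_trans xs).
  have := le_trans (normv_coord _ _ _) (c'l x (I01 x xI)).
  by move=> q; rewrite -[leRHS]mulr1 ler_pM.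
have acc (s : R) : 0 <= s <= 1 -> `|derive1 (derive1 c) s| <= n%:R * m%:R * K ^+ 3 * l ^+ 2.
  move=> sI; have sI' := I01 s sI.
  have [cas Ns dcs dc's ls] := h s sI'.
  have [v [Uv bv vE]] := hd _ Ns (near_x s sI).
  have [_ orth] := geodesic_in_chart chrt Uv cas (esym vE).
  move: (derive1 (derive1 c) s) dc's orth => nu dc's orth.
  have dF : is_derive s 1 (fun x => inner nu (derive1 c x)) (inner nu nu).
    exact: is_derive_innerl.
  have C0 : 0 <= n%:R * m%:R * K ^+ 3 * `|nu| * l.
    by rewrite !mulr_ge0// ltW.
  have near_s : \forall x \near s, `|inner nu (derive1 c x) - inner nu (derive1 c s)|
      <= n%:R * m%:R * K ^+ 3 * `|nu| * l * `|c x - c s|.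
    have n1 : \forall x \near s, - e < x < 1 + e.
      have := @near_in_itvoo _ (- e) (1 + e) s; rewrite in_itv/= => /(_ sI').
      by apply: filterS => x; rewrite in_itv.
    have n2 : \forall x \near s, `|c x - phi u0| < d.
      have cc : {for s, continuous (fun x => `|c x - phi u0|)}.
        by apply: continuous_comp; [apply: cvgB; [exact: is_derive_continuous dcs|exact: cvg_cst]|exact: norm_continuous].
      exact: (cvgr_lt _ cc _ (near_x s sI)).
    apply: filterS2 n1 n2 => x xI xd.
    have [cax Nx dcx _ lx] := h x xI.
    have [v' [Uv' bv' vE']] := hd _ Nx xd.
    have [[k kE] _] := geodesic_in_chart chrt Uv' cax (esym vE').
    have [[k0 k0E] _] := geodesic_in_chart chrt Uv cas (esym vE).
    have -> : inner nu (derive1 c s) = 0 by rewrite k0E orth.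
    have kn := c'l x xI; rewrite kE in kn.
    (* [nu] is orthogonal to [k *m 'J phi v], the tangent vector at time [s] with
       the same coordinates as the velocity at time [x]. *)
    rewrite subr0 kE -[inner nu _]subr0 -(orth k) -innerBr -mulmxBr.
    have [e1 _ e3] := hK _ _ bv bv'.
    have [_ e2 _] := hK _ _ bv' bv'.
    rewrite -vE -vE'.
    have q1 : `|k| <= K * l by apply: le_trans (e2 k) _; rewrite ler_wpM2l// ltW.
    have q2 : `|'J phi v' - 'J phi v| <= K * (K * `|phi v' - phi v|).
      by apply: le_trans e3 _; rewrite ler_wpM2l// ltW.
    have q3 : `|k *m ('J phi v' - 'J phi v)| <= m%:R * (K * (K * `|phi v' - phi v|)) * (K * l).
      apply: le_trans (norm_mulmx_le _ _) _.
      by rewrite ler_pM ?mulr_ge0// ler_wpM2l.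
    apply: le_trans (norm_inner_le _ _) _.
    apply: le_trans (_ : n%:R * `|nu| * (m%:R * (K * (K * `|phi v' - phi v|)) * (K * l)) <= _).
      by rewrite ler_wpM2l// mulr_ge0.
    by rewrite le_eqVlt; apply/orP; left; apply/eqP; ring.
  have := derive_le_of_near_le C0 dF dcs near_s.
  rewrite ger0_norm ?inner_ge0// => B.
  have {}B : `|nu| ^+ 2 <= n%:R * m%:R * K ^+ 3 * `|nu| * l * l.
    apply: le_trans (norm2_le_inner _) _; apply: le_trans B _.
    by rewrite ler_wpM2l// c'l.
  have [nu0|nu0] := eqVneq `|nu| 0.
    by rewrite nu0 !mulr_ge0 ?exprn_ge0// ?sqr_ge0// ltW.
  have nup : 0 < `|nu| by rewrite lt_neqAle eq_sym nu0 /=.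
  rewrite -(ler_pM2l nup) -expr2; apply: le_trans B _.
  by rewrite le_eqVlt; apply/orP; left; apply/eqP; ring.
have dp (s : R) : 0 <= s <= 1 -> is_derive s 1 (fun x => inner w (c x - (x *: derive1 c 0 + 0)))
    (inner w (derive1 c s - derive1 c 0)).
  move=> /I01/h[_ _ d1 _ _]; apply: is_derive_innerl; apply: is_deriveB => //.
  exact: is_derive_affine.
have [s sI] := MVT_closed ler01 dp.
rewrite !addr0 scale1r scale0r !subr0 mulr1 -innerBr => E.
have -> : c 1 - c 0 - derive1 c 0 = c 1 - derive1 c 0 - c 0 by rewrite addrAC.
rewrite E; have [s0 s1] := andP sI.
have dq (x : R) : 0 <= x <= s -> is_derive x 1 (fun x => inner w (derive1 c x))
    (inner w (derive1 (derive1 c) x)).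
  move=> /andP[x0 xs]; have /I01/h[_ _ _ d2 _] : 0 <= x <= 1 by rewrite x0 (le_trans xs).
  exact: is_derive_innerl.
have [x /andP[x0 xs]] := MVT_closed s0 dq.
rewrite -innerBr subr0 => ->; rewrite normrM (ger0_norm s0).
have xI : 0 <= x <= 1 by rewrite x0 (le_trans xs).
apply: le_trans (_ : `|inner w (derive1 (derive1 c) x)| <= _); first by rewrite ler_piMr.
apply: le_trans (norm_inner_le _ _) _.
rewrite -[leRHS]mulrA; apply: ler_wpM2l; first by rewrite mulr_ge0.
exact: acc.
Qed.

Lemma is_derive_sin_quarter (t : R) :
  is_derive t 1 (fun s : R => sin (pi / 2 * s)) (pi / 2 * cos (pi / 2 * t)).
Proof.
have d : is_derive t 1 (fun s : R => pi / 2 * s) (pi / 2).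
  have -> : (fun s : R => pi / 2 * s) = (fun s : R => s * (pi / 2)).
    by apply/funext => s; rewrite mulrC.
  exact: is_derive_scalel.
rewrite [X in is_derive _ _ _ X]mulrC; exact: (is_derive1_comp (f := sin) (is_derive_sin _) d).
Qed.

(** The competitor is the image of the coordinate segment from [u0] to [u],
run through with the parameter sin (pi t / 2). Curves have to be C^1 on the whole
real line, and this parameter keeps them in the chart for all times. *)
Lemma rdist_chart_le m n N (U : set 'rV[R]_m) (phi : 'rV[R]_m -> 'rV[R]_n) u0 (r K : R) u :
  chart N U phi -> ball u0 r `<=` U ->
  (forall v : 'rV[R]_m, ball u0 r v -> `|'J phi v| <= K) -> 0 < K ->
  ball u0 r u ->
  (rdist N (phi u0) (phi u) <= (n%:R * (m%:R * K * (2 * `|u - u0|)))%:E)%E.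
Proof.
move=> chrt rU JK K0 ru; have [oU C2 _ _ _] := chrt.
have [dphi C1] := C2.
have [g [V [_ phiNV _ _]]] := chart_inverse chrt.
pose q (t : R) : 'rV[R]_m := sin (pi / 2 * t) *: (u - u0) + u0.
pose c (t : R) := phi (q t).
have rq t : ball u0 r (q t).
  rewrite -ball_normE /= distrC addrK normrZ.
  apply: (@le_lt_trans _ _ `|u - u0|); last by move: ru; rewrite -ball_normE /= distrC.
  by rewrite ler_piMl// ler_norml sin_geN1 sin_le1.
have dq (t : R) : is_derive t 1 q ((pi / 2 * cos (pi / 2 * t)) *: (u - u0)).
  rewrite -[X in is_derive _ _ _ X]addr0; apply: is_deriveD.
  apply/is_derive_mxP => i j; rewrite mxE.
  have -> : (fun s : R => (sin (pi / 2 * s) *: (u - u0)) i j) =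
     (fun s : R => sin (pi / 2 * s) * (u - u0) i j).
    by apply/funext => s; rewrite mxE.
  have := is_derive_mulr (is_derive_sin_quarter t) (is_derive_cst ((u - u0) i j) t 1).
  by rewrite mulr0 addr0.
have dc (t : R) : is_derive t 1 c (((pi / 2 * cos (pi / 2 * t)) *: (u - u0)) *m 'J phi (q t)).
  by apply: is_derive_compv (dq t); apply: dphi; exact: rU.
have c'E : derive1 c = fun t => ((pi / 2 * cos (pi / 2 * t)) *: (u - u0)) *m 'J phi (q t).
  by apply/funext => t; exact: is_derive1E (dc t).
have cc' : continuous (derive1 c).
  move=> t; rewrite c'E; apply: cvg_mulmx; last first.
    apply: (cvg_comp q (jacobian phi)).
      exact: is_derive_continuous (dq t).
    exact: continuous_jacobian oU (Ck2_Ck1 C2) (rU _ (rq t)).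
  apply: cvgZr_tmp; apply: cvgMl_tmp.
  apply: (cvg_comp (fun s : R => pi / 2 * s) cos); last exact: continuous_cos.
  by apply: cvgMl_tmp; exact: cvg_id.
have lenc : (curve_length c <= (n%:R * (m%:R * K * (2 * `|u - u0|)))%:E)%E.
  rewrite -integral_II_cst; apply: ge0_le_integral => //.
  - by move=> t _; rewrite lee_fin enorm_ge0.
  - apply/measurable_EFinP; apply: measurable_funTS; apply: continuous_measurable_fun => t.
    by apply: continuous_enorm; exact: cc'.
  move=> t _; rewrite lee_fin; apply: le_trans (enorm_le_norm _) _.
  rewrite ler_wpM2l// c'E; apply: le_trans (norm_mulmx_le _ _) _.
  rewrite ler_pM ?mulr_ge0//; first by rewrite ler_wpM2l// JK.
  rewrite normrZ ler_wpM2r// normrM -[leRHS]mulr1 ler_pM//.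
    by have /andP[p0 p2] := pihalf_02 R; rewrite ger0_norm ltW.
  by rewrite ler_norml cos_geN1 cos_le1.
apply: le_trans lenc; apply: ereal_inf_lbound => /=; exists c => //; split.
- apply: piecewise_C1_smooth; split=> [t _|v t _].
    by apply/derivable1_diffP; case: (dc t).
  have -> : 'D_v c = fun s => v *: derive1 c s.
    apply/funext => s; have ds := derivable_diff (dc s).
    by rewrite deriveE// diff_val c'E.
  by apply: cvgZl_tmp; exact: cc'.
- by move=> t _; have [] := phiNV _ (rU _ (rq t)).
- by rewrite /c /q mulr0 sin0 scale0r add0r.
- by rewrite /c /q mulr1 sin_pihalf scale1r subrK.
Qed.

Lemma convex_exp_inv m n (N V : set 'rV[R]_n) x y : convex_in m N V -> V x -> V y ->
  exists2 c, minimizing_geodesic m N x y c & exp_inv m N x y = derive1 c 0.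
Proof.
move=> [_ h] Vx Vy; rewrite /exp_inv; set P := [set w | _].
have : P (get P).
  by have [c [mc _ _]] := h x y Vx Vy; apply: (getPex (P := P)); exists (derive1 c 0), c.
by move=> [c mc E]; exists c.
Qed.

(** A geodesic has constant speed, which is therefore its length. *)
Lemma minimizing_speed m n (N : set 'rV[R]_n) x y c : minimizing_geodesic m N x y c ->
  rdist N x y = (enorm (derive1 c 0))%:E.
Proof.
move=> [/geodesic_regular[e e0 h] _ _ <-]; apply: curve_length_cst => t /=.
rewrite in_itv/= => /andP[t0 t1]; have [|//] := h t.
by rewrite (lt_le_trans _ t0) ?oppr_lt0// (le_lt_trans t1)// ltrDl.
Qed.

(** With [a] the acceleration in R^n and [v] the initial velocity of the
geodesic of [M] from [x] to [y], the three terms of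
<a, y - x> = <a - w, y - x> + <w, v> + <w, y - x - v> are O(|y - x|^2), by the
second order contact of [M] with its tangent space, by the proximal inequality in
[M], and by the Taylor estimate for geodesics. *)
Lemma proximal_acceleration m n (M S : set 'rV[R]_n) (c : R -> 'rV[R]_n) (t : R) w :
  S `<=` M -> covariant_acceleration m M c t w -> proximal_normal m M S (c t) w ->
  covariant_acceleration n setT c t (derive1 (derive1 c) t) /\
  proximal_normal n setT S (c t) (derive1 (derive1 c) t).
Proof.
move=> SM /gauss_formula[U [phi [z [chrt nz dc' _ orth]]]].
move=> [_ [sg [W [sg0 convW nW hW]]]].
have [Uz czE dcz] := nbhs_singleton nz; split.
  apply: euclid_covariant_acceleration => //.
  by apply: filterS nz => s [_ _ []].
move: orth; move: (derive1 (derive1 c) t) (z t) Uz czE => a u0 Uu0 xE orth.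
rewrite xE in hW nW *.
have [oU C2 imm _ _] := chrt.
have [r [K [r0 K0 rU hK]]] := immersion_local oU C2 Uu0 (imm _ Uu0).
have [d1 d10 hd1] := chart_near chrt Uu0 r0.
have /nbhs_ballP[d2 /= d20 hd2] : nbhs (phi u0) (fun y => M y -> W y) by exact: nW.
have b0 : ball u0 r u0 by exact: ballxx.
(* [L] compares the Riemannian distance with the Euclidean one, and [s] adds
   up the constants of the three terms. *)
pose L := n%:R * (m%:R * K * (2 * K)) + 1.
have L0 : 0 < L by rewrite ltr_wpDl// !mulr_ge0// ltW.
pose s := n%:R * `|a - w| * (K * (K * K)) + sg * L ^+ 2
          + n%:R * `|w| * (n%:R * m%:R * K ^+ 3) * L ^+ 2 + 1.
have K3 : 0 <= K ^+ 3 by rewrite exprn_ge0// ltW.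
have A1 : 0 <= n%:R * `|a - w| * (K * (K * K)) by rewrite !mulr_ge0// ltW.
have A2 : 0 <= sg * L ^+ 2 by rewrite mulr_ge0 ?sqr_ge0// ltW.
have A3 : 0 <= n%:R * `|w| * (n%:R * m%:R * K ^+ 3) * L ^+ 2.
  by rewrite mulr_ge0 ?sqr_ge0// mulr_ge0// mulr_ge0.
have s0 : 0 < s by rewrite ltr_wpDl// !addr_ge0.
apply: (@proximal_normal_euclid _ _ _ _ _ (Num.min (Num.min d1 d2) (d1 / L)) s) => //.
  by rewrite !lt_min d10 d20 divr_gt0.
move=> y Sy; rewrite !lt_min => /andP[/andP[yd1 yd2] ydL].
have My := SM _ Sy.
have nle := norm_le_enorm (y - phi u0).
have [u [Uu bu uE]] := hd1 _ My (le_lt_trans nle yd1).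
have Wy : W y by apply: hd2 => //; rewrite -ball_normE /= distrC (le_lt_trans nle).
have Mx : M (phi u0).
  by have [g [V [_ phiNV _ _]]] := chart_inverse chrt; have [] := phiNV _ Uu0.
have Wx : W (phi u0) by apply: hd2 => //; exact: ballxx.
have [g ming expE] := convex_exp_inv convW Wx Wy.
have rdE := minimizing_speed ming.
have [h1 _ _ _ h5] := hK _ _ b0 bu.
set D := `|y - phi u0| in nle *; have D0 : 0 <= D by exact: normr_ge0.
rewrite uE -/D in h1 h5.
have lD : enorm (derive1 g 0) <= L * D.
  have := rdist_chart_le chrt rU (fun v bv => let: And5 _ _ _ q _ := hK v u0 bv b0 in q) K0 bu.
  rewrite uE rdE lee_fin => /le_trans; apply.
  apply: (@le_trans _ _ (n%:R * (m%:R * K * (2 * (K * D))))).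
    rewrite ler_wpM2l// ler_wpM2l ?mulr_ge0 ?(ltW K0)// ler_wpM2l//.
  have -> : n%:R * (m%:R * K * (2 * (K * D))) = L * D - D by rewrite /L; ring.
  by rewrite lerBlDr lerDl.
have [geo g0 g1 _] := ming.
have ld1 : enorm (derive1 g 0) < d1.
  apply: le_lt_trans lD _; rewrite mulrC -ltr_pdivlMr//.
  exact: le_lt_trans nle ydL.
have tay := geodesic_taylor w chrt K0 rU
  (fun u v bu bv => let: And5 a b c _ _ := hK u v bu bv in And3 a b c) hd1 geo g0 ld1.
rewrite g1 g0 in tay.
have hw : inner w (derive1 g 0) <= sg * enorm (derive1 g 0) ^+ 2.
  by have := hW _ Wy Sy; rewrite expE rdE -EFin_expe -EFinM lee_fin.
have l20 : enorm (derive1 g 0) ^+ 2 <= L ^+ 2 * D ^+ 2.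
  by rewrite -exprMn ler_pXn2r ?nnegrE ?enorm_ge0 ?mulr_ge0// ltW.
have B1 : inner (a - w) (y - phi u0) <= n%:R * `|a - w| * (K * (K * K)) * D ^+ 2.
  have -> : y - phi u0 = (y - phi u0 - (u - u0) *m 'J phi u0) + (u - u0) *m 'J phi u0.
    by rewrite subrK.
  rewrite innerDr orth addr0; apply: le_trans (inner_le _ _) _.
  rewrite -[leRHS]mulrA ler_wpM2l ?mulr_ge0//; apply: le_trans h5 _.
  rewrite -[leRHS]mulrA ler_wpM2l ?(ltW K0)// -expr2 -exprMn.
  by rewrite ler_pXn2r ?nnegrE ?mulr_ge0// ltW.
have B2 : inner w (derive1 g 0) <= sg * L ^+ 2 * D ^+ 2.
  by apply: le_trans hw _; rewrite -mulrA ler_wpM2l// ltW.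
have B3 : inner w (y - phi u0 - derive1 g 0) <=
    n%:R * `|w| * (n%:R * m%:R * K ^+ 3) * L ^+ 2 * D ^+ 2.
  apply: le_trans (ler_norm _) _; apply: le_trans tay _.
  by rewrite -[leRHS]mulrA ler_wpM2l// mulr_ge0// mulr_ge0.
have -> : inner a (y - phi u0) = inner (a - w) (y - phi u0) + inner w (derive1 g 0)
    + inner w (y - phi u0 - derive1 g 0).
  rewrite innerBl [inner w (_ - derive1 g 0)]innerBr.
  by move: (inner a _) (inner w _) (inner w _); clear => p q o; ring.
apply: (@le_trans _ _ (s * D ^+ 2)); last first.
  by rewrite ler_wpM2l ?(ltW s0)// ler_pXn2r ?nnegrE ?enorm_ge0.
apply: le_trans (lerD (lerD B1 B2) B3) _.
by rewrite -!mulrDl /s ler_wpM2r ?sqr_ge0// lerDl.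
Qed.

End Prox.

(** * Sobolev functions on the unit interval *)

Section Sobolev1D.
Context {R : realType}.
Notation mu := (@lebesgue_measure R).
Local Notation I := (II : set R).
Implicit Types f g h u phi : R -> R.

Definition integrableI f := mu.-integrable I (EFin \o f).
Definition contI f := {within I, continuous f}.
Definition primitive f (t : R) : R := \int[mu]_(s in `[0, t]) f s.

Lemma measurableI : @measurable _ (measurableTypeR R) I.
Proof. exact: measurable_itv. Qed.
Hint Resolve measurableI : core.

Lemma muI : mu I = 1%E.
Proof. by rewrite lebesgue_measure_itv/= lte01 oppr0 adde0. Qed.

Lemma contIM f g : contI f -> contI g -> contI (fun t => f t * g t).
Proof. by move=> cf cg z; apply: continuousM; [exact: cf|exact: cg]. Qed.
Lemma contID f g : contI f -> contI g -> contI (fun t => f t + g t).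
Proof. by move=> cf cg z; apply: continuousD; [exact: cf|exact: cg]. Qed.
Lemma contIB f g : contI f -> contI g -> contI (fun t => f t - g t).
Proof. by move=> cf cg z; apply: continuousB; [exact: cf|exact: cg]. Qed.
Lemma contI_cst c : contI (fun=> c).
Proof. by move=> z; exact: cvg_cst. Qed.
Lemma contI_sum n (f : 'I_n -> R -> R) : (forall i, contI (f i)) -> contI (fun t => \sum_i f i t).
Proof. by move=> cf z; apply: cvg_bigsum => i; exact: cf. Qed.
Lemma continuous_contI f : continuous f -> contI f.
Proof. exact: continuous_subspaceT. Qed.

Lemma contI_bounded f : contI f -> exists2 B, 0 <= B & forall t, I t -> `|f t| <= B.
Proof.
move=> cf; have [M MI hM] := EVT_max ler01 cf; have [m mI hm] := EVT_min ler01 cf.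
exists (`|f M| + `|f m|); first by rewrite addr_ge0.
move=> t It; rewrite ler_norml; apply/andP; split.
  apply: le_trans (hm t It); rewrite lerNl; apply: le_trans (ler_norm _) _.
  by rewrite normrN lerDr.
by apply: le_trans (hM t It) _; apply: le_trans (ler_norm _) _; rewrite lerDl.
Qed.

Lemma contI_measurable f : contI f -> measurable_fun I f.
Proof. by move=> cf; apply: subspace_continuous_measurable_fun. Qed.

Lemma contI_integrable f : contI f -> integrableI f.
Proof.
by move=> cf; apply: continuous_compact_integrable => //; exact: segment_compact.
Qed.

Lemma integrableI_measurable f : integrableI f -> measurable_fun I f.
Proof. by move=> /integrableP[/measurable_EFinP]. Qed.

Lemma integrableI_mul f g : integrableI f -> contI g -> integrableI (fun t => f t * g t).
Proof.
move=> fi cg; have [B B0 hB] := contI_bounded cg.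
have := @integrableMl _ _ R mu I measurableI (EFin \o f) g fi (contI_measurable cg).
apply; exists B; split; first exact: num_real.
by move=> M BM t It /=; apply: le_trans (hB t It) (ltW BM).
Qed.

Lemma integrableID f g : integrableI f -> integrableI g -> integrableI (fun t => f t + g t).
Proof. by move=> fi gi; exact: (integrableD measurableI fi gi). Qed.
Lemma integrableIB f g : integrableI f -> integrableI g -> integrableI (fun t => f t - g t).
Proof. by move=> fi gi; exact: (integrableB measurableI fi gi). Qed.
Lemma integrableIZ c f : integrableI f -> integrableI (fun t => c * f t).
Proof. by move=> fi; exact: (integrableZl measurableI c fi). Qed.

Lemma L2_integrable u : L2 u -> integrableI u.
Proof.
move=> [mu_ u2].
have i1 : integrableI (fun t => 1 + u t ^+ 2).
  by apply: integrableID u2; apply: contI_integrable; exact: contI_cst.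
rewrite /integrableI; apply: (le_integrable measurableI _ _ i1); first exact/measurable_EFinP.
move=> t _ /=; rewrite lee_fin [leRHS]ger0_norm ?addr_ge0 ?sqr_ge0//.
rewrite ler_norml; apply/andP; split.
  have := sqr_ge0 (u t + 1); have := sqr_ge0 (u t); rewrite !expr2; nra.
have := sqr_ge0 (u t - 1); have := sqr_ge0 (u t); rewrite !expr2; nra.
Qed.

Lemma contI_L2 f : contI f -> L2 f.
Proof.
move=> cf; split; first exact: contI_measurable.
exact: contI_integrable (contIM cf cf).
Qed.

Lemma L2_mul f g : L2 f -> contI g -> L2 (fun t => f t * g t).
Proof.
move=> [mf f2] cg; split.
  by apply: measurable_funM => //; exact: contI_measurable.
have -> : (fun t => ((f t * g t) ^+ 2)%:E) = EFin \o (fun t => f t ^+ 2 * (g t * g t)).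
  by apply/funext => t /=; rewrite exprMn [g t ^+ 2]expr2.
exact: integrableI_mul f2 (contIM cg cg).
Qed.

Lemma L2_add f g : L2 f -> L2 g -> L2 (fun t => f t + g t).
Proof.
move=> [mf f2] [mg g2]; have mfg := measurable_funD mf mg; split=> //.
have i1 : integrableI (fun t => 2 * f t ^+ 2 + 2 * g t ^+ 2).
  by apply: integrableID; exact: integrableIZ.
rewrite /integrableI; apply: (le_integrable measurableI _ _ i1).
  by apply/measurable_EFinP; apply: measurable_funX.
move=> t _ /=; rewrite lee_fin ger0_norm ?sqr_ge0// ger0_norm; last first.
  by rewrite addr_ge0// mulr_ge0// sqr_ge0.
by have := sqr_ge0 (f t - g t); rewrite !expr2; nra.
Qed.

Lemma L2_sum n (f : 'I_n -> R -> R) : (forall i, L2 (f i)) -> L2 (fun t => \sum_i f i t).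
Proof.
elim: n f => [|n IH] f hf.
  have -> : (fun t => \sum_i f i t) = (fun=> 0) by apply/funext => t; rewrite big_ord0.
  exact/contI_L2/contI_cst.
have -> : (fun t => \sum_i f i t) = (fun t => f ord0 t + \sum_i f (lift ord0 i) t).
  by apply/funext => t; rewrite big_ord_recl.
by apply: L2_add => //; exact: IH.
Qed.

Lemma test_functionP phi : test_function phi ->
  [/\ continuous phi, continuous (derive1 phi), forall t : R, is_derive t 1 phi (derive1 phi t),
    phi 0 = 0 & phi 1 = 0].
Proof.
move=> [[dphi cphi] [a [b [a0 b1 h]]]].
have d (t : R) : is_derive t 1 phi (derive1 phi t).
  by apply: is_derive1P; apply/derivable1_diffP; exact: dphi.
split=> //.
- by move=> t; exact: is_derive_continuous (d t).
- have -> : derive1 phi = 'D_1 phi by apply/funext => t; rewrite derive1E.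
  by move=> t; exact: cphi.
- by apply: h; rewrite leNgt a0.
- by apply: h; rewrite andbC leNgt b1.
Qed.

Lemma integral_by_parts (F G f g : R -> R) :
  contI F -> contI G -> contI f -> contI g ->
  (forall t : R, 0 < t < 1 -> is_derive t 1 F (f t)) ->
  (forall t : R, 0 < t < 1 -> is_derive t 1 G (g t)) ->
  \int[mu]_(t in I) (F t * g t) = F 1 * G 1 - F 0 * G 0 - \int[mu]_(t in I) (f t * G t).
Proof.
move=> cF cG cf cg dF dG.
have LR H k : contI H -> (forall t : R, 0 < t < 1 -> is_derive t 1 H (k t)) ->
    derivable_oo_LRcontinuous H 0 1.
  move=> /(continuous_within_itvP H ltr01)[_ h0 h1] dH; split=> //.
  by move=> t; rewrite in_itv/= => /dH[].
have E H k : (forall t : R, 0 < t < 1 -> is_derive t 1 H (k t)) ->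
    {in `]0, 1[, derive1 H =1 k}.
  by move=> dH t; rewrite in_itv/= => /dH; exact: is_derive1E.
apply: (@Rintegration_by_parts R F G f g 0 1 ltr01) => //.
- exact: LR cF dF.
- exact: E.
- exact: LR cG dG.
- exact: E.
Qed.

Lemma integrableI_sub h t : integrableI h -> t <= 1 ->
  mu.-integrable `[0, t] (EFin \o h).
Proof.
move=> hi t1; apply: (integrableS measurableI) hi; first exact: measurable_itv.
by move=> s /=; rewrite !in_itv/= => /andP[-> st]; exact: le_trans st t1.
Qed.

Lemma primitive_contI h : integrableI h -> contI (primitive h).
Proof. by move=> hi; exact: (parameterized_integral_continuous ler01 hi). Qed.

Lemma primitive_derive g : contI g ->
  forall t : R, 0 < t < 1 -> is_derive t 1 (primitive g) (g t).
Proof.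
move=> cg t /andP[t0 t1].
have ct : {for t, continuous g}.
  by apply: (within_continuous_continuous ltr01 cg); rewrite in_itv/= t0.
have [d E] := continuous_FTC1_closed t1 (contI_integrable cg) t0 ct.
by apply: (is_derive_eq (is_derive1P d)).
Qed.

Lemma norm_primitive h t : integrableI h -> I t ->
  `|primitive h t| <= \int[mu]_(s in I) `|h s|.
Proof.
move=> hi /=; rewrite in_itv/= => /andP[t0 t1].
apply: le_trans (le_normr_Rintegral _ (integrableI_sub hi t1)) _; first exact: measurable_itv.
have ni : integrableI (fun s => `|h s|) by exact: (integrable_norm hi).
have := @Rintegral_itvB R (fun s => `|h s|) (BLeft 0) (BRight 1) t ni.
rewrite !bnd_simp => /(_ t0 t1) E; rewrite -subr_ge0 E.
exact: Rintegral_ge0.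
Qed.

Lemma primitiveB h g t : integrableI h -> integrableI g -> t <= 1 ->
  primitive (fun s => h s - g s) t = primitive h t - primitive g t.
Proof.
move=> hi gi t1; apply: RintegralB; [exact: measurable_itv| |]; exact: integrableI_sub.
Qed.

Lemma L1_approx_continuous h (e : R) : integrableI h -> 0 < e ->
  exists2 g, continuous g & \int[mu]_(s in I) `|h s - g s| <= e.
Proof.
move=> hi e0.
have [g_ [cg ig /fine_cvgP[fin H]]] := approximation_continuous_integrable measurableI
  (eq_ind_r (fun x => (x < +oo)%E) (ltry 1) muI) hi.
have /cvgrPdist_le/(_ e e0) := H => H'.
have [n _ /(_ n (leqnn n)) [fn Hn]] := filterI fin H'.
exists (g_ n); first exact: cg.
by move: Hn; rewrite /= sub0r normrN; apply: le_trans; exact: ler_norm.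
Qed.

Lemma norm_RintegralM_le f g (B : R) : integrableI f -> contI g -> 0 <= B ->
  (forall t, I t -> `|g t| <= B) ->
  `|\int[mu]_(t in I) (f t * g t)| <= \int[mu]_(t in I) `|f t| * B.
Proof.
move=> fi cg B0 gB; apply: le_trans (le_normr_Rintegral measurableI (integrableI_mul fi cg)) _.
have ni : integrableI (fun s => `|f s|) by exact: (integrable_norm fi).
rewrite mulrC -(RintegralZl B measurableI ni).
apply: le_Rintegral => //.
- exact: (integrable_norm (integrableI_mul fi cg)).
- exact: integrableIZ.
by move=> t It; rewrite normrM mulrC ler_wpM2r// gB.
Qed.

(** For continuous [h] this is integration by parts. Both sides are
continuous in [h] for the norm of L^1, in which continuous functions are dense. *)
Lemma weak_derivative_primitive h : integrableI h -> weak_derivative (primitive h) h.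
Proof.
move=> hi phi tphi; have [cphi cphi' dphi phi0 phi1] := test_functionP tphi.
have cI := continuous_contI cphi; have cI' := continuous_contI cphi'.
have [B1 B10 hB1] := contI_bounded cI; have [B2 B20 hB2] := contI_bounded cI'.
have cH := primitive_contI hi.
apply/eqP; rewrite -subr_eq0 opprK -normr_le0; apply/ler_addgt0Pr => e e0; rewrite add0r.
have K0 : 0 < B1 + B2 + 1 by rewrite ltr_wpDl// addr_ge0.
have [g cg hg] := L1_approx_continuous hi (divr_gt0 e0 K0).
have cgI := continuous_contI cg; have gi := contI_integrable cgI.
have hgi := integrableIB hi gi.
have cG := primitive_contI gi.
have G0 : \int[mu]_(t in I) (primitive g t * derive1 phi t) + \int[mu]_(t in I) (g t * phi t) = 0.
  rewrite (integral_by_parts cG cI cgI cI' (primitive_derive cgI) (fun t _ => dphi t)).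
  by rewrite phi0 phi1 !mulr0 subrr sub0r addNr.
have -> : \int[mu]_(t in I) (primitive h t * derive1 phi t) + \int[mu]_(t in I) (h t * phi t)
  = \int[mu]_(t in I) ((primitive h t - primitive g t) * derive1 phi t)
    + \int[mu]_(t in I) ((h t - g t) * phi t).
  have -> : \int[mu]_(t in I) ((primitive h t - primitive g t) * derive1 phi t)
    = \int[mu]_(t in I) (primitive h t * derive1 phi t - primitive g t * derive1 phi t).
    by apply: eq_Rintegral => t _; rewrite mulrBl.
  have -> : \int[mu]_(t in I) ((h t - g t) * phi t) = \int[mu]_(t in I) (h t * phi t - g t * phi t).
    by apply: eq_Rintegral => t _; rewrite mulrBl.
  rewrite RintegralB//; [|exact: contI_integrable (contIM cH cI')|exact: contI_integrable (contIM cG cI')].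
  rewrite RintegralB//; [|exact: integrableI_mul hi cI|exact: integrableI_mul gi cI].
  by rewrite addrACA -opprD G0 subr0.
set d := \int[mu]_(t in I) `|h t - g t| in hg.
have d0 : 0 <= d by apply: Rintegral_ge0.
apply: le_trans (ler_normD _ _) _.
apply: (@le_trans _ _ (d * B2 + d * B1)).
  apply: lerD; last exact: norm_RintegralM_le.
  apply: le_trans (norm_RintegralM_le (contI_integrable (contIB cH cG)) cI' B20 hB2) _.
  rewrite ler_wpM2r// (_ : d = \int[mu]_(t in I) d); last first.
    by rewrite /Rintegral integral_II_cst.
  have cHG := contIB cH cG.
  apply: le_Rintegral => //.
  - exact: (integrable_norm (contI_integrable cHG)).
  - exact/contI_integrable/contI_cst.
  move=> t It; have t1 : t <= 1 by move: It; rewrite /= in_itv/= => /andP[].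
  by rewrite -primitiveB//; exact: norm_primitive.
rewrite -mulrDr; apply: le_trans (ler_wpM2r _ hg) _; first by rewrite addr_ge0.
by rewrite mulrAC ler_pdivrMr// ler_wpM2l ?(ltW e0)// addrC lerDl.
Qed.

(** This produces test functions with a prescribed derivative; the integral
of the derivative has to vanish for its primitive to have compact support. *)
Lemma test_primitive psi (a b : R) : continuous psi -> 0 < a -> a < b -> b < 1 ->
  (forall t, ~~ (a < t < b) -> psi t = 0) -> \int[mu]_(t in I) psi t = 0 ->
  test_function (primitive psi) /\ derive1 (primitive psi) = psi.
Proof.
move=> cpsi a0 ab b1 psi0 int0.
have ipsi (t : R) : mu.-integrable `[0, t] (EFin \o psi).
  by apply: continuous_compact_integrable; [exact: segment_compact|exact: continuous_subspaceT].
have z (t : R) : t <= a -> primitive psi t = 0.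
  move=> ta; rewrite /primitive (@eq_Rintegral _ _ _ _ _ (fun=> 0)).
    by rewrite Rintegral_cst ?mul0r//; exact: measurable_itv.
  move=> s; rewrite inE/= in_itv/= => /andP[_ st]; apply: psi0.
  by rewrite negb_and -leNgt (le_trans st ta).
have d (t : R) : is_derive t 1 (primitive psi) (psi t).
  have [t0|t0] := ltP 0 t.
    have tu : t < t + 1 by rewrite ltrDl.
    have [dt E] := continuous_FTC1_closed tu (ipsi (t + 1)) t0 (cpsi t).
    exact: is_derive_eq (is_derive1P dt) E.
  have ta : t < a by exact: le_lt_trans a0.
  rewrite psi0; last by rewrite negb_and -leNgt ltW.
  have dcst : is_derive t 1 (cst (0 : R)) (0 : R) by exact: is_derive_cst.
  apply: near_eq_is_derive dcst.
  have := @near_in_itvNyo _ a t; rewrite in_itv/= ta => /(_ isT).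
  by apply: filterS => s; rewrite in_itv/= => sa; rewrite z// ltW.
have E : derive1 (primitive psi) = psi by apply/funext => t; exact: is_derive1E.
have e1 (s t : R) : b <= s -> s <= t -> primitive psi s = primitive psi t.
  move=> bs st.
  have [x /andP[sx _]] := MVT_closed st (fun x _ => d x).
  rewrite psi0 ?mul0r; last first.
    by apply/negP => /andP[_ xb]; move: (le_lt_trans (le_trans bs sx) xb); rewrite ltxx.
  by move=> /eqP; rewrite subr_eq0 => /eqP.
have z1 (t : R) : b <= t -> primitive psi t = 0.
  move=> bt; have p1 : primitive psi 1 = 0 by [].
  by case: (leP t 1) => t1; rewrite -p1; [apply: e1|apply/esym/e1; rewrite // ltW].
split=> //; split.
  split=> [t _|v t _]; first by apply/derivable1_diffP; case: (d t).
  have -> : 'D_v (primitive psi) = fun s => v * psi s.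
    apply/funext => s; have ds := derivable_diff (d s).
    by rewrite deriveE// diff_val.
  by apply: cvgMl_tmp; exact: cpsi.
exists a, b; split=> // t; rewrite negb_and -!ltNge => /orP[ta|tb].
  by rewrite z// ltW.
by rewrite z1// ltW.
Qed.

(** The positive part of the distance to the complement of the interval,
written (x + |x|) / 2, is multiplied by [k] and truncated at 1. The functions
increase to the indicator function of the open interval. *)
Definition plateau (a b : R) (k : nat) (t : R) : R :=
  Num.min 1 (k%:R * ((Num.min (t - a) (b - t) + `|Num.min (t - a) (b - t)|) / 2)).

Lemma continuous_plateau a b k : continuous (plateau a b k).
Proof.
have cm : continuous (fun t : R => Num.min (t - a) (b - t)).
  move=> t; apply: (@continuous_min R R (fun t => t - a) (fun t => b - t)).
    by apply: cvgB; [exact: cvg_id|exact: cvg_cst].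
  by apply: cvgB; [exact: cvg_cst|exact: cvg_id].
move=> t; apply: (@continuous_min R R (fun=> 1) (fun t : R =>
  k%:R * ((Num.min (t - a) (b - t) + `|Num.min (t - a) (b - t)|) / 2)) t).
  exact: cvg_cst.
apply: cvgMl_tmp; apply: cvgMr_tmp; apply: cvgD; first exact: cm.
by apply: cvg_norm; exact: cm.
Qed.

Lemma plateau_out a b k t : ~~ (a < t < b) -> plateau a b k t = 0.
Proof.
move=> h; have m0 : Num.min (t - a) (b - t) <= 0.
  by rewrite ge_min !subr_le0 !leNgt -negb_and.
by rewrite /plateau ler0_norm// subrr mul0r mulr0 min_r.
Qed.

Lemma plateau_in a b t : a < t < b -> \forall k \near \oo, plateau a b k t = 1.
Proof.
move=> /andP[at_ tb]; set m := Num.min (t - a) (b - t).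
have m0 : 0 < m by rewrite lt_min !subr_gt0 at_.
have := nbhs_infty_ger m^-1; apply: filterS => k hk.
rewrite /plateau -/m gtr0_norm// (_ : (m + m) / 2 = m); last by field.
by rewrite min_l// -ler_pdivrMr// div1r.
Qed.

Lemma plateau_01 a b k t : 0 <= plateau a b k t <= 1.
Proof.
rewrite /plateau ge_min lexx andbT le_min ler01/= mulr_ge0// divr_ge0//.
by rewrite addrC -lerBlDr sub0r -normrN ler_norm.
Qed.

Lemma plateau_cvg w a b : integrableI w -> 0 < a -> a < b -> b < 1 ->
  (fun k => \int[mu]_(t in I) (w t * plateau a b k t)) @ \oo -->
  \int[mu]_(t in `]a, b[) w t.
Proof.
move=> wi a0 ab b1.
have mJ : @measurable _ (measurableTypeR R) `]a, b[ by exact: measurable_itv.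
have JI : `]a, b[%classic `<=` I.
  move=> t /=; rewrite !in_itv/= => /andP[at_ tb].
  by rewrite (ltW (lt_trans a0 at_)) (ltW (lt_trans tb b1)).
have -> : \int[mu]_(t in `]a, b[) w t = \int[mu]_(t in I) (w \_ `]a, b[) t.
  by rewrite -Rintegral_mkcondr setIidr.
have wiJ : mu.-integrable I (EFin \o (w \_ `]a, b[)).
  have := (integrable_mkcond _ mJ).1 (integrableS measurableI mJ JI wi).
  rewrite -restrict_EFin.
  exact: (integrableS _ measurableI).
have mw := integrableI_measurable wi.
have m1 k : measurable_fun I (fun t => (w t * plateau a b k t)%:E).
  apply/measurable_EFinP; apply: measurable_funM => //.
  by apply: contI_measurable; apply: continuous_contI; exact: continuous_plateau.
have m2 : measurable_fun I (EFin \o (w \_ `]a, b[)) by case/integrableP: wiJ.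
have m3 : {ae mu, forall t, I t ->
    (w t * plateau a b k t)%:E @[k --> \oo] --> (EFin \o (w \_ `]a, b[)) t}.
  apply: aeW => t It; apply: cvg_EFin; first exact: nearW.
  rewrite /= patchE; case: ifPn => [|]; rewrite ?inE ?notin_setE /= in_itv/=.
    move=> tJ; apply: cvg_near_cst; have := plateau_in tJ.
    by apply: filterS => k /= ->; rewrite mulr1.
  move=> /negP tJ; apply: cvg_near_cst; apply: nearW => k.
  by rewrite /= plateau_out// mulr0.
pose nw (t : R) : R := `|w t|.
have m4 : mu.-integrable I (EFin \o nw) by exact: (integrable_norm wi).
have m5 : {ae mu, forall t (k : nat), I t ->
    (`|(w t * plateau a b k t)%:E| <= (EFin \o nw) t)%E}.
  apply: aeW => t k It; rewrite /= /nw lee_fin normrM ler_piMr//.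
  by have /andP[p0 p1] := plateau_01 a b k t; rewrite ger0_norm.
have [_ _ H] := dominated_convergence measurableI m1 m2 m3 m4 m5.
apply: (@fine_cvg R nat \oo _ _ (\int[mu]_(t in I) (w \_ `]a, b[) t)).
rewrite /Rintegral fineK; last exact: integrable_fin_num.
exact: H.
Qed.

Lemma integral_open_cst (k a b : R) : a < b -> \int[mu]_(t in `]a, b[) k = k * (b - a).
Proof.
move=> ab; rewrite Rintegral_cst; last exact: measurable_itv.
have E : mu (`]a, b[%classic : set R) = (b - a)%:E.
  by rewrite lebesgue_measure_itv/= lte_fin ab.
by rewrite (congr1 fine E).
Qed.

(** The test function is a primitive of the combination q P - p Q of two
plateaus [P] and [Q], with [p] and [q] their integrals; then the plateaus tend to
the indicator functions of the two intervals. *)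
Lemma plateau_proportional w (a b c d : R) : integrableI w ->
  (forall phi, test_function phi -> \int[mu]_(t in I) (w t * derive1 phi t) = 0) ->
  0 < a -> a < b -> b < 1 -> 0 < c -> c < d -> d < 1 ->
  (d - c) * \int[mu]_(t in `]a, b[) w t = (b - a) * \int[mu]_(t in `]c, d[) w t.
Proof.
move=> wi h a0 ab b1 c0 cd d1.
have one : integrableI (fun=> 1) by exact/contI_integrable/contI_cst.
have cP := plateau_cvg wi a0 ab b1; have cQ := plateau_cvg wi c0 cd d1.
have oP := plateau_cvg one a0 ab b1; have oQ := plateau_cvg one c0 cd d1.
rewrite (integral_open_cst 1 ab) mul1r in oP; rewrite (integral_open_cst 1 cd) mul1r in oQ.
have Foo : Filter \oo by typeclasses eauto.
have l1 := cvgM oQ cP; have {}l1 := l1 Foo.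
have l2 := cvgM oP cQ; have {}l2 := l2 Foo.
apply: (cvg_unique (@Rhausdorff R) l1).
apply: cvg_trans l2; apply: near_eq_cvg; apply: nearW => k /=.
set P := plateau a b k; set Q := plateau c d k.
have ctP : contI P by apply: continuous_contI; exact: continuous_plateau.
have ctQ : contI Q by apply: continuous_contI; exact: continuous_plateau.
have E1 f : \int[mu]_(t in I) (1 * f t) = \int[mu]_(t in I) f t.
  by apply: eq_Rintegral => t _; rewrite mul1r.
rewrite !E1; set p := \int[mu]_(t in I) P t; set q := \int[mu]_(t in I) Q t.
pose psi t := q * P t - p * Q t.
have iP := integrableI_mul wi ctP; have iQ := integrableI_mul wi ctQ.
have int0 : \int[mu]_(t in I) psi t = 0.
  rewrite RintegralB//; [|exact/integrableIZ/contI_integrable|exact/integrableIZ/contI_integrable].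
  by rewrite !RintegralZl//; [rewrite -/p -/q mulrC subrr|exact: contI_integrable|exact: contI_integrable].
have m1 : Num.min a c < Num.max b d by rewrite gt_min !lt_max ab.
have cpsi : continuous psi.
  by move=> t; apply: cvgB; apply: cvgMl_tmp; exact: continuous_plateau.
have [|||tf E] := @test_primitive psi (Num.min a c) (Num.max b d) cpsi _ m1 _ _ int0.
- by rewrite lt_min a0.
- by rewrite gt_max b1.
- move=> t; rewrite negb_and gt_min lt_max !negb_or => tn.
  have [oa oc] : ~~ (a < t < b) /\ ~~ (c < t < d).
    by move: tn => /orP[/andP[x y]|/andP[x y]]; rewrite !negb_and x y ?orbT.
  by rewrite /psi /P /Q !plateau_out// !mulr0 subrr.
have := h _ tf; rewrite E.
have -> : \int[mu]_(t in I) (w t * psi t) =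
   \int[mu]_(t in I) (q * (w t * P t) - p * (w t * Q t)).
  by apply: eq_Rintegral => t _; rewrite /psi mulrBr !(mulrCA (w t)).
rewrite RintegralB//; [|exact: integrableIZ|exact: integrableIZ].
rewrite !RintegralZl// => /eqP; rewrite subr_eq0 => /eqP ->//.
Qed.

(** The integral of [w] over an interval is proportional to the length, so
that the integral of [w - c] over every interval vanishes for some [c]; Lebesgue
differentiation concludes. *)
Lemma du_bois_reymond w : integrableI w ->
  (forall phi, test_function phi -> \int[mu]_(t in I) (w t * derive1 phi t) = 0) ->
  exists c, {ae mu, forall t, I t -> w t = c}.
Proof.
(* The interval of reference is ]1/4, 3/4[, of length 1/2. *)
move=> wi h; pose c := 2 * \int[mu]_(t in `](4^-1), (3 / 4)[) w t; exists c.
have key (a b : R) : 0 < a -> a < b -> b < 1 -> \int[mu]_(t in `]a, b[) w t = (b - a) * c.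
  move=> a0 ab b1.
  have := @plateau_proportional w a b 4^-1 (3 / 4) wi h a0 ab b1.
  have [q0 q1 q2] : [/\ 0 < 4^-1 :> R, 4^-1 < 3 / 4 :> R & 3 / 4 < 1 :> R].
    by split; lra.
  move=> /(_ q0 q1 q2); rewrite (_ : 3 / 4 - 4^-1 = 2^-1 :> R); last by lra.
  by move=> E; rewrite /c mulrCA -E mulrA mulfV// mul1r.
pose f := (fun t => w t - c) \_ I.
have wci : integrableI (fun t => w t - c).
  by apply: integrableIB => //; exact/contI_integrable/contI_cst.
have fi : mu.-integrable setT (EFin \o f).
  by have := (integrable_mkcond _ measurableI).1 wci; rewrite -restrict_EFin.
have fy (x y : itv_bound R) : mu.-integrable [set` Interval x y] (EFin \o f).
  by apply: (integrableS _ _ _ fi) => //; exact: measurable_itv.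
have lf : locally_integrable setT f.
  by apply: integrable_locally_restrict; [exact: measurableI|exact: wci].
have H := FTC1 (fun y => fy (BLeft 0) (BRight y)) lf.
(* [F], the primitive of [w - c], is constant only on the open interval. *)
have n0 : {ae mu, forall t : R, t != 0 /\ t != 1}.
  exists ([set 0] `|` [set 1]); split.
  - by apply: measurableU; exact: measurable_set1.
  - by rewrite null_set_setU//; [exact: lebesgue_measure_set1|exact: lebesgue_measure_set1].
  - move=> t /= /not_andP[/negP|/negP]; rewrite negbK => /eqP ->; [by left|by right].
pose F x := \int[mu]_(t in `[0, x]) f t.
have F0 (x y : R) : 0 < x -> x < y -> y < 1 -> F x = F y.
  move=> x0 xy y1; apply/esym/eqP; rewrite -subr_eq0; apply/eqP.
  have := @Rintegral_itvB R f (BLeft 0) (BRight y) x (fy _ _).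
  rewrite !bnd_simp => /(_ (ltW x0) (ltW xy)) ->.
  rewrite -(Rintegral_itv_bndo_bndc (fy (BRight x) (BLeft y))).
  have sub : `]x, y[%classic `<=` I.
    move=> t /=; rewrite !in_itv/= => /andP[xt ty].
    by rewrite (ltW (lt_trans x0 xt)) (ltW (lt_trans ty y1)).
  have mJ : @measurable _ (measurableTypeR R) `]x, y[ by exact: measurable_itv.
  have -> : \int[mu]_(t in `]x, y[) f t = \int[mu]_(t in `]x, y[) (w t - c).
    by apply: eq_Rintegral => t; rewrite inE => tJ; rewrite /f patchE mem_set//; exact: sub.
  rewrite RintegralB//; [|exact: integrableS wi|]; last first.
    by apply: (integrableS measurableI mJ sub); exact/contI_integrable/contI_cst.
  have K := key x y x0 xy y1; have C := integral_open_cst c xy.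
  by move: K C => -> ->; rewrite mulrC subrr.
apply: filterS2 H n0; first exact: (ae_filter_ringOfSetsType mu).
move=> t Ht [t0 t1] It.
have [p0 p1] : 0 < t /\ t < 1.
  by move: It; rewrite /= in_itv/= !le_eqVlt eq_sym (negbTE t0) (negbTE t1) => /andP[].
have [dF E] := Ht p0.
have : derive1 F t = 0.
  apply: is_derive1E.
  have dcst : is_derive t 1 (cst (F t)) (0 : R) by exact: is_derive_cst.
  apply: near_eq_is_derive dcst.
  have := @near_in_itvoo _ 0 1 t; rewrite in_itv/= p0 p1 => /(_ isT).
  apply: filterS => s; rewrite in_itv/= => /andP[s0 s1].
  by case: (ltgtP s t) => [st|st|->//]; [apply/esym|]; exact: F0.
rewrite E /f patchE mem_set// => /eqP; rewrite subr_eq0 => /eqP //.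
Qed.

(** The difference of [f] and a primitive of [g] has weak derivative zero. *)
Lemma weak_derivative_ae f g : integrableI f -> integrableI g -> weak_derivative f g ->
  exists c, {ae mu, forall t, I t -> f t = primitive g t + c}.
Proof.
move=> fi gi fg; have cG := primitive_contI gi.
have [|phi tphi|c H] := @du_bois_reymond (fun t => f t - primitive g t).
- by apply: integrableIB => //; exact: contI_integrable.
- have [cphi cphi' _ _ _] := test_functionP tphi.
  have cI' := continuous_contI cphi'.
  have -> : \int[mu]_(t in I) ((f t - primitive g t) * derive1 phi t)
    = \int[mu]_(t in I) (f t * derive1 phi t - primitive g t * derive1 phi t).
    by apply: eq_Rintegral => t _; rewrite mulrBl.
  rewrite RintegralB//; [|exact: integrableI_mul|exact: integrableI_mul (contI_integrable cG) cI'].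
  by rewrite (fg _ tphi) (weak_derivative_primitive gi tphi) subrr.
exists c; apply: filterS H; first exact: (ae_filter_ringOfSetsType mu).
by move=> t h It; rewrite -(h It) addrC subrK.
Qed.

Lemma contI_ae_eq f g : contI f -> contI g -> {ae mu, forall t, I t -> f t = g t} ->
  forall t, 0 < t < 1 -> f t = g t.
Proof.
move=> cf cg [N [mN N0 sub]] t tI; apply/eqP; apply/negP => /negP fgt.
have ct k : contI k -> {for t, continuous k}.
  by move=> ck; apply: (within_continuous_continuous ltr01 ck); rewrite in_itv.
have c1 : {for t, continuous (fun s => f s - g s)}.
  by apply: cvgB; exact: ct.
have e0 : 0 < `|f t - g t| by rewrite normr_gt0 subr_eq0.
have n1 := continuous_near_dist c1 (divr_gt0 e0 (ltr0n R 2)).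
have n2 : \forall s \near t, 0 < s < 1.
  have := @near_in_itvoo _ 0 1 t; rewrite in_itv/= tI => /(_ isT).
  by apply: filterS => s; rewrite in_itv.
have /nbhs_ballP[d /= d0 H] : nbhs t (fun s => `|f s - g s - (f t - g t)| <= `|f t - g t| / 2 /\ 0 < s < 1).
  by apply: filterS2 n1 n2.
have bN : ball t d `<=` N.
  move=> s /H[h1 /andP[s0 s1]]; apply: sub => /= /(_ _) h2.
  have E : f s = g s by apply: h2; rewrite /= in_itv/= !ltW.
  move: h1; rewrite E subrr sub0r normrN => h1.
  move: h1; rewrite ler_pdivlMr// -{2}[`|f t - g t|]mulr1 ler_pM2l//.
  by rewrite leNgt ltr1n.
have : (mu (ball t d) <= mu N)%E by apply: le_measure => //; rewrite inE//; exact: measurable_ball.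
rewrite N0 (lebesgue_measure_ball _ (ltW d0)) => h3.
have h4 : (0 < (d *+ 2)%:E)%E by rewrite lte_fin mulrn_wgt0.
by have := lt_le_trans h4 h3; rewrite ltxx.
Qed.

(** The weak derivative of [u] is almost everywhere equal to [G], a primitive
of the second weak derivative plus a constant, and [G] is continuous. So [u] is
almost everywhere, and by continuity everywhere inside the interval, equal to a
primitive of [G] plus a constant. *)
Lemma W22_regular u : contI u -> W2 2 u -> exists G h,
  [/\ contI G, L2 h, weak_derivative G h & forall t : R, 0 < t < 1 -> is_derive t 1 u (G t)].
Proof.
move=> cu [u2 [g [ug [g2 [h [gh h2]]]]]].
have ui := L2_integrable u2; have gi := L2_integrable g2; have hi := L2_integrable h2.
have [c gc] := weak_derivative_ae gi hi gh.
have [k uk] := weak_derivative_ae ui gi ug.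
pose G t := primitive h t + c.
have cG : contI G by apply: contID; [exact: primitive_contI|exact: contI_cst].
have Gi := contI_integrable cG.
have ae_int f : contI f -> \int[mu]_(t in I) (g t * f t) = \int[mu]_(t in I) (G t * f t).
  move=> cf; rewrite /Rintegral; congr fine; apply: ae_eq_integral => //.
  - by have /integrableP[] := integrableI_mul gi cf.
  - by have /integrableP[] := integrableI_mul Gi cf.
  apply: filterS gc; first exact: (ae_filter_ringOfSetsType mu).
  by move=> t e It; rewrite e.
have pG t : I t -> primitive g t = primitive G t.
  rewrite /= in_itv/= => /andP[t0 t1].
  have mt : @measurable _ (measurableTypeR R) `[0, t] by exact: measurable_itv.
  rewrite /primitive /Rintegral; congr fine; apply: ae_eq_integral => //.
  - by have /integrableP[] := integrableI_sub gi t1.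
  - by have /integrableP[] := integrableI_sub Gi t1.
  apply: filterS gc; first exact: (ae_filter_ringOfSetsType mu).
  move=> s e; rewrite /= in_itv/= => /andP[s0 st].
  by rewrite e//= in_itv/= s0 (le_trans st).
have uG : forall t, 0 < t < 1 -> u t = primitive G t + k.
  apply: contI_ae_eq => //; first by apply: contID; [exact: primitive_contI|exact: contI_cst].
  apply: filterS uk; first exact: (ae_filter_ringOfSetsType mu).
  by move=> t e It; rewrite e// pG.
exists G, h; split=> //.
  move=> phi tphi; have [cphi cphi' _ _ _] := test_functionP tphi.
  by rewrite -ae_int ?gh//; exact: continuous_contI.
move=> t tI.
have d1 : is_derive t 1 (fun s => primitive G s + k) (G t).
  have dk : is_derive t 1 (cst k) (0 : R) by exact: is_derive_cst.
  by have := is_deriveD (primitive_derive cG tI) dk; rewrite addr0.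
apply: near_eq_is_derive d1.
have := @near_in_itvoo _ 0 1 t; rewrite in_itv/= tI => /(_ isT).
by apply: filterS => s; rewrite in_itv/= => sI; rewrite uG.
Qed.

(** For a C^1 function [q] and a test function [phi], the product
[q * phi] is again a test function. *)
Lemma weak_derivative_mul G h q q' : integrableI h -> contI G -> weak_derivative G h ->
  contI q -> contI q' -> (forall t : R, 0 < t < 1 -> is_derive t 1 q (q' t)) ->
  weak_derivative (fun t => G t * q t) (fun t => h t * q t + G t * q' t).
Proof.
move=> hi cG Gh cq cq' dq phi tphi.
have [cphi cphi' dphi phi0 phi1] := test_functionP tphi.
have [_ [a [b [a0 b1 hab]]]] := tphi.
have [cI cI'] := (continuous_contI cphi, continuous_contI cphi').
have Gi := contI_integrable cG.
(* [p' t] is the derivative of [p] also outside of the open interval, where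
   [q'] is unrelated to [q]: there [phi] and its derivative vanish. *)
pose p (t : R) := q t * phi t.
pose p' (t : R) := q' t * phi t + q t * derive1 phi t.
have cont01 (k : R -> R) (t : R) : contI k -> 0 < t < 1 -> {for t, continuous k}.
  by move=> ck tI; apply: (within_continuous_continuous ltr01 ck); rewrite in_itv.
have out (t : R) : ~~ (0 < t < 1) -> \forall s \near t, phi s = 0.
  rewrite negb_and -!leNgt => /orP[t0|t1].
    have := @near_in_itvNyo _ a t; rewrite in_itv/= (le_lt_trans t0 a0) => /(_ isT).
    by apply: filterS => s; rewrite in_itv/= => sa; apply: hab; rewrite negb_and -ltNge sa.
  have := @near_in_itvoy _ b t; rewrite in_itv/= (lt_le_trans b1 t1) => /(_ isT).
  by apply: filterS => s; rewrite in_itv/= andbT => sb; apply: hab; rewrite negb_and -!ltNge sb orbT.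
have local0 (k : R -> R) (t : R) : (\forall s \near t, k s = 0) -> is_derive t 1 k (0 : R).
  move=> k0; have dcst : is_derive t 1 (cst (0 : R)) (0 : R) by exact: is_derive_cst.
  by apply: near_eq_is_derive dcst; apply: filterS k0 => s ->.
have out' (t : R) : ~~ (0 < t < 1) -> \forall s \near t, p' s = 0.
  move=> /out/near_join; apply: filterS => s e.
  by rewrite /p' (nbhs_singleton e) (is_derive1E (local0 _ _ e)) !mulr0 addr0.
have dp (t : R) : is_derive t 1 p (p' t).
  have [tI|tI] := boolP (0 < t < 1); first exact: is_derive_mulr (dq t tI) (dphi t).
  rewrite (nbhs_singleton (out' t tI)); apply: local0.
  by apply: filterS (out t tI) => s e; rewrite /p e mulr0.
have cp' : continuous p'.
  move=> t; have [tI|tI] := boolP (0 < t < 1).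
    by apply: cvgD; apply: cvgM; [exact: cont01|exact: cphi|exact: cont01|exact: cphi'].
  apply: (@near_eq_continuous _ _ (fun=> 0)); last exact: cvg_cst.
  by apply: filterS (out' t tI) => s ->.
have tp : test_function p.
  split; last by exists a, b; split=> // t /hab e; rewrite /p e mulr0.
  split=> [t _|v t _]; first by apply/derivable1_diffP; case: (dp t).
  have -> : 'D_v p = fun s => v * p' s.
    apply/funext => s; have ds := derivable_diff (dp s).
    by rewrite deriveE// diff_val.
  by apply: cvgMl_tmp; exact: cp'.
have E1 : derive1 p = p' by apply/funext => t; exact: is_derive1E.
have := Gh _ tp; rewrite E1 => E2.
have cp'I := continuous_contI cp'.
have cGqp := contIM (contIM cG cq') cI.
have -> : \int[mu]_(t in I) (G t * q t * derive1 phi t) =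
    \int[mu]_(t in I) (G t * p' t - G t * q' t * phi t).
  by apply: eq_Rintegral => t _; rewrite /p'; ring.
have -> : \int[mu]_(t in I) ((h t * q t + G t * q' t) * phi t) =
    \int[mu]_(t in I) (h t * p t + G t * q' t * phi t).
  by apply: eq_Rintegral => t _; rewrite /p; ring.
rewrite RintegralB//; [|exact: contI_integrable (contIM cG cp'I)|exact: contI_integrable].
rewrite RintegralD//; [|exact: integrableI_mul hi (contIM cq cI)|exact: contI_integrable].
by rewrite E2 opprD.
Qed.

Lemma weak_derivative_sum n (F f : 'I_n -> R -> R) :
  (forall i, integrableI (F i)) -> (forall i, integrableI (f i)) ->
  (forall i, weak_derivative (F i) (f i)) ->
  weak_derivative (fun t => \sum_i F i t) (fun t => \sum_i f i t).
Proof.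
move=> Fi fi Ff phi tphi; have [cphi cphi' _ _ _] := test_functionP tphi.
have [cI cI'] := (continuous_contI cphi, continuous_contI cphi').
have S k (H : 'I_n -> R -> R) : contI k -> (forall i, integrableI (H i)) ->
    \int[mu]_(t in I) ((\sum_i H i t) * k t) = \sum_i \int[mu]_(t in I) (H i t * k t).
  move=> ck iH; have -> : \int[mu]_(t in I) ((\sum_i H i t) * k t) =
      \int[mu]_(t in I) \sum_i (H i t * k t).
    by apply: eq_Rintegral => t _; rewrite mulr_suml.
  rewrite /Rintegral; under eq_integral do rewrite -sumEFin.
  rewrite (@integral_sum _ _ R mu I measurableI _ (fun i => EFin \o (fun t => H i t * k t))
    (fun i => integrableI_mul (iH i) ck)).
  rewrite -sum_fine// => i _.
  exact: integrable_fin_num (integrableI_mul (iH i) ck).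
rewrite S// S// -sumrN; apply: eq_bigr => i _; exact: Ff.
Qed.

Lemma weak_derivative_C1 v b : contI v -> contI b ->
  (forall t : R, 0 < t < 1 -> is_derive t 1 v (b t)) -> weak_derivative v b.
Proof.
move=> cv cb dv phi tphi; have [cphi cphi' dphi phi0 phi1] := test_functionP tphi.
have [cI cI'] := (continuous_contI cphi, continuous_contI cphi').
rewrite (integral_by_parts cv cI cb cI' dv (fun t _ => dphi t)).
by rewrite phi0 phi1 !mulr0 subrr sub0r.
Qed.

(** This is the form in which the velocities of embedded curves appear:
[G i] are the components of a velocity in one embedding, and [q i] are C^1
coefficients. *)
Lemma W22_of_product n (v : R -> R) (G h q q' : 'I_n -> R -> R) :
  contI v -> (forall i, contI (G i)) -> (forall i, L2 (h i)) ->
  (forall i, weak_derivative (G i) (h i)) ->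
  (forall i, contI (q i)) -> (forall i, contI (q' i)) ->
  (forall i (t : R), 0 < t < 1 -> is_derive t 1 (q i) (q' i t)) ->
  (forall t : R, 0 < t < 1 -> is_derive t 1 v (\sum_i G i t * q i t)) ->
  W2 2 v.
Proof.
move=> cv cG h2 Gh cq cq' dq dv.
have cb : contI (fun t => \sum_i G i t * q i t).
  by apply: contI_sum => i; exact: contIM.
have l2 i : L2 (fun t => h i t * q i t + G i t * q' i t).
  by apply: L2_add; [exact: L2_mul|apply: contI_L2; exact: contIM].
split; first exact: contI_L2.
exists (fun t => \sum_i G i t * q i t); split; first exact: weak_derivative_C1.
split; first exact: contI_L2.
exists (fun t => \sum_i (h i t * q i t + G i t * q' i t)); split; last exact: L2_sum.
apply: weak_derivative_sum => i.
- by apply: contI_integrable; exact: contIM.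
- exact: L2_integrable.
- by apply: weak_derivative_mul => //; exact: L2_integrable.
Qed.

End Sobolev1D.

(** * Matrices of C^1 functions *)

Section RationalClosure.
Context {R : realType}.

(** The determinant and the inverse of a matrix of functions are needed both
for functions that are continuous at a point and for functions that are C^1 near
it; this is what the two classes have in common. *)
Definition rationally_closed (t0 : R) (P : (R -> R) -> Prop) :=
  [/\ forall c, P (fun=> c),
      forall f g, P f -> P g -> P (fun t => f t + g t),
      forall f g, P f -> P g -> P (fun t => f t * g t) &
      forall f, f t0 != 0 -> P f -> P (fun t => (f t)^-1)].

Definition entrywise (P : (R -> R) -> Prop) m n (A : R -> 'M[R]_(m, n)) :=
  forall i j, P (fun t => A t i j).

Context (t0 : R) (P : (R -> R) -> Prop) (HP : rationally_closed t0 P).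

Lemma closed_sum (J : Type) (r : seq J) (p : pred J) (f : J -> R -> R) :
  (forall i, P (f i)) -> P (fun t => \sum_(i <- r | p i) f i t).
Proof.
have [Pc PD _ _] := HP => Pf; elim: r => [|i r IH].
  by under eq_fun do rewrite big_nil.
under eq_fun do rewrite big_cons.
by case: (p i) => //; exact: PD.
Qed.

Lemma closed_prod (J : Type) (r : seq J) (p : pred J) (f : J -> R -> R) :
  (forall i, P (f i)) -> P (fun t => \prod_(i <- r | p i) f i t).
Proof.
have [Pc _ PM _] := HP => Pf; elim: r => [|i r IH].
  by under eq_fun do rewrite big_nil.
under eq_fun do rewrite big_cons.
by case: (p i) => //; exact: PM.
Qed.

Lemma closed_mulmx m n p (A : R -> 'M[R]_(m, n)) (B : R -> 'M[R]_(n, p)) :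
  entrywise P A -> entrywise P B -> entrywise P (fun t => A t *m B t).
Proof.
have [_ _ PM _] := HP => PA PB i j; under eq_fun do rewrite mxE.
by apply: closed_sum => k; exact: PM.
Qed.

Lemma closed_det n (A : R -> 'M[R]_n) : entrywise P A -> P (fun t => \det (A t)).
Proof.
have [Pc _ PM _] := HP => PA; apply: closed_sum => s.
by apply: PM => //; apply: closed_prod => i; exact: PA.
Qed.

Lemma closed_right_inverse m n (A : R -> 'M[R]_(m, n)) B :
  A t0 *m B = 1%:M -> entrywise P A -> entrywise P (fun t => right_inverse_mx (A t)).
Proof.
have [Pc _ PM PV] := HP => AB PA.
have PT : entrywise P (fun t => (A t)^T) by move=> i j; under eq_fun do rewrite mxE; exact: PA.
have PG := closed_mulmx PA PT.
apply: closed_mulmx => // i j; under eq_fun do rewrite 2!mxE.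
apply: (PM); first apply: (PV).
- by have := gram_unit AB; rewrite unitmxE unitfE.
- exact: closed_det.
- by apply: (PM) => //; apply: closed_det => k l; under eq_fun do rewrite 2!mxE.
Qed.

End RationalClosure.

(** * Functions that are C^1 up to the end points *)

Section LocalC1.
Context {R : realType}.
Local Notation I := (II : set R).
Local Notation F t0 := (within I (nbhs (t0 : R))).

(** Being C^1 near [t0], end points of the interval included: the derivative
is only taken at interior times, but [c'] is continuous at [t0] from within the
interval. *)
Definition C1near (V : normedModType R) (t0 : R) (c c' : R -> V) :=
  [/\ c t @[t --> F t0] --> c t0, c' t @[t --> F t0] --> c' t0 &
      \forall t \near F t0, (0 : R) < t < 1 -> is_derive t 1 c (c' t)].

Definition C1at (t0 : R) (q : R -> R) := exists q', C1near t0 q q'.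
Definition continuous_within_at (t0 : R) (q : R -> R) := q t @[t --> F t0] --> q t0.

Lemma filter_within_II (t0 : R) : Filter (F t0).
Proof. exact: within_filter. Qed.

Lemma C1at_continuous_within (t0 : R) q : C1at t0 q -> continuous_within_at t0 q.
Proof. by case=> q' []. Qed.

Lemma continuous_within_at_closed (t0 : R) : rationally_closed t0 (continuous_within_at t0).
Proof.
split=> [c|f g|f g|f f0]; rewrite /continuous_within_at; first exact: cvg_cst.
- exact: cvgD.
- exact: cvgM.
- exact: cvgV.
Qed.

Lemma C1at_closed (t0 : R) : rationally_closed t0 (C1at t0).
Proof.
split=> [c|f g [f' [cf cf' df]] [g' [cg cg' dg]]|f g [f' [cf cf' df]] [g' [cg cg' dg]]
  |f f0 [f' [cf cf' df]]].
- exists (fun=> 0); split; [exact: cvg_cst|exact: cvg_cst|].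
  by apply: nearW => t _; exact: is_derive_cst.
- exists (fun t => f' t + g' t); split; [exact: cvgD|exact: cvgD|].
  by apply: filterS2 df dg => t df dg tI; exact: is_deriveD (df tI) (dg tI).
- exists (fun t => f' t * g t + f t * g' t); split; first exact: cvgM.
    by apply: cvgD; exact: cvgM.
  by apply: filterS2 df dg => t df dg tI; exact: is_derive_mulr (df tI) (dg tI).
- exists (fun t => - (f t)^-1 ^+ 2 * f' t); split; first exact: cvgV.
    apply: cvgM => //; apply: cvgN; rewrite expr2.
    under eq_fun do rewrite expr2.
    by apply: cvgM; exact: cvgV.
  have fn0 : \forall t \near F t0, f t != 0 by exact: cvgr_neq0 cf f0.
  apply: filterS2 df fn0 => t df ft tI.
  have := is_deriveV ft (df tI); rewrite -exprVn; exact.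
Qed.

(** At an interior time, a neighborhood within the interval is a
neighborhood. *)
Lemma near_within_interior (t0 : R) (p : set R) : (\forall t \near F t0, p t) ->
  \forall t \near F t0, (0 : R) < t < 1 -> \forall s \near t, p s.
Proof.
move=> /near_join; rewrite /within /=; apply: filterS => t h _ tI.
have := @near_in_itvoo _ 0 1 t; rewrite in_itv/= tI => /(_ isT) hI.
by apply: filterS2 h hI => s h; rewrite in_itv/= => /andP[s0 s1]; apply: h; rewrite /= in_itv/= !ltW.
Qed.

Lemma C1at_near_eq (t0 : R) q k : I t0 -> (\forall t \near F t0, q t = k t) ->
  C1at t0 q -> C1at t0 k.
Proof.
move=> It0 qk [q' [cq cq' dq]]; exists q'.
have E0 : q t0 = k t0 by move: (nbhs_singleton qk); exact.
split=> //.
  rewrite -E0; apply: cvg_trans cq; apply: near_eq_cvg.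
  by apply: filterS qk => t ->.
apply: filterS2 dq (near_within_interior qk) => t d e tI.
by apply: near_eq_is_derive (d tI); exact: e.
Qed.

(** At interior times the local derivatives agree, by uniqueness. At an
end point the value is the one of the local derivative there, and this choice is
harmless because a small neighborhood of [t0] contains no other end point. *)
Lemma C1at_glue q : (forall t0, I t0 -> C1at t0 q) ->
  contI q /\ exists q', contI q' /\ forall t : R, 0 < t < 1 -> is_derive t 1 q (q' t).
Proof.
move=> H; have /choice[D HD] t0 : exists q', I t0 -> C1near t0 q q'.
  have [It0|nI] := pselect (I t0); last by exists q.
  by have [q' hq'] := H _ It0; exists q'.
(* [D t0] is the derivative near [t0], and [fun t => D t t] the global one. *)
have dD (t : R) : 0 < t < 1 -> is_derive t 1 q (D t t).
  move=> tI; have It : I t by move: tI => /andP[? ?]; rewrite /= in_itv/= !ltW.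
  by have [_ _ /nbhs_singleton] := HD _ It; apply.
split.
  by apply/subspace_continuousP => t0 /HD[].
exists (fun t => D t t); split=> //.
apply/subspace_continuousP => t0 It0; have [_ c d] := HD _ It0.
apply: cvg_trans c; apply: near_eq_cvg.
have ne (a : R) : \forall t \near F t0, t = a -> t0 = a.
  have [->|ta] := eqVneq t0 a; first exact: nearW.
  have r0 : 0 < `|t0 - a| by rewrite normr_gt0 subr_eq0.
  apply: cvg_within; apply: filterS (nbhsx_ballx t0 _ r0) => t + e.
  by rewrite e -ball_normE /= ltxx.
have nI : \forall t \near F t0, I t by apply: withinT.
apply: filterS2 (filterI (ne 0) (ne 1)) (filterI d nI) => t [n0 n1] [dt].
rewrite /= in_itv/= => /andP[]; rewrite le_eqVlt => /orP[/eqP t0E _|tgt].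
  by rewrite (n0 (esym t0E)) t0E.
rewrite le_eqVlt => /orP[/eqP t1E|tlt]; first by rewrite (n1 t1E) t1E.
have tI : 0 < t < 1 by rewrite tgt.
exact: is_derive_uniq (dt tI) (dD t tI).
Qed.

Lemma C1at_jacobian m n (U : set 'rV[R]_m) (f : 'rV[R]_m -> 'rV[R]_n) (t0 : R) c c' :
  open U -> Ck 2 U f -> U (c t0) -> C1near t0 c c' -> entrywise (C1at t0) (fun t => 'J f (c t)).
Proof.
move=> oU C2 U0 [cc cc' dc] i j; have [df C1f] := C2.
exists (fun t => (c' t *m 'J ('D_(delta_mx 0 i) f) (c t)) 0 j); split.
- have := cvg_comp c (jacobian f) cc (continuous_jacobian oU (Ck2_Ck1 C2) U0).
  by move=> /cvg_mxP/(_ i j).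
- have := cvg_comp c (jacobian ('D_(delta_mx 0 i) f)) cc (continuous_jacobian oU (C1f _) U0).
  by move=> h; have H := cvg_mulmx cc' h; have /cvg_mxP := H (filter_within_II t0); exact.
- have nU : \forall t \near F t0, U (c t) by apply: cc; exact: open_nbhs_nbhs.
  apply: filterS2 dc nU => t d Ut tI.
  have /is_derive_mxP/(_ i j) := is_derive_jacobian oU C2 Ut (d tI).
  by rewrite mxE.
Qed.

Lemma continuous_within_at_jacobian m n (U : set 'rV[R]_m) (f : 'rV[R]_m -> 'rV[R]_n) (t0 : R) c :
  open U -> Ck 1 U f -> U (c t0) -> c t @[t --> F t0] --> c t0 ->
  entrywise (continuous_within_at t0) (fun t => 'J f (c t)).
Proof.
move=> oU C1 U0 cc i j.
have := cvg_comp c (jacobian f) cc (continuous_jacobian oU C1 U0).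
by move=> /cvg_mxP/(_ i j).
Qed.

End LocalC1.

(** * Independence of W^{2,2} from the embedding *)

Section EmbeddedCurves.
Context {R : realType}.
Local Notation I := (II : set R).
Local Notation F t0 := (within I (nbhs (t0 : R))).

(** The differential of the inverse of [Phi] on the image of [N],
precomposed with the orthogonal projection onto the tangent space of this image:
it takes the velocity of [Phi \o c] to that of [c]. *)
Definition inverse_jacobian m n p (Phi : 'rV[R]_n -> 'rV[R]_p) (phi : 'rV[R]_m -> 'rV[R]_n)
    (u : 'rV[R]_m) : 'M[R]_(p, n) :=
  right_inverse_mx ('J (Phi \o phi) u) *m 'J phi u.

Lemma jacobian_transition m n p N (U W : set 'rV[R]_m) (phi psi : 'rV[R]_m -> 'rV[R]_n)
    (Phi : 'rV[R]_n -> 'rV[R]_p) u w :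
  chart N U phi -> chart N W psi -> U u -> W w -> phi u = psi w ->
  differentiable (Phi \o phi) u -> differentiable (Phi \o psi) w ->
  exists T : 'M[R]_m, 'J phi u = T *m 'J psi w /\ 'J (Phi \o phi) u = T *m 'J (Phi \o psi) w.
Proof.
move=> cphi cpsi Uu Ww E d1 d2.
have [k hk] := choice (tangent_transition cphi cpsi Uu Ww E d1 d2).
exists (\matrix_i k (delta_mx 0 i)).
by split; apply/row_matrixP => i; rewrite row_mul rowK rowE; have [] := hk (delta_mx 0 i).
Qed.

(** With [A] and [B] the Jacobian matrices of [Phi \o phi] and [phi], the
matrix is the only solution of [A *m X = B] of the form [X = A^T *m Y]. A change
of chart multiplies [A] and [B] on the left by the same invertible matrix, which
affects neither condition. *)
Lemma inverse_jacobian_chart_indep m n p N (U W : set 'rV[R]_m) (phi psi : 'rV[R]_m -> 'rV[R]_n)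
    (Phi : 'rV[R]_n -> 'rV[R]_p) u w :
  embedding m N Phi -> chart N U phi -> chart N W psi -> U u -> W w -> phi u = psi w ->
  inverse_jacobian Phi phi u = inverse_jacobian Phi psi w.
Proof.
move=> [hPhi _] cphi cpsi Uu Ww E.
have [[d1 _] i1] := hPhi _ _ cphi; have [[d2 _] i2] := hPhi _ _ cpsi.
have [P1 AP1] := injective_right_inverse (i1 _ Uu).
have [P2 AP2] := injective_right_inverse (i2 _ Ww).
have [T [BT AT]] := jacobian_transition cphi cpsi Uu Ww E (d1 _ Uu) (d2 _ Ww).
have [T' [_ AT']] := jacobian_transition cpsi cphi Ww Uu (esym E) (d2 _ Ww) (d1 _ Uu).
have K1 := right_inverse_mxE AP1; have K2 := right_inverse_mxE AP2.
have G1 := gram_unit AP1.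
rewrite /inverse_jacobian.
move: ('J (Phi \o phi) u) ('J (Phi \o psi) w) ('J phi u) ('J psi w) BT AT AT' K1 K2 G1.
clear => A A' B B' BT AT AT' K1 K2 G1.
apply/eqP; rewrite -subr_eq0; apply/eqP.
(* [X] lies in the range of [A^T] and [A *m X = 0]. *)
set X := _ - _.
have AX : A *m X = 0.
  by rewrite mulmxBr mulmxA K1 mul1mx [in X in _ - X]AT -mulmxA (mulmxA A') K2 mul1mx -BT subrr.
have [Y XY] : exists Y, X = A^T *m Y.
  exists ((\det (A *m A^T))^-1 *: \adj (A *m A^T) *m B -
     T'^T *m ((\det (A' *m A'^T))^-1 *: \adj (A' *m A'^T) *m B')).
  rewrite mulmxBr [A^T *m (T'^T *m _)]mulmxA -trmx_mul -AT' /X /right_inverse_mx.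
  by rewrite !mulmxA.
by rewrite XY -[Y]mul1mx -(mulVmx G1) -mulmxA -[A *m A^T *m Y]mulmxA -XY AX !mulmx0.
Qed.

Lemma W22_velocity p (f : R -> 'rV[R]_p) : (forall i, contI (fun t => f t 0 i)) -> W22 f ->
  exists G h : 'I_p -> R -> R,
  [/\ forall i, contI (G i), forall i, L2 (h i), forall i, weak_derivative (G i) (h i) &
      forall t : R, 0 < t < 1 -> is_derive t 1 f (\row_i G i t)].
Proof.
move=> cf Wf.
have /choice[G hG] : forall i, exists Gi, exists hi, [/\ contI Gi, L2 hi, weak_derivative Gi hi &
    forall t : R, 0 < t < 1 -> is_derive t 1 (fun t => f t 0 i) (Gi t)].
  by move=> i; exact: W22_regular (cf i) (Wf i).
have /choice[h hh] := hG.
exists G, h; split=> [i|i|i|t tI]; try by case: (hh i).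
by apply/is_derive_mxP => i j; rewrite ord1 mxE; have [_ _ _] := hh j; exact.
Qed.

(** The coordinates [z] of the curve in a chart are obtained from
[Phi \o c] by lifting through the immersion [Phi \o phi], so that they are C^1
like [Phi \o c]; Jacobian matrices of C^2 maps along them are then C^1. The
matrix [Q] gathers these local data in a function defined on the whole interval,
because it does not depend on the chart. *)
Lemma W22_embedding_change m n p q N (Phi : 'rV[R]_n -> 'rV[R]_p)
    (Psi : 'rV[R]_n -> 'rV[R]_q) (c : R -> 'rV[R]_n) :
  submanifold m N -> embedding m N Phi -> Ck 2 setT Psi ->
  {within I, continuous c} -> (forall t, I t -> N (c t)) -> W22 (Phi \o c) -> W22 (Psi \o c).
Proof.
move=> sN ePhi C2Psi cc Nc Wf.
have [_ [cPhi _]] := ePhi.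
have ccF (t0 : R) : I t0 -> c t @[t --> F t0] --> c t0.
  by move=> It0; move/subspace_continuousP: cc; exact.
have nN (t0 : R) : \forall t \near F t0, N (c t).
  by apply: filterS (withinT I _) => t /Nc.
have cf i : contI (fun t => (Phi \o c) t 0 i).
  apply/subspace_continuousP => t0 It0.
  have := within_cvg cPhi (Nc _ It0) (ccF _ It0) (nN t0).
  by move=> /(_ (filter_within_II t0))/cvg_mxP/(_ 0 i).
have [G [h [cG h2 Gh df]]] := W22_velocity cf Wf.
have cGF (t0 : R) : I t0 -> (\row_i G i t) @[t --> F t0] --> \row_i G i t0.
  move=> It0; apply/cvg_mxP => i j; rewrite mxE; under eq_fun do rewrite mxE.
  by have /subspace_continuousP := cG j; exact.
have /choice[Q hQ] (t : R) : exists Q : 'M[R]_(p, n), I t ->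
    forall (U : set 'rV[R]_m) (phi : 'rV[R]_m -> 'rV[R]_n) u,
    chart N U phi -> U u -> phi u = c t -> Q = inverse_jacobian Phi phi u.
  have [It|nI] := pselect (I t); last by exists 0.
  have [U [phi [cphi [u Uu E]]]] := sN _ (Nc _ It).
  exists (inverse_jacobian Phi phi u) => _ W psi w cpsi Ww E'.
  by apply: inverse_jacobian_chart_indep ePhi cphi cpsi Uu Ww _; rewrite E.
have local (t0 : R) : I t0 -> entrywise (C1at t0) Q /\
    \forall t \near F t0, (0 : R) < t < 1 -> is_derive t 1 c (\row_i G i t *m Q t).
  move=> It0; have [U [phi [cphi [u0 Uu0 E0]]]] := sN _ (Nc _ It0).
  have [oU C2phi imphi _ _] := cphi; have [dphi _] := C2phi.
  have [C2F iF] := ePhi.1 _ _ cphi; have [dF _] := C2F.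
  have [g [V [oV phiNV gN cg]]] := chart_inverse cphi.
  pose z t := g (c t).
  have Vc0 : V (c t0) by rewrite -E0; have [] := phiNV _ Uu0.
  have nV : \forall t \near F t0, V (c t) by apply: (ccF _ It0); exact: open_nbhs_nbhs.
  have nz : \forall t \near F t0, U (z t) /\ phi (z t) = c t.
    by apply: filterS2 (nN t0) nV => t; exact: gN.
  have cz : z t @[t --> F t0] --> z t0.
    apply: (within_cvg (A := N `&` V)) cg _ (ccF _ It0) _; first by split=> //; exact: Nc.
    by apply: filterS2 (nN t0) nV => t.
  have [Uz0 z0E] : U (z t0) /\ phi (z t0) = c t0.
    exact: gN (Nc _ It0) Vc0.
  pose A t := 'J (Phi \o phi) (z t).
  have RA t : U (z t) -> A t *m right_inverse_mx (A t) = 1%:M.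
    by move=> Uz; have [P AP] := injective_right_inverse (iF _ Uz); exact: right_inverse_mxE AP.
  have cA : entrywise (continuous_within_at t0) A.
    exact: continuous_within_at_jacobian oU (Ck2_Ck1 C2F) Uz0 cz.
  (* Continuity of the right inverse is needed before its C^1 regularity, to
     see that [z] is C^1. *)
  have cRA := closed_right_inverse (continuous_within_at_closed t0) (RA _ Uz0) cA.
  have ninn := near_within_interior (filterI (filterI (nN t0) nV) nz).
  have {}ninn := ninn (filter_within_II t0) (filter_within_II t0).
  have nI : \forall t \near F t0, I t by exact: withinT.
  have dz : C1near t0 z (fun t => \row_i G i t *m right_inverse_mx (A t)).
    split=> //.
      have cRA' : right_inverse_mx (A t) @[t --> F t0] --> right_inverse_mx (A t0).
        by apply/cvg_mxP => i j; exact: cRA.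
      have H := cvg_mulmx (cGF _ It0) cRA'; exact: (H (filter_within_II t0)).
    apply: filterS ninn => t nt tI; have {}nt := nt tI.
    have [[Nct Vct] [Uzt zE]] := nbhs_singleton nt.
    apply: (is_derive_lift (F := Phi \o phi)); first exact: dF.
    - exact: RA.
    - have cct : {for t, continuous c}.
        by apply: (within_continuous_continuous ltr01 cc); rewrite in_itv.
      have NVt : \forall s \near t, (N `&` V) (c s) by apply: filterS nt => s [].
      exact: within_cvg cg (conj Nct Vct) cct NVt.
    - apply: near_eq_is_derive (df t tI).
      by apply: filterS nt => s [_ [_ e]]; rewrite /= e.
  have C1A : entrywise (C1at t0) A.
    exact: C1at_jacobian oU C2F Uz0 dz.
  have C1B : entrywise (C1at t0) (fun t => 'J phi (z t)).
    exact: C1at_jacobian oU C2phi Uz0 dz.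
  have C1RA := closed_right_inverse (C1at_closed t0) (RA _ Uz0) C1A.
  have QE : \forall t \near F t0, Q t = right_inverse_mx (A t) *m 'J phi (z t).
    by apply: filterS2 nI nz => t It [Uz E]; exact: (hQ t It U phi).
  split.
    move=> i j; apply: (C1at_near_eq It0 _ (closed_mulmx (C1at_closed t0) C1RA C1B i j)).
    by apply: filterS QE => t ->.
  have [_ _ ddz] := dz.
  apply: filterS2 ddz (filterI ninn QE) => t d [nt Qt] tI.
  have {}nt := nt tI; have [_ [Uzt _]] := nbhs_singleton nt.
  rewrite Qt mulmxA.
  apply: near_eq_is_derive (is_derive_compv (dphi _ Uzt) (d tI)).
  by apply: filterS nt => s [_ [_ e]]; rewrite /= e.
pose E t := 'J Psi (c t).
have C1QE (t0 : R) : I t0 -> entrywise (C1at t0) (fun t => Q t *m E t).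
  move=> It0; have [C1Q dc] := local _ It0.
  apply: (closed_mulmx (C1at_closed t0)) => //.
  have dcc : C1near t0 c (fun t => \row_i G i t *m Q t).
    split=> //; first exact: ccF.
    have cQ : Q t @[t --> F t0] --> Q t0.
      by apply/cvg_mxP => i j; exact: C1at_continuous_within (C1Q i j).
    have H := cvg_mulmx (cGF _ It0) cQ; exact: (H (filter_within_II t0)).
  by apply: C1at_jacobian openT C2Psi _ dcc.
have dPsi : forall x, differentiable Psi x by move=> x; exact: C2Psi.1.
have dv (t : R) : 0 < t < 1 -> is_derive t 1 (Psi \o c) (\row_i G i t *m (Q t *m E t)).
  move=> tI; have It : I t by move: tI => /andP[? ?]; rewrite /= in_itv/= !ltW.
  have [_ /nbhs_singleton/(_ It tI) dc] := local _ It.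
  by rewrite mulmxA; exact: is_derive_compv (dPsi _) dc.
move=> j.
have glue i := C1at_glue (fun t0 It0 => C1QE t0 It0 i j).
have /choice[q' hq'] : forall i, exists q', contI q' /\
    forall t : R, 0 < t < 1 -> is_derive t 1 (fun t => (Q t *m E t) i j) (q' t).
  by move=> i; case: (glue i).
apply: (@W22_of_product _ p _ G h (fun i t => (Q t *m E t) i j) q') => //.
- apply/subspace_continuousP => t0 It0.
  have H : Psi (c t) @[t --> F t0] --> Psi (c t0).
    exact: cvg_comp (ccF _ It0) (differentiable_continuous (dPsi _)).
  by move: H => /cvg_mxP/(_ 0 j).
- by move=> i; case: (glue i).
- by move=> i; case: (hq' i).
- by move=> i; case: (hq' i).
move=> t tI; have /is_derive_mxP/(_ 0 j) := dv t tI.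
rewrite mxE; under eq_bigr do rewrite mxE; exact.
Qed.

End EmbeddedCurves.

(** * The theorem *)

Theorem proposition4p4 (R : realType) (m n : nat) (M S : set 'rV[R]_n)
    (PhiM : 'rV[R]_n -> 'rV[R]_((2 * m).+1))
    (PhiE : 'rV[R]_n -> 'rV[R]_((2 * n).+1))
    (gamma : R -> 'rV[R]_n)
    (hM : submanifold m M) (hMc : complete_metric M)
    (hPhiM : embedding m M PhiM) (hPhiE : embedding n setT PhiE)
    (hSM : S `<=` M) (hS0 : S !=set0) (hScl : closed_in M S)
    (hSpr : prox_regular m M S) :
  weak_geodesic m M PhiM S gamma -> weak_geodesic n setT PhiE S gamma.
Proof.
move=> [cg Sg Wg acc]; split=> //.
  have [C2E _] := hPhiE.1 _ _ (chart_id _).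
  by apply: (W22_embedding_change hM hPhiM C2E cg _ Wg) => t /Sg/hSM.
apply: filterS acc; first exact: (ae_filter_ringOfSetsType lebesgue_measure).
move=> t acc It; have [w cw pw] := acc It.
by exists (derive1 (derive1 gamma) t); have [] := proximal_acceleration hSM cw pw.
Qed.
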